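(* Let $H$ be a Hopf algebra over a field $k$ with bijective antipode. The assignments $A\mapsto H/HA^+$ and $C\mapsto{}^{\mathrm{co}\,C}H$ give mutually inverse bijections between the set of right coideal subalgebras $A$ of $H$ such that all objects of $\mathcal M_A^H$ are projective as right $A$-modules and the set of left $H$-module factor coalgebras $C$ of $H$ such that all objects of ${}_H^C\mathcal M$ are injective as left $C$-comodules. The same assignments also give mutually inverse bijections between the set of right coideal subalgebras $A$ of $H$ such that all objects of ${}_A\mathcal M^H$ are projective as left $A$-modules and the set of left $H$-module factor coalgebras $C$ of $H$ such that all objects of ${}_H\mathcal M^C$ are injective as right $C$-comodules.
   Context: $\Delta,\varepsilon$ are the comultiplication and counit of $H$. A right coideal subalgebra of $H$ is a subalgebra $A\subset H$ with $\Delta(A)\subset A\otimes H$; $A^+=A\cap\ker\varepsilon$. A left $H$-module factor coalgebra of $H$ is a quotient $C=H/I$ where $I$ is both a coideal and a left ideal of $H$; $\pi:H\to C$ is the canonical map, $1_C=\pi(1)$, ${}^{\mathrm{co}\,C}H=\{h\in H\mid(\pi\otimes\mathrm{id})\Delta(h)=1_C\otimes h\}$. The assignments $A\mapsto H/HA^+$, $C\mapsto{}^{\mathrm{co}\,C}H$ form Takeuchi's correspondence. Categories of relative Hopf modules (morphisms are the linear maps compatible with both structures; Sweedler notation): $\mathcal M_A^H$: right $A$-modules $M$ with a right $H$-comodule structure $\rho$ such that $\rho(ma)=\sum m_{(0)}a_{(1)}\otimes m_{(1)}a_{(2)}$; ${}_A\mathcal M^H$: left $A$-modules $M$ with a right $H$-comodule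 structure $\rho$ such that $\rho(am)=\sum a_{(1)}m_{(0)}\otimes a_{(2)}m_{(1)}$; ${}_H^C\mathcal M$: left $H$-modules $M$ with a left $C$-comodule structure $\lambda$ such that $\lambda(hm)=\sum h_{(1)}m_{(-1)}\otimes h_{(2)}m_{(0)}$; ${}_H\mathcal M^C$: left $H$-modules $M$ with a right $C$-comodule structure $\rho$ such that $\rho(hm)=\sum h_{(1)}m_{(0)}\otimes h_{(2)}m_{(1)}$. Here $\Delta(x)=\sum x_{(1)}\otimes x_{(2)}$ for $x\in H$. *)

(* Defs.v *)
From HB Require Import structures.
From mathcomp Require Import all_boot all_order all_algebra.
From mathcomp Require Import boolp classical_sets.

Set Implicit Arguments.
Unset Strict Implicit.
Unset Printing Implicit Defensive.

Import GRing.Theory.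

Local Open Scope ring_scope.
Local Open Scope quotient_scope.

Section LinearSpan.
Variables (k : fieldType) (V : lmodType k).

Definition lspan (X : set V) : {pred V} := [pred v | `[< exists n (c : 'I_n -> k)
  (x : 'I_n -> V), (forall i, X (x i)) /\ v = \sum_(i < n) c i *: x i >]].

Lemma lspan_closed (X : set V) : submod_closed (lspan X).
Proof.
split.
  by apply/asboolP; exists 0, (fun=> 0), (fun=> 0); split => [[]//|]; rewrite big_ord0.
move=> a _ _ /asboolP[n [c [x [Xx ->]]]] /asboolP[m [d [y [Xy ->]]]].
apply/asboolP; exists (n + m)%N.
exists (fun i => match split i with inl j => a * c j | inr j => d j end).
exists (fun i => match split i with inl j => x j | inr j => y j end).
split; first by move=> i; case: (split i).
rewrite big_split_ord /= scaler_sumr; congr (_ + _); apply: eq_bigr => i _.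
  by rewrite (unsplitK (inl i)) scalerA.
by rewrite (unsplitK (inr i)).
Qed.

HB.instance Definition _ (X : set V) := GRing.isSubmodClosed.Build k V (lspan X)
  (GRing.submod_closed_semi (lspan_closed X)).

Lemma lspan_gen (X : set V) v : X v -> v \in lspan X.
Proof.
move=> Xv; apply/asboolP; exists 1, (fun=> 1), (fun=> v); split=> //.
by rewrite big_ord1 scale1r.
Qed.

Lemma lspan_min (X : set V) (S : submodClosed V) :
  (forall v, X v -> v \in S) -> {subset lspan X <= S}.
Proof.
move=> XS _ /asboolP[n [c [x [Xx ->]]]].
by apply: rpred_sum => i _; apply: rpredZ; apply: XS.
Qed.

Lemma lspan_map (W : lmodType k) (f : {linear V -> W}) (X : set V) (S : submodClosed W) :
  (forall v, X v -> f v \in S) -> forall v, v \in lspan X -> f v \in S.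
Proof.
move=> XS _ /asboolP[n [c [x [Xx ->]]]]; rewrite linear_sum.
by apply: rpred_sum => i _; rewrite linearZ; apply: rpredZ; apply: XS.
Qed.

End LinearSpan.

Section QuotientSpace.
Variables (k : fieldType) (V : lmodType k) (S : submodClosed V).

Definition lquot_pred : {pred V} := S.
HB.instance Definition _ := GRing.isZmodClosed.Build V lquot_pred
  (GRing.submod_closedB (submodClosedP S)).

Definition lquot : Type := Quotient.quot lquot_pred.
HB.instance Definition _ := GRing.Zmodule.on lquot.
HB.instance Definition _ : EqQuotient V (Quotient.equiv lquot_pred) lquot :=
  EqQuotient.on lquot.

Definition lproj (v : V) : lquot := \pi v.

Lemma lproj_eq x y : (lproj x == lproj y) = (x - y \in S).
Proof. by rewrite /lproj -(Quotient.idealrBE lquot_pred). Qed.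

Lemma lproj_repr q : lproj (repr q) = q. Proof. exact: reprK. Qed.

Lemma lprojD x y : lproj (x + y) = lproj x + lproj y.
Proof. exact: (Quotient.pi_add lquot_pred). Qed.

Definition lquot_scale (a : k) (q : lquot) : lquot := lproj (a *: repr q).

Lemma lquot_scaleE a v : lquot_scale a (lproj v) = lproj (a *: v).
Proof.
apply/eqP; rewrite lproj_eq -scalerBr rpredZ // -lproj_eq.
by rewrite lproj_repr.
Qed.

Let scaleA a b q : lquot_scale a (lquot_scale b q) = lquot_scale (a * b) q.
Proof. by rewrite -[q]lproj_repr !lquot_scaleE scalerA. Qed.
Let scale1 : left_id 1 lquot_scale.
Proof. by move=> q; rewrite -[q]lproj_repr lquot_scaleE scale1r. Qed.
Let scaleDr : right_distributive lquot_scale +%R.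
Proof.
move=> a p q; rewrite -[p]lproj_repr -[q]lproj_repr -lprojD !lquot_scaleE.
by rewrite scalerDr lprojD.
Qed.
Let scaleDl q : {morph lquot_scale^~ q : a b / a + b}.
Proof. by move=> a b; rewrite -[q]lproj_repr !lquot_scaleE scalerDl lprojD. Qed.

HB.instance Definition _ :=
  GRing.Zmodule_isLmodule.Build k lquot scaleA scale1 scaleDr scaleDl.

Lemma lproj_is_linear : linear lproj.
Proof. by move=> a x y; rewrite lprojD -lquot_scaleE. Qed.
HB.instance Definition _ := GRing.isLinear.Build k V lquot *:%R lproj lproj_is_linear.

End QuotientSpace.

(* Tensor product of vector spaces: formal sums of pairs (the free commutative
   monoid on U * V) modulo the bilinearity relations. *)
Section TensorProduct.
Variables (k : fieldType) (U V : lmodType k).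
Implicit Types (s t : seq (U * V)) (u : U) (v : V) (a : k).

Inductive tens_eq : seq (U * V) -> seq (U * V) -> Prop :=
| tens_eq_refl s : tens_eq s s
| tens_eq_sym s t : tens_eq s t -> tens_eq t s
| tens_eq_trans s t r : tens_eq s t -> tens_eq t r -> tens_eq s r
| tens_eq_cat s s' t t' : tens_eq s s' -> tens_eq t t' -> tens_eq (s ++ t) (s' ++ t')
| tens_eq_catC s t : tens_eq (s ++ t) (t ++ s)
| tens_eqDl u u' v : tens_eq [:: (u + u', v)] [:: (u, v); (u', v)]
| tens_eqDr u v v' : tens_eq [:: (u, v + v')] [:: (u, v); (u, v')]
| tens_eqZ a u v : tens_eq [:: (a *: u, v)] [:: (u, a *: v)]
| tens_eq0 v : tens_eq [:: (0, v)] [::].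

Definition tens_eqb s t : bool := `[< tens_eq s t >].

Let tens_eqb_equiv : equiv_class_of tens_eqb.
Proof.
split=> [s|s t|t s r].
- exact/asboolP/tens_eq_refl.
- by apply/asboolP/asboolP => /tens_eq_sym.
- by move=> /asboolP st /asboolP tr; apply/asboolP/(tens_eq_trans st tr).
Qed.
Canonical tens_eqb_equivRel := EquivRelPack tens_eqb_equiv.
Canonical tens_eqb_encModRel := defaultEncModRel tens_eqb.

Definition tensor : Type := {eq_quot tens_eqb}.
HB.instance Definition _ : EqQuotient _ tens_eqb tensor := EqQuotient.on tensor.
HB.instance Definition _ := Choice.on tensor.

Definition tclass s : tensor := \pi s.

Lemma tclassP s t : tclass s = tclass t <-> tens_eq s t.
Proof.
split=> [/eqP|st]; first by rewrite piE => /asboolP.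
by apply/eqP; rewrite piE; apply/asboolP.
Qed.

Lemma tclass_repr x : tclass (repr x) = x. Proof. exact: reprK. Qed.
Lemma repr_tclass s : tens_eq (repr (tclass s)) s.
Proof. by apply/tclassP; rewrite tclass_repr. Qed.

Definition tscales a s := [seq (a *: p.1, p.2) | p <- s].

Definition tzero : tensor := tclass [::].
Definition tadd (x y : tensor) : tensor := tclass (repr x ++ repr y).
Definition tscale a (x : tensor) : tensor := tclass (tscales a (repr x)).
Definition topp (x : tensor) : tensor := tscale (-1) x.

Lemma tens_eq_scales a s t : tens_eq s t -> tens_eq (tscales a s) (tscales a t).
Proof.
elim=> {s t} [s|s t _|s t r _ + _|s s' t t' _ + _|s t|u u' v|u v v'|b u v|v] /=.
- exact: tens_eq_refl.
- exact: tens_eq_sym.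
- exact: tens_eq_trans.
- by rewrite /tscales !map_cat; exact: tens_eq_cat.
- by rewrite /tscales !map_cat; exact: tens_eq_catC.
- by rewrite scalerDr; exact: tens_eqDl.
- exact: tens_eqDr.
- by rewrite scalerA mulrC -scalerA; exact: tens_eqZ.
- by rewrite scaler0; exact: tens_eq0.
Qed.

Lemma taddE s t : tadd (tclass s) (tclass t) = tclass (s ++ t).
Proof. by apply/tclassP; apply: tens_eq_cat; apply: repr_tclass. Qed.
Lemma tscaleE a s : tscale a (tclass s) = tclass (tscales a s).
Proof. by apply/tclassP; apply: tens_eq_scales; apply: repr_tclass. Qed.

Let taddA : associative tadd.
Proof.
move=> x y z; rewrite -[x]tclass_repr -[y]tclass_repr -[z]tclass_repr !taddE.
by rewrite catA.
Qed.
Let taddC : commutative tadd.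
Proof.
move=> x y; rewrite -[x]tclass_repr -[y]tclass_repr !taddE.
exact/tclassP/tens_eq_catC.
Qed.
Let tadd0 : left_id tzero tadd.
Proof. by move=> x; rewrite -[x]tclass_repr taddE. Qed.

Lemma tens_eq_scalesDl a b s :
  tens_eq (tscales (a + b) s) (tscales a s ++ tscales b s).
Proof.
elim: s => [|[u v] s IH] /=; first exact: tens_eq_refl.
apply: (@tens_eq_trans _ ([:: (a *: u, v); (b *: u, v)] ++ (tscales a s ++ tscales b s))).
  rewrite -cat1s; apply: tens_eq_cat => //.
  by rewrite scalerDl; exact: tens_eqDl.
rewrite /= -(cat1s (a *: u, v)) -(cat1s (a *: u, v) (_ ++ _)).
apply: tens_eq_cat; first exact: tens_eq_refl.
rewrite -cat1s -[X in tens_eq _ (_ ++ X)]cat1s !catA.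
by apply: tens_eq_cat; [exact: tens_eq_catC | exact: tens_eq_refl].
Qed.

Lemma tens_eq_scales0 s : tens_eq (tscales 0 s) [::].
Proof.
elim: s => [|[u v] s IH] /=; first exact: tens_eq_refl.
rewrite -cat1s -[X in tens_eq _ X](cats0 [::]); apply: tens_eq_cat => //.
by rewrite scale0r; exact: tens_eq0.
Qed.

Lemma tscales1 s : tscales 1 s = s.
Proof. by rewrite -[RHS]map_id; apply: eq_map => -[u v] /=; rewrite scale1r. Qed.

Let taddN : left_inverse tzero topp tadd.
Proof.
move=> x; rewrite -[x]tclass_repr /topp tscaleE taddE; apply/tclassP.
rewrite -[X in _ ++ X]tscales1.
apply: tens_eq_trans (tens_eq_sym (tens_eq_scalesDl _ _ _)) _.
by rewrite addNr; exact: tens_eq_scales0.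
Qed.

HB.instance Definition _ := GRing.isZmodule.Build tensor taddA taddC tadd0 taddN.

Let tscaleA a b x : tscale a (tscale b x) = tscale (a * b) x.
Proof.
rewrite -[x]tclass_repr !tscaleE; congr tclass.
by rewrite /tscales -map_comp; apply: eq_map => -[u v] /=; rewrite scalerA.
Qed.
Let tscale1 : left_id 1 tscale.
Proof. by move=> x; rewrite -[x]tclass_repr tscaleE tscales1. Qed.
Let tscaleDr : right_distributive tscale +%R.
Proof.
move=> a x y; rewrite -[x]tclass_repr -[y]tclass_repr.
rewrite [_ + _]taddE !tscaleE [RHS]taddE.
by rewrite /tscales map_cat.
Qed.
Let tscaleDl x : {morph tscale^~ x : a b / a + b}.
Proof.
move=> a b; rewrite -[x]tclass_repr !tscaleE [RHS]taddE.
exact/tclassP/tens_eq_scalesDl.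
Qed.

HB.instance Definition _ :=
  GRing.Zmodule_isLmodule.Build k tensor tscaleA tscale1 tscaleDr tscaleDl.

Definition tens u v : tensor := tclass [:: (u, v)].

End TensorProduct.

Arguments tensor k U%_type V%_type : rename.
Notation "U ⊗ V" := (tensor U V) (at level 40, left associativity) : type_scope.
Notation "u ⊗ v" := (tens u v) (at level 40, left associativity) : ring_scope.

(* The linear map on U ⊗ V induced by b; meaningful when b is bilinear. *)
Definition tlift (k : fieldType) (U V W : lmodType k) (b : U -> V -> W) (t : U ⊗ V) : W :=
  \sum_(p <- repr t) b p.1 p.2.

Section TensorLift.
Variables (k : fieldType) (U V : lmodType k).

Lemma tens_is_bilinear : bilinear_for *:%R *:%R (@tens k U V).
Proof.
split=> [v a x y|u a x y]; rewrite /tens.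
  rewrite [RHS]/GRing.add/= [X in tadd X]tscaleE taddE; exact/tclassP/tens_eqDl.
rewrite [RHS]/GRing.add/= [X in tadd X]tscaleE taddE; apply/tclassP => /=.
apply: tens_eq_trans (tens_eqDr _ _ _) _.
rewrite -cat1s -[X in tens_eq _ X]cat1s; apply: tens_eq_cat.
  exact/tens_eq_sym/tens_eqZ.
exact: tens_eq_refl.
Qed.

Lemma tensDl u u' (v : V) : (u + u' : U) ⊗ v = u ⊗ v + u' ⊗ v.
Proof. by have := tens_is_bilinear.1 v 1 u u'; rewrite /= !scale1r. Qed.
Lemma tensDr (u : U) (v v' : V) : u ⊗ (v + v') = u ⊗ v + u ⊗ v'.
Proof. by have := tens_is_bilinear.2 u 1 v v'; rewrite /= !scale1r. Qed.
Lemma tens0l (v : V) : (0 : U) ⊗ v = 0. Proof. exact/tclassP/tens_eq0. Qed.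
Lemma tensZl a (u : U) (v : V) : (a *: u) ⊗ v = a *: (u ⊗ v).
Proof. by have := tens_is_bilinear.1 v a u 0; rewrite /= addr0 tens0l addr0. Qed.
Lemma tensZr a (u : U) (v : V) : u ⊗ (a *: v) = a *: (u ⊗ v).
Proof. by rewrite -tensZl; exact/tclassP/tens_eq_sym/tens_eqZ. Qed.
Lemma tens0r (u : U) : u ⊗ (0 : V) = 0.
Proof. by rewrite -(scale0r 0) tensZr scale0r. Qed.
Lemma tensNl u (v : V) : (- u : U) ⊗ v = - (u ⊗ v).
Proof. by rewrite -scaleN1r tensZl scaleN1r. Qed.
Lemma tensBl u u' (v : V) : (u - u' : U) ⊗ v = u ⊗ v - u' ⊗ v.
Proof. by rewrite tensDl tensNl. Qed.

Lemma tclass_sum s : tclass s = \sum_(p <- s) (p.1 : U) ⊗ (p.2 : V).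
Proof.
elim: s => [|[u v] s IH]; first by rewrite big_nil.
by rewrite big_cons -IH /= [RHS]taddE.
Qed.

Lemma tens_sum (t : U ⊗ V) : t = \sum_(p <- repr t) p.1 ⊗ p.2.
Proof. by rewrite -tclass_sum tclass_repr. Qed.

Lemma tens_ind (P : U ⊗ V -> Prop) : P 0 -> (forall s t, P s -> P t -> P (s + t)) ->
  (forall u v, P (u ⊗ v)) -> forall t, P t.
Proof. by move=> P0 PD Pt t; rewrite [t]tens_sum; elim/big_ind: _. Qed.

Lemma tens_ext (W : lmodType k) (f g : {linear (U ⊗ V)%type -> W}) :
  (forall u v, f (u ⊗ v) = g (u ⊗ v)) -> f =1 g.
Proof.
move=> fg; elim/tens_ind => [|s t fs ft|u v]; first by rewrite !linear0.
  by rewrite !linearD fs ft.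
exact: fg.
Qed.

Variables (W : lmodType k) (b : U -> V -> W).
Hypothesis hb : bilinear_for *:%R *:%R b.

Lemma tlift_tclass s : tlift b (tclass s) = \sum_(p <- s) b p.1 p.2.
Proof.
have bDl u u' v : b (u + u') v = b u v + b u' v.
  by have := hb.1 v 1 u u'; rewrite /= !scale1r.
have bDr u v v' : b u (v + v') = b u v + b u v'.
  by have := hb.2 u 1 v v'; rewrite /= !scale1r.
have b0l v : b 0 v = 0 by apply: (addIr (b 0 v)); rewrite -bDl !add0r.
have b0r u : b u 0 = 0 by apply: (addIr (b u 0)); rewrite -bDr !add0r.
have bZl a u v : b (a *: u) v = a *: b u v.
  by have := hb.1 v a u 0; rewrite /= addr0 b0l addr0.
have bZr a u v : b u (a *: v) = a *: b u v.
  by have := hb.2 u a v 0; rewrite /= addr0 b0r addr0.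
rewrite /tlift; move: (repr_tclass s); move: (repr _) => r; elim=> {r s}.
- by [].
- by move=> s t _ ->.
- by move=> s t r _ -> _ ->.
- by move=> s s' t t' _ Es _ Et; rewrite !big_cat /= Es Et.
- by move=> s t; rewrite !big_cat /= addrC.
- by move=> u u' v; rewrite !big_cons !big_nil /= bDl !addr0.
- by move=> u v v'; rewrite !big_cons !big_nil /= bDr !addr0.
- by move=> a u v; rewrite !big_cons !big_nil /= bZl bZr.
- by move=> v; rewrite !big_cons !big_nil /= b0l addr0.
Qed.

Lemma tlift_tens u v : tlift b (u ⊗ v) = b u v.
Proof. by rewrite tlift_tclass big_seq1. Qed.

Lemma tlift_is_linear : linear (tlift b).
Proof.
have bZ a u v : b (a *: u) v = a *: b u v.
  have b0 : b 0 v = 0.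
    have := hb.1 v 1 0 0; rewrite /= !scale1r addr0 => /eqP.
    by rewrite -subr_eq0 opprD addrA subrr sub0r oppr_eq0 => /eqP.
  by have := hb.1 v a u 0; rewrite /= addr0 b0 addr0.
move=> a x y; rewrite -[x]tclass_repr -[y]tclass_repr.
rewrite [a *: _]tscaleE [_ + _]taddE !tlift_tclass big_cat big_map /=.
rewrite scaler_sumr; congr (_ + _); by apply: eq_bigr => p _; rewrite bZ.
Qed.

End TensorLift.

(* tmap f g = f ⊗ g *)
Definition tmap (k : fieldType) (U V U' V' : lmodType k) (f : U -> U') (g : V -> V') :
    U ⊗ V -> U' ⊗ V' :=
  tlift (fun u v => f u ⊗ g v).

Definition tassoc (k : fieldType) (U V W : lmodType k) : (U ⊗ V) ⊗ W -> U ⊗ (V ⊗ W) :=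
  tlift (fun t w => tlift (fun u v => u ⊗ (v ⊗ w)) t).

(* tact f g (\sum x ⊗ y) (\sum u ⊗ v) = \sum f x u ⊗ g y v *)
Definition tact (k : fieldType) (X Y U V U' V' : lmodType k)
    (f : X -> U -> U') (g : Y -> V -> V') (s : X ⊗ Y) (t : U ⊗ V) : U' ⊗ V' :=
  tlift (fun x y => tmap (f x) (g y) t) s.

Section TensorMaps.
Variables (k : fieldType).

Section Map.
Variables (U V U' V' : lmodType k) (f : {linear U -> U'}) (g : {linear V -> V'}).

Let tmap_bilinear : bilinear_for *:%R *:%R (fun u v => f u ⊗ g v).
Proof.
by split=> [v a x y|u a x y] /=; rewrite linearP ?tensDl ?tensDr ?tensZl ?tensZr.
Qed.

Lemma tmap_tens u v : tmap f g (u ⊗ v) = f u ⊗ g v.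
Proof. exact: tlift_tens. Qed.

Lemma tmap_is_linear : linear (tmap f g).
Proof. exact: tlift_is_linear. Qed.
HB.instance Definition _ := GRing.isLinear.Build k (U ⊗ V)%type (U' ⊗ V')%type _
  (tmap f g) tmap_is_linear.
End Map.

Section Assoc.
Variables (U V W : lmodType k).

Let inner_bilinear w : bilinear_for *:%R *:%R (fun (u : U) (v : V) => u ⊗ (v ⊗ (w : W))).
Proof.
split=> [v a x y|u a x y] /=; first by rewrite tensDl tensZl.
by rewrite tensDl tensDr tensZl tensZr.
Qed.

Let outer_bilinear : bilinear_for *:%R *:%R
  (fun t (w : W) => tlift (fun (u : U) (v : V) => u ⊗ (v ⊗ w)) t).
Proof.
split=> [w a s t|t a v w] /=; first exact: tlift_is_linear.
rewrite /tlift scaler_sumr -big_split /=; apply: eq_bigr => p _.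
by rewrite tensDr tensZr tensDr tensZr.
Qed.

Lemma tassoc_tens u v w : tassoc ((u : U) ⊗ (v : V) ⊗ (w : W)) = u ⊗ (v ⊗ w).
Proof. by rewrite /tassoc (tlift_tens outer_bilinear) (tlift_tens (inner_bilinear w)). Qed.

Lemma tassoc_is_linear : linear (@tassoc k U V W).
Proof. exact: tlift_is_linear. Qed.
HB.instance Definition _ := GRing.isLinear.Build k ((U ⊗ V) ⊗ W)%type (U ⊗ (V ⊗ W))%type _
  (@tassoc k U V W) tassoc_is_linear.
End Assoc.

Section Act.
Variables (X Y U V U' V' : lmodType k) (f : X -> U -> U') (g : Y -> V -> V').
Hypotheses (hf : bilinear_for *:%R *:%R f) (hg : bilinear_for *:%R *:%R g).

Let fl x : {linear U -> U'} := HB.pack (f x) (GRing.isLinear.Build _ _ _ _ (f x) (hf.2 x)).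
Let gl y : {linear V -> V'} := HB.pack (g y) (GRing.isLinear.Build _ _ _ _ (g y) (hg.2 y)).

Lemma tact_is_bilinear : bilinear_for *:%R *:%R (tact f g).
Proof.
have bil t : bilinear_for *:%R *:%R (fun x y => tmap (f x) (g y) t).
  split=> [y a x x'|x a y y'] /=; rewrite /tmap/tlift scaler_sumr -big_split /=;
    apply: eq_bigr => p _.
    by have := hf.1 p.1 a x x' => /= ->; rewrite tensDl tensZl.
  by have := hg.1 p.2 a y y' => /= ->; rewrite tensDr tensZr.
split=> [t a s s'|s a t t'].
  by have := tlift_is_linear (bil t) a s s'.
rewrite /= /tact /tlift scaler_sumr -big_split /=; apply: eq_bigr => p _.
exact: (linearP (tmap (fl p.1) (gl p.2))).
Qed.

Lemma tact_tens x y u v : tact f g (x ⊗ y) (u ⊗ v) = f x u ⊗ g y v.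
Proof.
have bil t : bilinear_for *:%R *:%R (fun x y => tmap (f x) (g y) t).
  split=> [y' a x1 x2|x1 a y1 y2] /=; rewrite /tmap/tlift scaler_sumr -big_split /=;
    apply: eq_bigr => p _.
    by have := hf.1 p.1 a x1 x2 => /= ->; rewrite tensDl tensZl.
  by have := hg.1 p.2 a y1 y2 => /= ->; rewrite tensDr tensZr.
rewrite /tact (tlift_tens (bil _)).
exact: (tmap_tens (fl x) (gl y)).
Qed.
End Act.

End TensorMaps.

HB.mixin Record Lmodule_isCoalgebra (k : fieldType) C of GRing.Lmodule k C := {
  comul_subdef : C -> C ⊗ C;
  counit_subdef : C -> k;
  comul_linear_subproof : linear comul_subdef;
  counit_scalar_subproof : scalar counit_subdef;
  comulA_subproof : forall c, tassoc (tmap comul_subdef idfun (comul_subdef c)) =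
    tmap idfun comul_subdef (comul_subdef c);
  counitl_subproof : forall c, tlift (fun x y => counit_subdef x *: y) (comul_subdef c) = c;
  counitr_subproof : forall c, tlift (fun x y => counit_subdef y *: x) (comul_subdef c) = c
}.

#[short(type="coalgType")]
HB.structure Definition Coalgebra (k : fieldType) :=
  {C of Lmodule_isCoalgebra k C & GRing.Lmodule k C}.

Definition comul (k : fieldType) (C : coalgType k) : C -> C ⊗ C := comul_subdef.
Definition counit (k : fieldType) (C : coalgType k) : C -> k := counit_subdef.

Section CoalgebraTheory.
Variables (k : fieldType) (C : coalgType k).

HB.instance Definition _ :=
  GRing.isLinear.Build k C (C ⊗ C)%type _ (@comul k C) comul_linear_subproof.
HB.instance Definition _ :=
  GRing.isLinear.Build k C k _ (@counit k C) counit_scalar_subproof.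

Lemma comulA (c : C) : tassoc (tmap (@comul k C) idfun (comul c)) =
  tmap idfun (@comul k C) (comul c).
Proof. exact: comulA_subproof. Qed.

Lemma counitl (c : C) : tlift (fun x y => counit x *: y) (comul c) = c.
Proof. exact: counitl_subproof. Qed.

Lemma counitr (c : C) : tlift (fun x y => counit y *: x) (comul c) = c.
Proof. exact: counitr_subproof. Qed.

End CoalgebraTheory.

HB.mixin Record isHopf (k : fieldType) H of GRing.Algebra k H & Coalgebra k H := {
  comul1_subproof : comul (1 : H) = 1 ⊗ 1;
  comulM_subproof : forall x y : H, comul (x * y) = tact *%R *%R (comul x) (comul y);
  counit1_subproof : counit (1 : H) = 1;
  counitM_subproof : forall x y : H, counit (x * y) = counit x * counit y;
  antipode_subdef : H -> H;
  antipode_linear_subproof : linear antipode_subdef;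
  antipodel_subproof :
    forall x, tlift (fun x1 x2 => antipode_subdef x1 * x2) (comul x) = (counit x)%:A;
  antipoder_subproof :
    forall x, tlift (fun x1 x2 => x1 * antipode_subdef x2) (comul x) = (counit x)%:A
}.

#[short(type="hopfType")]
HB.structure Definition Hopf (k : fieldType) :=
  {H of isHopf k H & GRing.Algebra k H & Coalgebra k H}.

Definition antipode (k : fieldType) (H : hopfType k) : H -> H := antipode_subdef.

Section HopfTheory.
Variables (k : fieldType) (H : hopfType k).
Implicit Types x y : H.

HB.instance Definition _ :=
  GRing.isLinear.Build k H H _ (@antipode k H) antipode_linear_subproof.

Lemma comul1 : comul (1 : H) = 1 ⊗ 1. Proof. exact: comul1_subproof. Qed.

Lemma comulM x y : comul (x * y) = tact *%R *%R (comul x) (comul y).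
Proof. exact: comulM_subproof. Qed.

Lemma counit1 : counit (1 : H) = 1. Proof. exact: counit1_subproof. Qed.

Lemma counitM x y : counit (x * y) = counit x * counit y.
Proof. exact: counitM_subproof. Qed.

Lemma antipodel x : tlift (fun x1 x2 => antipode x1 * x2) (comul x) = (counit x)%:A.
Proof. exact: antipodel_subproof. Qed.

Lemma antipoder x : tlift (fun x1 x2 => x1 * antipode x2) (comul x) = (counit x)%:A.
Proof. exact: antipoder_subproof. Qed.

End HopfTheory.

Section ConverseAlgebra.
Variables (k : fieldType) (A : algType k).

HB.instance Definition _ := GRing.Lmodule.on A^c.
Let converse_scalerAl (a : k) (x y : A^c) : a *: (x * y) = (a *: x : A^c) * y.
Proof. exact: (@scalerAr k A). Qed.
HB.instance Definition _ := GRing.Lmodule_isLalgebra.Build k A^c converse_scalerAl.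
Let converse_scalerAr (a : k) (x y : A^c) : a *: (x * y) = x * (a *: y : A^c).
Proof. exact: (@scalerAl k A). Qed.
HB.instance Definition _ := GRing.Lalgebra_isAlgebra.Build k A^c converse_scalerAr.

End ConverseAlgebra.

(* The underlying k-space of a module over a k-algebra. *)
Section UnderlyingSpace.
Variables (k : fieldType) (B : algType k) (M : lmodType B).

Definition kspace : Type := M.
HB.instance Definition _ := GRing.Zmodule.on kspace.

Definition kspace_scale (a : k) (m : kspace) : kspace := (a%:A : B) *: (m : M).

Let scaleA a b m : kspace_scale a (kspace_scale b m) = kspace_scale (a * b) m.
Proof. by rewrite /kspace_scale scalerA mulr_algl scalerA. Qed.
Let scale1 : left_id 1 kspace_scale.
Proof. by move=> m; rewrite /kspace_scale !scale1r. Qed.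
Let scaleDr : right_distributive kspace_scale +%R.
Proof. by move=> a m n; exact: scalerDr. Qed.
Let scaleDl m : {morph kspace_scale^~ m : a b / a + b}.
Proof. by move=> a b; rewrite /kspace_scale !scalerDl. Qed.
HB.instance Definition _ :=
  GRing.Zmodule_isLmodule.Build k kspace scaleA scale1 scaleDr scaleDl.

Definition kact (b : B) (m : kspace) : kspace := b *: (m : M).

End UnderlyingSpace.

Lemma kact_bilinear (k : fieldType) (B : algType k) (M : lmodType B) :
  bilinear_for *:%R *:%R (@kact k B M).
Proof.
split=> [m a x y|x a m n] /=.
  rewrite -[a *: kact x m]/(kact a%:A (kact x m)) /kact scalerDl scalerA.
  by congr (_ + _); congr (_ *: (m : M)); exact/esym/(@mulr_algl k B).
rewrite -[a *: m]/(kact a%:A m) -[a *: kact x m]/(kact a%:A (kact x m)).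
rewrite /kact scalerDr !scalerA; congr (_ + _); congr (_ *: (m : M)).
by rewrite (@mulr_algl k B) (@mulr_algr k B).
Qed.

Definition projective (B : pzRingType) (M : lmodType B) : Prop :=
  forall (N P : lmodType B) (p : {linear N -> P}) (f : {linear M -> P}),
    (forall y, exists x, p x = y) ->
  exists g : {linear M -> N}, forall m, p (g m) = f m.

Section Comodules.
Variables (k : fieldType) (C : coalgType k).

Definition is_rcomod (M : lmodType k) (rho : M -> M ⊗ C) : Prop :=
  (forall m, tassoc (tmap rho idfun (rho m)) = tmap idfun (@comul k C) (rho m)) /\
  (forall m, tlift (fun x c => counit c *: x) (rho m) = m).

Definition is_lcomod (M : lmodType k) (lambda : M -> C ⊗ M) : Prop :=
  (forall m, tassoc (tmap (@comul k C) idfun (lambda m)) = tmap idfun lambda (lambda m)) /\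
  (forall m, tlift (fun c x => counit c *: x) (lambda m) = m).

Record rcomod := RComod {
  rcomod_space :> lmodType k;
  rcoact : {linear rcomod_space -> (rcomod_space ⊗ C)%type};
  rcomodP : is_rcomod rcoact
}.

Record lcomod := LComod {
  lcomod_space :> lmodType k;
  lcoact : {linear lcomod_space -> (C ⊗ lcomod_space)%type};
  lcomodP : is_lcomod lcoact
}.

Definition rcomod_morphism (M N : rcomod) (f : M -> N) : Prop :=
  forall m, rcoact N (f m) = tmap f idfun (rcoact M m).

Definition lcomod_morphism (M N : lcomod) (f : M -> N) : Prop :=
  forall m, lcoact N (f m) = tmap idfun f (lcoact M m).

Definition rcomod_injective (M : rcomod) : Prop :=
  forall (N P : rcomod) (i : {linear N -> P}) (f : {linear N -> M}),
    rcomod_morphism i -> rcomod_morphism f -> injective i ->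
  exists g : {linear P -> M}, rcomod_morphism g /\ forall n, g (i n) = f n.

Definition lcomod_injective (M : lcomod) : Prop :=
  forall (N P : lcomod) (i : {linear N -> P}) (f : {linear N -> M}),
    lcomod_morphism i -> lcomod_morphism f -> injective i ->
  exists g : {linear P -> M}, lcomod_morphism g /\ forall n, g (i n) = f n.

End Comodules.

(* The subspace S ⊗ V of U ⊗ V. *)
Definition tsubl (k : fieldType) (U V : lmodType k) (S : {pred U}) : {pred U ⊗ V} :=
  lspan [set t | exists u v, u \in S /\ t = u ⊗ v].

(* The subspace S ⊗ V + V ⊗ S of V ⊗ V. *)
Definition tsub2 (k : fieldType) (V : lmodType k) (S : {pred V}) : {pred V ⊗ V} :=
  lspan [set t | exists u v, (u \in S \/ v \in S) /\ t = u ⊗ v].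

Section CoidealSubalgebras.
Variables (k : fieldType) (H : hopfType k).

Record rcSubalg := RCSubalg {
  rcs_pred :> {pred H};
  rcs_subalg : GRing.subalg_closed rcs_pred;
  rcs_coideal : forall a, a \in rcs_pred -> comul a \in tsubl rcs_pred
}.

HB.instance Definition _ (A : rcSubalg) := GRing.isSubalgClosed.Build k H (rcs_pred A)
  (GRing.subalg_closed_semi (rcs_subalg A)).

Definition rcs_alg (A : rcSubalg) : Type := {x : H | x \in rcs_pred A}.
HB.instance Definition _ A := SubChoice.on (rcs_alg A).
HB.instance Definition _ A := [SubChoice_isSubAlgebra of rcs_alg A by <:].

Definition rcs_val A (a : rcs_alg A) : H := \val a.

Lemma rcs_val_is_linear A : linear (@rcs_val A). Proof. by move=> a x y; exact: linearP. Qed.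
Lemma rcs_val_is_monoid_morphism A : monoid_morphism (@rcs_val A).
Proof. by split=> [|x y]; [exact: rmorph1 | exact: rmorphM]. Qed.
HB.instance Definition _ A :=
  GRing.isLinear.Build k (rcs_alg A) H _ (@rcs_val A) (rcs_val_is_linear (A := A)).
HB.instance Definition _ A := GRing.isMonoidMorphism.Build (rcs_alg A) H (@rcs_val A)
  (rcs_val_is_monoid_morphism A).

Lemma rcs_comul_ex A (a : rcs_alg A) :
  exists t : (rcs_alg A ⊗ H)%type, tmap (@rcs_val A) idfun t == comul (rcs_val a).
Proof.
case/asboolP: (rcs_coideal (valP a)) => n [c [x [Xx ax]]]; rewrite [rcs_val a]/rcs_val ax.
elim/big_ind: _ => [|s t [s' /eqP <-] [t' /eqP <-]|i _].
- by exists 0; rewrite linear0.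
- by exists (s' + t'); rewrite linearD.
- have [u [v [uA ->]]] := Xx i; exists (c i *: ((Sub u uA : rcs_alg A) ⊗ v)).
  by rewrite linearZ /= tmap_tens.
Qed.

(* The restriction A -> A ⊗ H of the comultiplication. *)
Definition rcs_comul A (a : rcs_alg A) : rcs_alg A ⊗ H := xchoose (rcs_comul_ex a).

Lemma rcs_comulE A (a : rcs_alg A) :
  tmap (@rcs_val A) idfun (rcs_comul a) = comul (rcs_val a).
Proof. exact/eqP/(xchooseP (rcs_comul_ex a)). Qed.

(* A factor coalgebra H/I is given by the kernel I of the projection H -> H/I. *)
Record factorCoalg := FactorCoalg {
  fc_ker :> {pred H};
  fc_submod : GRing.submod_closed fc_ker;
  fc_left : forall h x, x \in fc_ker -> h * x \in fc_ker;
  fc_comul : forall x, x \in fc_ker -> comul x \in tsub2 fc_ker;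
  fc_counit : forall x, x \in fc_ker -> counit x = 0
}.

HB.instance Definition _ (I : factorCoalg) := GRing.isSubmodClosed.Build k H (fc_ker I)
  (GRing.submod_closed_semi (fc_submod I)).

Lemma rcSubalg_eq (A B : rcSubalg) : rcs_pred A =i rcs_pred B -> A = B.
Proof.
case: A B => [p ? ?] [q ? ?] /= pq; have E : p = q by apply: funext => x; exact: pq.
by subst q; congr RCSubalg; exact: Prop_irrelevance.
Qed.

Lemma factorCoalg_eq (I J : factorCoalg) : fc_ker I =i fc_ker J -> I = J.
Proof.
case: I J => [p ? ? ? ?] [q ? ? ? ?] /= pq.
have E : p = q by apply: funext => x; exact: pq.
by subst q; congr FactorCoalg; exact: Prop_irrelevance.
Qed.

End CoidealSubalgebras.


Section TensorComposition.
Variables (k : fieldType).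

Lemma tmap_comp (U V U1 V1 U2 V2 : lmodType k) (f : {linear U -> U1}) (g : {linear V -> V1})
    (f1 : {linear U1 -> U2}) (g1 : {linear V1 -> V2}) t :
  tmap f1 g1 (tmap f g t) = tmap (f1 \o f) (g1 \o g) t.
Proof.
elim/tens_ind: t => [|s t Hs Ht|u v]; first by rewrite !linear0.
  by rewrite !linearD /= Hs Ht.
by rewrite !tmap_tens.
Qed.

Lemma tmap_ext (U V U1 V1 : lmodType k) (f f' : U -> U1) (g g' : V -> V1) :
  f =1 f' -> g =1 g' -> tmap f g =1 tmap f' g'.
Proof. by move=> ff' gg' t; apply: eq_bigr => p _; rewrite ff' gg'. Qed.

Lemma tassoc_nat (U V W U1 V1 W1 : lmodType k) (f : {linear U -> U1})
    (g : {linear V -> V1}) (h : {linear W -> W1}) t :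
  tassoc (tmap (tmap f g) h t) = tmap f (tmap g h) (tassoc t).
Proof.
elim/tens_ind: t => [|s t Hs Ht|t w]; first by rewrite !linear0.
  by rewrite !linearD /= Hs Ht.
rewrite tmap_tens /=; elim/tens_ind: t => [|s t Hs Ht|u v].
- by rewrite linear0 !tens0l !linear0.
- by rewrite linearD !tensDl !linearD /= Hs Ht.
- by rewrite tmap_tens !tassoc_tens !tmap_tens /= tmap_tens.
Qed.

Lemma lspan_ker (V W : lmodType k) (f : {linear V -> W}) (X : set V) :
  (forall v, X v -> f v = 0) -> forall v, v \in lspan X -> f v = 0.
Proof.
move=> Xf _ /asboolP[n [c [x [Xx ->]]]]; rewrite linear_sum big1 // => i _.
by rewrite linearZ /= Xf // scaler0.
Qed.

Lemma scaling_bilinearl (U V : lmodType k) (e : {scalar U}) :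
  bilinear_for *:%R *:%R (fun (u : U) (v : V) => e u *: v).
Proof.
split=> [v a x y|u a x y] /=; first by rewrite linearP /= scalerDl scalerA.
by rewrite scalerDr !scalerA mulrC.
Qed.

Lemma scaling_bilinearr (U V : lmodType k) (e : {scalar V}) :
  bilinear_for *:%R *:%R (fun (u : U) (v : V) => e v *: u).
Proof.
split=> [v a x y|u a x y] /=; first by rewrite scalerDr !scalerA mulrC.
by rewrite linearP /= scalerDl scalerA.
Qed.

Lemma tlift_tmap (U V U1 V1 W : lmodType k) (f : {linear U -> U1}) (g : {linear V -> V1})
    (b : U1 -> V1 -> W) t : bilinear_for *:%R *:%R b ->
  tlift b (tmap f g t) = tlift (fun u v => b (f u) (g v)) t.
Proof.
move=> hb; pose B : {linear (U1 ⊗ V1)%type -> W} :=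
  HB.pack (tlift b) (GRing.isLinear.Build _ _ _ _ (tlift b) (tlift_is_linear hb)).
rewrite [in LHS](tens_sum t) linear_sum -[LHS]/(B _) linear_sum; apply: eq_bigr => p _.
by rewrite /= tmap_tens tlift_tens.
Qed.

Section PartialApplication.
Variables (U V W : lmodType k) (b : U -> V -> W) (hb : bilinear_for *:%R *:%R b).

Definition bil_appl (v : V) : {linear U -> W} :=
  HB.pack (fun u => b u v) (GRing.isLinear.Build k U W _ (fun u => b u v) (hb.1 v)).
Definition bil_appr (u : U) : {linear V -> W} :=
  HB.pack (b u) (GRing.isLinear.Build k V W _ (b u) (hb.2 u)).

End PartialApplication.

Lemma linear_tlift (U V W W1 : lmodType k) (f : {linear W -> W1}) (b : U -> V -> W) t :
  f (tlift b t) = tlift (fun u v => f (b u v)) t.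
Proof. by rewrite /tlift linear_sum. Qed.

Lemma eq_tlift (U V W : lmodType k) (b b' : U -> V -> W) t :
  (forall u v, b u v = b' u v) -> tlift b t = tlift b' t.
Proof. by move=> bb'; apply: eq_bigr => p _. Qed.

End TensorComposition.

Section FactorCoalgebra.
Variables (k : fieldType) (H : hopfType k) (I : factorCoalg H).

Definition factor : Type := lquot (fc_ker I).
HB.instance Definition _ := GRing.Lmodule.on factor.

Definition fproj (h : H) : factor := lproj (fc_ker I) h.

Lemma fproj_is_linear : linear fproj. Proof. exact: lproj_is_linear. Qed.
HB.instance Definition _ := GRing.isLinear.Build k H factor _ fproj fproj_is_linear.

Lemma fproj_eq x y : fproj x = fproj y <-> x - y \in fc_ker I.
Proof.
by split=> [/eqP|xy]; [rewrite lproj_eq | apply/eqP; rewrite lproj_eq].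
Qed.

Definition frepr (c : factor) : H := repr (c : lquot (fc_ker I)).

Lemma freprK : cancel frepr fproj. Proof. by move=> c; exact: lproj_repr. Qed.

Lemma frepr_fproj h : frepr (fproj h) - h \in fc_ker I.
Proof. by apply/fproj_eq; rewrite freprK. Qed.

Lemma fproj_quotient (W : lmodType k) (f : {linear H -> W}) :
  (forall x, x \in fc_ker I -> f x = 0) -> forall h, f (frepr (fproj h)) = f h.
Proof. by move=> fI h; apply/eqP; rewrite -subr_eq0 -linearB fI ?frepr_fproj. Qed.

Definition factor_comul (c : factor) : factor ⊗ factor :=
  tmap fproj fproj (comul (frepr c)).
Definition factor_counit (c : factor) : k := counit (frepr c).

(* The left action of H on H/I. *)
Definition factor_act (h : H) (c : factor) : factor := fproj (h * frepr c).

Lemma factor_comulE h : factor_comul (fproj h) = tmap fproj fproj (comul h).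
Proof.
apply: (fproj_quotient (f := tmap fproj fproj \o @comul k H)) => x /fc_comul.
apply: lspan_ker => _ [u [v [uvI ->]]]; rewrite /= tmap_tens /=.
have I0 w : w \in fc_ker I -> fproj w = 0.
  by move=> wI; rewrite -(linear0 fproj); apply/fproj_eq; rewrite subr0.
by case: uvI => /I0 ->; rewrite ?tens0l ?tens0r.
Qed.

Lemma factor_counitE h : factor_counit (fproj h) = counit h.
Proof.
apply/eqP; rewrite -subr_eq0 -linearB; apply/eqP/(@fc_counit _ _ I).
exact: frepr_fproj.
Qed.

Lemma factor_actE h x : factor_act h (fproj x) = fproj (h * x).
Proof.
apply/fproj_eq; rewrite -mulrBr; apply/(@fc_left _ _ I); exact: frepr_fproj.
Qed.

Lemma factor_act_bilinear : bilinear_for *:%R *:%R factor_act.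
Proof.
split=> [c a x y|h a c d] /=.
  by rewrite /factor_act mulrDl -scalerAl linearP.
rewrite -[c]freprK -[d]freprK -linearP !factor_actE.
by rewrite mulrDr -scalerAr linearP.
Qed.

Let factor_comul_linear : linear factor_comul.
Proof.
move=> a c d; rewrite -[c]freprK -[d]freprK -linearP !factor_comulE.
by rewrite linearP linearP.
Qed.

Let factor_counit_scalar : scalar factor_counit.
Proof.
move=> a c d; rewrite -[c]freprK -[d]freprK -linearP !factor_counitE.
by rewrite linearP.
Qed.

Let fcomul : {linear factor -> (factor ⊗ factor)%type} :=
  HB.pack factor_comul (GRing.isLinear.Build _ _ _ _ factor_comul factor_comul_linear).
Let fcounit : {scalar factor} :=
  HB.pack factor_counit (GRing.isLinear.Build _ _ _ _ factor_counit factor_counit_scalar).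

Let factor_comulA c : tassoc (tmap factor_comul idfun (factor_comul c)) =
  tmap idfun factor_comul (factor_comul c).
Proof.
rewrite -[c]freprK factor_comulE; move: (frepr c) => {c} h.
rewrite (tmap_comp fproj fproj fcomul idfun) (tmap_comp fproj fproj idfun fcomul).
pose D := @comul k H; pose p := fproj.
rewrite (@tmap_ext _ _ _ _ _ _ (tmap p p \o D) _ (p \o idfun)) //; last first.
  exact: factor_comulE.
rewrite -(tmap_comp D idfun) tassoc_nat comulA tmap_comp.
by apply: tmap_ext => // x; rewrite /= factor_comulE.
Qed.

Let factor_counitl c : tlift (fun x y => factor_counit x *: y) (factor_comul c) = c.
Proof.
rewrite -[c]freprK factor_comulE tlift_tmap; last exact: (scaling_bilinearl _ fcounit).
rewrite -[in RHS](counitl (frepr c)) linear_tlift; apply: eq_tlift => x y.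
by rewrite factor_counitE linearZ.
Qed.

Let factor_counitr c : tlift (fun x y => factor_counit y *: x) (factor_comul c) = c.
Proof.
rewrite -[c]freprK factor_comulE tlift_tmap; last exact: (scaling_bilinearr _ fcounit).
rewrite -[in RHS](counitr (frepr c)) linear_tlift; apply: eq_tlift => x y.
by rewrite factor_counitE linearZ.
Qed.

HB.instance Definition _ := Lmodule_isCoalgebra.Build k factor
  factor_comul_linear factor_counit_scalar factor_comulA factor_counitl factor_counitr.

End FactorCoalgebra.

Lemma mul_bilinear (k : fieldType) (B : algType k) :
  bilinear_for *:%R *:%R (fun x y : B => x * y).
Proof.
split=> [y a x x'|x a y y'] /=; first by rewrite mulrDl scalerAl.
by rewrite mulrDr scalerAr.
Qed.

Section FactorOfSubalgebra.
Variables (k : fieldType) (H : hopfType k) (A : rcSubalg H).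

(* H A^+ *)
Definition HAplus : {pred H} :=
  lspan [set x | exists h a, [/\ a \in rcs_pred A, counit a = 0 & x = h * a]].

Let HAplus_submod : GRing.submod_closed HAplus. Proof. exact: lspan_closed. Qed.

Let HAplus_left h x : x \in HAplus -> h * x \in HAplus.
Proof.
pose L : {linear H -> H} := HB.pack (fun x => h * x)
  (GRing.isLinear.Build k H H _ _ ((mul_bilinear H).2 h)).
apply: (lspan_map (f := L)) => _ [g [a [aA ea ->]]]; apply: lspan_gen.
by exists (h * g), a; split; rewrite //= mulrA.
Qed.

Let HAplus_counit x : x \in HAplus -> counit x = 0.
Proof.
apply: (lspan_ker (f := @counit k H : {linear H -> k^o})) => _ [g [a [aA ea ->]]].
by rewrite /= counitM ea mulr0.
Qed.

Let tact_mul_tsub2 (s : (H ⊗ H)%type) (u v : H) : u \in HAplus \/ v \in HAplus ->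
  tact (fun x y => x * y) (fun x y => x * y) s (u ⊗ v) \in tsub2 HAplus.
Proof.
have bil := tact_is_bilinear (mul_bilinear H) (mul_bilinear H).
move=> uv; rewrite (tens_sum s).
pose L : {linear (H ⊗ H)%type -> (H ⊗ H)%type} :=
  HB.pack (fun s => tact (fun x y => x * y) (fun x y => x * y) s (u ⊗ v))
  (GRing.isLinear.Build k _ _ _ _ (bil.1 (u ⊗ v))).
rewrite -[tact _ _ _ _]/(L _) linear_sum; apply: rpred_sum => p _ /=.
rewrite (tact_tens (mul_bilinear H) (mul_bilinear H)); apply: lspan_gen.
exists (p.1 * u), (p.2 * v); split=> //.
by case: uv => /HAplus_left; [left | right].
Qed.

Let HAplus_comul x : x \in HAplus -> comul x \in tsub2 HAplus.
Proof.
apply: lspan_map => _ [h [a [aA ea ->]]]; rewrite /= comulM.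
have bil := tact_is_bilinear (mul_bilinear H) (mul_bilinear H).
pose L : {linear (H ⊗ H)%type -> (H ⊗ H)%type} :=
  HB.pack (tact (fun x y => x * y) (fun x y => x * y) (comul h))
  (GRing.isLinear.Build k _ _ _ _ (bil.2 (comul h))).
pose e (u : H) : H := u - counit u *: 1.
have e_linear : linear e.
  move=> c u v; rewrite /e linearP /= scalerDl scalerBr scalerA.
  by rewrite opprD addrACA.
pose E : {linear H -> H} := HB.pack e (GRing.isLinear.Build _ _ _ _ e e_linear).
have AplusJ u : u \in rcs_pred A -> counit u = 0 -> u \in HAplus.
  by move=> uA eu; apply: lspan_gen; exists 1, u; rewrite mul1r.
have comula : comul a = tmap E idfun (comul a) + 1 ⊗ a.
  rewrite -[in X in 1 ⊗ X](counitl a); move: (comul a) => t.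
  pose N : {linear (H ⊗ H)%type -> H} :=
    HB.pack (tlift (fun x y : H => counit x *: y)) (GRing.isLinear.Build _ _ _ _ _
      (tlift_is_linear (scaling_bilinearl H (@counit k H)))).
  rewrite -[tlift _ _]/(N t).
  elim/tens_ind: t => [|s t Hs Ht|u v]; first by rewrite !linear0 tens0r addr0.
    by rewrite {1}Hs {1}Ht !linearD /= tensDr addrACA.
  rewrite tmap_tens /= (tlift_tens (scaling_bilinearl H (@counit k H))).
  by rewrite /e tensBl tensZl tensZr subrK.
rewrite comula -[tact _ _ _ _]/(L _) linearD /=; apply: rpredD; last first.
  by apply: tact_mul_tsub2; right; exact: AplusJ.
rewrite -[tact _ _ _ _]/((L \o tmap E idfun) _).
apply: lspan_map (rcs_coideal aA) => _ [u [v [uA ->]]].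
rewrite -[_ (u ⊗ v)]/(L (tmap E idfun (u ⊗ v))) tmap_tens /=; apply: tact_mul_tsub2; left; apply: AplusJ.
  by apply: rpredB => //; apply: rpredZ; exact: rpred1.
by rewrite /e linearB linearZ /= counit1 mulr1 subrr.
Qed.

Definition takeuchi_factor : factorCoalg H :=
  FactorCoalg HAplus_submod HAplus_left HAplus_comul HAplus_counit.

End FactorOfSubalgebra.

Section Separation.
Variables (k : fieldType).

Lemma separation (V : lmodType k) (W : {pred V}) (v : V) :
  GRing.submod_closed W -> v \notin W ->
  exists phi : {scalar V}, phi v = 1 /\ forall w, w \in W -> phi w = 0.
Proof.
move=> [W0 Wlin] vW.
pose P (X : set V) := (forall a x y, X x -> X y -> X (a *: x + y)) /\
  (forall x w, X x -> w \in W -> x + w <> v).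
have [F FP Ftot|X [[Xlin Xv] Xmax]] := @Zorn_bigcup V P.
  split=> [a x y [X FX Xx] [Y FY Yy]|x w [X FX Xx]]; last by apply: (FP X FX).2.
  have [XY|YX] := Ftot X Y FX FY.
    by exists Y => //; apply: (FP Y FY).1 => //; exact: XY.
  by exists X => //; apply: (FP X FX).1 => //; exact: YX.
have X0 : X 0.
  have [//|nX0] := pselect (X 0); exfalso.
  have XE x : ~ X x.
    by move=> Xx; apply: nX0; have := Xlin (-1) x x Xx Xx; rewrite scaleN1r addNr.
  apply: (Xmax (fun x => x = 0)).
    by split=> [x /XE|/(_ 0 erefl)/XE].
  split=> [a x y -> ->|x w -> wW]; first by rewrite scaler0 addr0.
  by rewrite add0r => wv; rewrite -wv wW in vW.
have WD w w' : w \in W -> w' \in W -> w + w' \in W.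
  by move=> ? ?; rewrite -[w]scale1r; exact: Wlin.
have WZ c w : w \in W -> c *: w \in W.
  by move=> ?; rewrite -[_ *: _]addr0; exact: Wlin.
have XZ c x : X x -> X (c *: x).
  by move=> ?; rewrite -[_ *: _]addr0; exact: Xlin.
pose S y := exists x w, [/\ X x, w \in W & y = x + w].
have Slin a y z : S y -> S z -> S (a *: y + z).
  move=> [x [w [Xx wW ->]]] [x' [w' [Xx' wW' ->]]].
  exists (a *: x + x'), (a *: w + w'); split; [exact: Xlin|exact: Wlin|].
  by rewrite scalerDr addrACA.
have SZ c y : S y -> S (c *: y).
  move=> Sy; rewrite -[_ *: _]addr0; apply: Slin => //.
  by exists 0, 0; rewrite addr0.
have Sv : ~ S v by move=> [x [w [Xx wW vE]]]; exact: (Xv x w Xx wW).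
have Sdec y : exists c, S (y - c *: v).
  have [Xy|nXy] := pselect (X y).
    by exists 0; rewrite scale0r subr0; exists y, 0; rewrite addr0.
  pose Y (z : V) := exists c x, X x /\ z = c *: y + x.
  have XY : (X `<` Y)%classic.
    split=> [x Xx|YX]; last by apply/nXy/YX; exists 1, 0; rewrite scale1r addr0.
    by exists 0, x; rewrite scale0r add0r.
  have := Xmax Y XY; rewrite not_andP => -[nlin|].
    exfalso; apply: nlin => a _ _ [c [x [Xx ->]]] [d [x' [Xx' ->]]].
    exists (a * c + d), (a *: x + x'); split; first exact: Xlin.
    by rewrite scalerDr scalerA scalerDl addrACA.
  move=> /existsNP[z /existsNP[w /not_implyP[[c [x [Xx ->]]] /not_implyP[wW]]]].
  move=> /contrapT vE; have c0 : c != 0.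
    apply/eqP => c0; apply: (Xv x w Xx wW).
    by rewrite -vE c0 scale0r add0r.
  exists c^-1; exists (- c^-1 *: x), (- c^-1 *: w); split; [exact: XZ|exact: WZ|].
  rewrite -vE !scalerDr scalerA mulVf // scale1r !scaleNr -addrA opprD addrA.
  by rewrite subrr add0r opprD.
have Suniq y c d : S (y - c *: v) -> S (y - d *: v) -> c = d.
  move=> Sc Sd; apply/eqP/negP => /negP cd; apply: Sv.
  have := Slin (-1) _ _ Sc Sd.
  rewrite scaleN1r opprB addrA subrK -scalerBl => /(SZ (c - d)^-1).
  by rewrite scalerA mulVf ?scale1r // subr_eq0.
pose phi y : k := projT1 (cid (Sdec y)).
have phiP y : S (y - phi y *: v) := projT2 (cid (Sdec y)).
have phi_scalar : scalar phi.
  move=> a y z; apply: Suniq (phiP _) _.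
  have := Slin a _ _ (phiP y) (phiP z).
  by rewrite scalerBr scalerA addrACA -opprD -scalerDl.
pose Phi : {scalar V} := HB.pack phi (GRing.isLinear.Build _ _ _ _ phi phi_scalar).
exists Phi; split.
  apply: Suniq (phiP v) _; rewrite scale1r subrr.
  by exists 0, 0; rewrite addr0.
move=> w wW; apply: Suniq (phiP w) _; rewrite scale0r subr0.
by exists 0, w; rewrite add0r.
Qed.

(* The map id ⊗ phi : U ⊗ V -> U ⊗ k = U. *)
Definition slice (U V : lmodType k) (phi : V -> k) : U ⊗ V -> U :=
  tlift (fun u v => phi v *: u).

Lemma slice_tens (U V : lmodType k) (phi : {scalar V}) (u : U) (v : V) :
  slice phi (u ⊗ v) = phi v *: u.
Proof. exact: (tlift_tens (scaling_bilinearr U phi)). Qed.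

Lemma slice_is_linear (U V : lmodType k) (phi : {scalar V}) : linear (@slice U V phi).
Proof. exact: (tlift_is_linear (scaling_bilinearr U phi)). Qed.
HB.instance Definition _ (U V : lmodType k) (phi : {scalar V}) :=
  GRing.isLinear.Build k (U ⊗ V)%type U _ (@slice U V phi) (slice_is_linear phi).

Lemma slice_tsubl (U V : lmodType k) (K : submodClosed U) (t : (U ⊗ V)%type) :
  (forall phi : {scalar V}, slice phi t \in K) -> t \in tsubl K.
Proof.
rewrite (tens_sum t); move: (repr t) => s {t}.
have [n] := ubnP (size s); elim: n s => // n IH [|[u v] s] /=.
  by move=> _ _; rewrite big_nil; exact: rpred0.
rewrite ltnS => sn; rewrite big_cons /= => tK.
pose Ws : {pred V} := lspan [set v' | v' \in [seq p.2 | p <- s]].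
have [vW|vW] := boolP (v \in Ws).
  have [s' ss' us'] : exists2 s' : seq (U * V), size s' = size s &
      u ⊗ v + \sum_(p <- s) p.1 ⊗ p.2 = \sum_(p <- s') p.1 ⊗ p.2.
    case/asboolP: vW => m [c [x [xs ->]]] {tK sn}.
    elim: m s c x xs {Ws} => [|m IHm] s c x xs.
      by exists s => //; rewrite big_ord0 tens0r add0r.
    have /mapP[p ps xp] := xs ord0.
    case/splitPr: ps xs => s1 s2 xs.
    have [|s' ss' us'] := IHm (s1 ++ (c ord0 *: u + p.1, p.2) :: s2)
        (fun i => c (lift ord0 i)) (fun i => x (lift ord0 i)).
      by move=> i; have := xs (lift ord0 i); rewrite /= !map_cat.
    exists s'; first by rewrite ss' !size_cat.
    rewrite -us' big_ord_recl tensDr !big_cat /= !big_cons /= xp.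
    rewrite tensDl tensZl tensZr [_ + u ⊗ _]addrC -addrA; congr (_ + _).
    by rewrite addrCA -!addrA.
  rewrite us' in tK *; apply: IH => //; by rewrite ss'.
have [phi [phiv phiW]] := separation (lspan_closed _) vW.
have uK : u \in K.
  have := tK phi; rewrite linearD /= slice_tens phiv scale1r linear_sum big1_seq ?addr0 //.
  move=> p /andP[_ ps] /=; rewrite slice_tens phiW ?scale0r //; apply: lspan_gen.
  exact: map_f.
apply: rpredD; first by apply: lspan_gen; exists u, v.
apply: IH => // psi; have := tK psi; rewrite linearD /= slice_tens => totK.
by rewrite -[slice _ _](addKr (psi v *: u)) -scaleNr; apply: rpredD => //; exact: rpredZ.
Qed.

End Separation.

Section CoinvariantSubalgebra.
Variables (k : fieldType) (H : hopfType k) (C : factorCoalg H).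
Local Notation pi := (@fproj k H C).

Definition coinv : {pred H} :=
  [pred h | tmap pi idfun (comul h) == pi 1 ⊗ h].

Lemma coinvP h : reflect (tmap pi idfun (comul h) = pi 1 ⊗ h) (h \in coinv).
Proof. exact: eqP. Qed.

Let coinv_linear : linear_closed coinv.
Proof.
move=> a x y /coinvP xC /coinvP yC; apply/coinvP.
by rewrite !linearP /= xC yC tensDr tensZr.
Qed.

Let coinv0 : 0 \in coinv. Proof. by apply/coinvP; rewrite !linear0 tens0r. Qed.

Let coinv1 : 1 \in coinv. Proof. by apply/coinvP; rewrite comul1 tmap_tens. Qed.

Let pi_act (s t : (H ⊗ H)%type) :
  tmap pi idfun (tact (fun x y => x * y) (fun x y => x * y) s t) =
  tact (factor_act (I := C)) (fun x y => x * y) s (tmap pi idfun t).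
Proof.
have hm := mul_bilinear H; have ha := factor_act_bilinear C.
have b1 := tact_is_bilinear hm hm; have b2 := tact_is_bilinear ha hm.
rewrite -[LHS]/((tmap pi idfun \o bil_appr b1 s) t) -[RHS]/((bil_appr b2 s \o tmap pi idfun) t).
apply: tens_ext => u v.
rewrite -[LHS]/((tmap pi idfun \o bil_appl b1 (u ⊗ v)) s) -[RHS]/((bil_appl b2 (tmap pi idfun (u ⊗ v))) s).
apply: tens_ext => x y.
by rewrite /= tmap_tens !tact_tens //= tmap_tens factor_actE.
Qed.

Let coinvM : GRing.mulr_2closed coinv.
Proof.
move=> x y /coinvP xC /coinvP yC; apply/coinvP; rewrite comulM pi_act yC.
have hm := mul_bilinear H; have ha := factor_act_bilinear C.
have b2 := tact_is_bilinear ha hm.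
pose My := bil_appl hm y.
transitivity (tmap idfun My (tmap pi idfun (comul x))); last by rewrite xC tmap_tens.
rewrite -[LHS]/(bil_appl b2 (pi 1 ⊗ y) (comul x)) -[RHS]/((tmap idfun My \o tmap pi idfun) (comul x)).
apply: tens_ext => u v /=.
by rewrite tact_tens // factor_actE mulr1 tmap_tens (tmap_tens idfun My).
Qed.

Let coinv_subalg : GRing.subalg_closed coinv. Proof. by split. Qed.

Let coinv_submod : GRing.submod_closed coinv. Proof. by split. Qed.
HB.instance Definition _ := GRing.isSubmodClosed.Build k H coinv
  (GRing.submod_closed_semi coinv_submod).

Let coinv_coideal h : h \in coinv -> comul h \in tsubl coinv.
Proof.
move=> /coinvP hC; apply: slice_tsubl => phi; apply/coinvP.
pose D := @comul k H.
transitivity (tmap idfun (slice phi)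
    (tassoc (tmap (tmap pi idfun \o D) idfun (comul h)))).
  move: (comul h) => t.
  rewrite -[LHS]/((tmap pi idfun \o D \o slice phi) t).
  rewrite -[RHS]/((tmap idfun (slice phi) \o (@tassoc k (factor C) H H) \o
    tmap (tmap pi idfun \o D) idfun) t).
  apply: tens_ext => u v /=; rewrite slice_tens linearZ /= linearZ /= tmap_tens /=.
  rewrite -[RHS]/((tmap idfun (slice phi) \o @tassoc k (factor C) H H \o
    bil_appl (@tens_is_bilinear _ _ _) v) (tmap pi idfun (comul u))).
  rewrite -[LHS]/((phi v \*: idfun) (tmap pi idfun (comul u))).
  apply: tens_ext => c x /=.
  by rewrite tassoc_tens tmap_tens /= slice_tens tensZr.
suff -> : tassoc (tmap (tmap pi idfun \o D) idfun (comul h)) =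
    tmap idfun D (tmap pi idfun (comul h)) by rewrite hC !tmap_tens.
rewrite (@tmap_ext _ _ _ _ _ _ (tmap pi idfun \o D) _ (idfun \o idfun)) //.
rewrite -(tmap_comp D idfun (tmap pi idfun) idfun) tassoc_nat comulA !tmap_comp.
apply: tmap_ext => // x /=; rewrite [RHS](tens_sum (D x)) [X in tmap _ _ X](tens_sum (D x)).
by rewrite linear_sum; apply: eq_bigr => p _ /=; rewrite tmap_tens.
Qed.

Definition takeuchi_subalg : rcSubalg H := RCSubalg coinv_subalg coinv_coideal.

End CoinvariantSubalgebra.

Section RelativeHopfModules.
Variables (k : fieldType) (H : hopfType k).

Section OverSubalgebra.
Variable A : rcSubalg H.

(* Right A-modules are left modules over the converse algebra A^c; ract m a is m a. *)
Definition ract (M : lmodType (rcs_alg A)^c) (m : kspace M) (a : rcs_alg A) : kspace M :=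
  @kact k (rcs_alg A)^c M a m.

Lemma ract1 (M : lmodType (rcs_alg A)^c) (m : kspace M) : ract m 1 = m.
Proof. exact: (@scale1r (rcs_alg A)^c M). Qed.

Lemma ractA (M : lmodType (rcs_alg A)^c) (m : kspace M) (a b : rcs_alg A) :
  ract (ract m a) b = ract m (a * b).
Proof. by rewrite /ract /kact scalerA. Qed.

Lemma ract_bilinear (M : lmodType (rcs_alg A)^c) : bilinear_for *:%R *:%R (@ract M).
Proof. by have b := @kact_bilinear k (rcs_alg A)^c M; split; [exact: b.2 | exact: b.1]. Qed.

Record hopfmod_MAH := HopfMod_MAH {
  MAH_mod :> lmodType (rcs_alg A)^c;
  MAH_coact : {linear kspace MAH_mod -> (kspace MAH_mod ⊗ H)%type};
  MAH_comod : is_rcomod MAH_coact;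
  MAH_compat : forall (m : kspace MAH_mod) (a : rcs_alg A),
    MAH_coact (ract m a) =
    tact (@ract _) (fun x y => x * y) (MAH_coact m) (rcs_comul a)
}.

Record hopfmod_AMH := HopfMod_AMH {
  AMH_mod :> lmodType (rcs_alg A);
  AMH_coact : {linear kspace AMH_mod -> (kspace AMH_mod ⊗ H)%type};
  AMH_comod : is_rcomod AMH_coact;
  AMH_compat : forall (a : rcs_alg A) (m : kspace AMH_mod),
    AMH_coact (kact a m) =
    tact (fun a m => kact a m) (fun x y => x * y) (rcs_comul a) (AMH_coact m)
}.

End OverSubalgebra.

Section OverFactor.
Variable C : factorCoalg H.

Record hopfmod_CHM := HopfMod_CHM {
  CHM_mod :> lmodType H;
  CHM_coact : {linear kspace CHM_mod -> (factor C ⊗ kspace CHM_mod)%type};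
  CHM_comod : is_lcomod CHM_coact;
  CHM_compat : forall (h : H) (m : kspace CHM_mod),
    CHM_coact (kact h m) =
    tact (fun h c => factor_act h c) (fun h m => kact h m) (comul h) (CHM_coact m)
}.

Record hopfmod_HMC := HopfMod_HMC {
  HMC_mod :> lmodType H;
  HMC_coact : {linear kspace HMC_mod -> (kspace HMC_mod ⊗ factor C)%type};
  HMC_comod : is_rcomod HMC_coact;
  HMC_compat : forall (h : H) (m : kspace HMC_mod),
    HMC_coact (kact h m) =
    tact (fun h m => kact h m) (fun h c => factor_act h c) (comul h) (HMC_coact m)
}.

Definition CHM_lcomod (M : hopfmod_CHM) : lcomod (factor C) := LComod (CHM_comod M).
Definition HMC_rcomod (M : hopfmod_HMC) : rcomod (factor C) := RComod (HMC_comod M).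

End OverFactor.

End RelativeHopfModules.

(* f and g restrict to mutually inverse bijections between {x | P x} and {y | Q y}. *)
Definition inverse_bijections (X Y : Type) (P : X -> Prop) (Q : Y -> Prop)
    (f : X -> Y) (g : Y -> X) : Prop :=
  [/\ forall x, P x -> Q (f x), forall y, Q y -> P (g y),
      forall x, P x -> g (f x) = x & forall y, Q y -> f (g y) = y].

(* Main.v *)
(* Let all objects of [M_A^H] be projective and [C = H / H A^+]. Then subobjects of [Z ⊗ H] in
   [M_A^H] are direct summands as [A]-modules. Hence [A] has a right [A]-linear retraction
   [p : H -> A], a coinvariant [h] equals [\sum p(h_1) S(h_2) h_3 = p(h)], and morphisms
   [d : Y ⊗ H -> Z ⊗ H] of [M_A^H] are regular: [d g d = d] for some [A]-linear [g]. For an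
   object [M] of [{}_H^C M], maps of the form [z ⊗ (pi x ⊗ m) |-> \sum Phi (z ⊗ x_1) (S x_2 m)]
   turn [g] into solutions in [M] of linear systems that are solvable in [C ⊗ M]; with these
   systems a colinear map into [M] is extended along one finite-dimensional subcomodule at a
   time, and Zorn's lemma shows that [M] is injective.

   Conversely, let all objects of [{}_H^C M] be injective and [A = {}^{co C} H]. The coaction
   of [M] has a colinear retraction [r], the elements [\sum S(h_1) r(pi h_2 ⊗ m)] are
   coinvariant, and they generate [M]. For [M = ker pi] this gives [ker pi = H A^+]. For
   [S1 <= S2] subobjects of [X] in [M_A^H] with [W] the dual of a finite-dimensional
   [S2/S1 ⊗_A k], the coinvariants of [H ⊗ W] are [A]-linear maps [S2/S1 -> A]; together with
   the elements of [X] they form a dual basis modulo [S1]. So [S2/S1] is projective, and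
   Zorn's lemma shows that [X] is.

   Left [A]-modules are right [A^c]-modules: the second pair of bijections is the first one for
   the Hopf algebra [H^c], whose antipode is [S^-1], and the factor [pi \o S^-1] onto [C] with
   reversed comultiplication; [S^-1] exchanges [H A^+] and [A^+ H]. *)
From HB Require Import structures.
Require Import Defs.
From mathcomp Require Import all_boot all_order all_algebra.
From mathcomp Require Import boolp classical_sets.

Set Implicit Arguments.
Unset Strict Implicit.
Unset Printing Implicit Defensive.

Import GRing.Theory.

Local Open Scope classical_set_scope.
Local Open Scope ring_scope.

(** * Bilinear maps and sums over tensors *)

(** Tensor products over [A] are never formed. For a left [H]-module [L] and [C = H / H A^+], the
    space [H ⊗_A L] is [C ⊗ L], through [h ⊗ l |-> \sum pi h_1 ⊗ h_2 l] and its inverse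
    [pi x ⊗ l |-> \sum x_1 ⊗ S x_2 l], and every map on it is written on [C ⊗ L]. Regularity
    [d g d = d] is an identity between [A]-linear maps, so it survives this passage without any
    flatness. Solvability in [C ⊗ M] comes for free, because [C ⊗ M] is cofree: any linear map
    [P -> M] induces a colinear map [P -> C ⊗ M].

    Neither Zorn argument can proceed by one vector at a time: the domain has to stay a subcomodule
    in one and a subobject in the other. The steps are finite because unknowns are collected in
    coordinates in the first, and because the dual [W] of a comodule is a comodule only in finite
    dimension in the second.

    The factor is an arbitrary coalgebra [C] with [is_quotient], so that the same lemmas apply to
    [pi] and to [pi] composed with [S^{-1}], whose target is the reversed coalgebra. *)

Definition lin (k : fieldType) (U V : lmodType k) (f : U -> V) : Prop :=
  forall a x y, f (a *: x + y) = a *: f x + f y.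

Definition bil (k : fieldType) (U V W : lmodType k) (F : U -> V -> W) : Prop :=
  (forall v, lin (fun u => F u v)) /\ (forall u, lin (F u)).

(** Sweedler notation. The sum runs over the chosen representative of the tensor: exchanging two
    sums or comparing them term by term needs no hypothesis, whereas evaluation at a pure tensor
    needs a bilinear summand. *)
Notation "'\tsum_(' x , y '<-' t ')' F" := (tlift (fun x y => F) t)
  (at level 41, x name, y name, F at level 41,
   format "'[' '\tsum_(' x ,  y  '<-'  t ')' '/  '  F ']'") : ring_scope.

Section Lin.
Variable k : fieldType.
Implicit Types U V W X Y : lmodType k.

Definition mklin U V (f : U -> V) (hf : lin f) : {linear U -> V} :=
  HB.pack f (GRing.isLinear.Build k U V _ f hf).

Definition mkscalar V (f : V -> k) (hf : lin (V := k^o) f) : {scalar V} :=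
  HB.pack f (GRing.isLinear.Build k V k *%R f hf).

Lemma linE U V (f : {linear U -> V}) : lin f.
Proof. by move=> a x y; rewrite linearP. Qed.

Lemma lin_id U : lin (fun x : U => x). Proof. by []. Qed.

Lemma lin_app U V W (f : {linear V -> W}) (g : U -> V) : lin g -> lin (fun x => f (g x)).
Proof. by move=> hg a x y; rewrite hg linearP. Qed.

Lemma lin_scalar U V (f : {scalar V}) (g : U -> V) :
  lin g -> lin (V := k^o) (fun x => f (g x)).
Proof. by move=> hg a x y; rewrite hg linearP. Qed.

Lemma lin_slice U V X (phi : {scalar V}) (f : X -> (U ⊗ V)%type) :
  lin f -> lin (fun x => slice phi (f x)).
Proof. by move=> hf a x y; rewrite hf linearP. Qed.

Lemma lin_comp U V W (f : V -> W) (g : U -> V) : lin f -> lin g -> lin (fun x => f (g x)).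
Proof. by move=> hf hg a x y; rewrite hg hf. Qed.

Lemma lin_add U V (f g : U -> V) : lin f -> lin g -> lin (fun x => f x + g x).
Proof. by move=> hf hg a x y; rewrite hf hg scalerDr addrACA. Qed.

Lemma lin_opp U V (f : U -> V) : lin f -> lin (fun x => - f x).
Proof. by move=> hf a x y; rewrite hf scalerN opprD. Qed.

Lemma lin_scale U V (f : U -> V) b : lin f -> lin (fun x => b *: f x).
Proof. by move=> hf a x y; rewrite hf scalerDr !scalerA mulrC. Qed.

Lemma lin_scalel U V (f : U -> k^o) (v : V) : lin f -> lin (fun x => (f x : k) *: v).
Proof. by move=> hf a x y; rewrite hf scalerDl -scalerA. Qed.

Lemma lin_sum U V (I : Type) (r : seq I) (P : pred I) (F : U -> I -> V) :
  (forall i, lin (F^~ i)) -> lin (fun x => \sum_(i <- r | P i) F x i).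
Proof.
move=> hF a x y; rewrite scaler_sumr -big_split /=; apply: eq_bigr => i _.
exact: hF.
Qed.

Lemma lin_tlift U V W X (F : X -> U -> V -> W) (t : (U ⊗ V)%type) :
  (forall u v, lin (fun x => F x u v)) -> lin (fun x => \tsum_(u, v <- t) F x u v).
Proof. by move=> hF; exact: (@lin_sum _ _ _ _ _ (fun x (p : U * V) => F x p.1 p.2)). Qed.

Lemma lin_tliftr U V W X (F : U -> V -> W) (f : X -> (U ⊗ V)%type) :
  bil F -> lin f -> lin (fun x => tlift F (f x)).
Proof.
move=> [hF1 hF2] hf a x y; rewrite hf.
by rewrite (tlift_is_linear (b := F)).
Qed.

Lemma lin_bill U V W X (F : U -> V -> W) (f : X -> U) v :
  bil F -> lin f -> lin (fun x => F (f x) v).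
Proof. by move=> [hF _] hf a x y; rewrite hf; apply: hF. Qed.

Lemma lin_bilr U V W X (F : U -> V -> W) (f : X -> V) u :
  bil F -> lin f -> lin (fun x => F u (f x)).
Proof. by move=> [_ hF] hf a x y; rewrite hf; apply: hF. Qed.

Lemma lin_tensl U V X (f : X -> U) (v : V) : lin f -> lin (fun x => f x ⊗ v).
Proof. by move=> hf a x y; rewrite hf tensDl tensZl. Qed.

Lemma lin_tensr U V X (f : X -> V) (u : U) : lin f -> lin (fun x => u ⊗ f x).
Proof. by move=> hf a x y; rewrite hf tensDr tensZr. Qed.

Lemma lin_mull (B : algType k) X (f : X -> B) v : lin f -> lin (fun x => f x * v).
Proof. by move=> hf a x y; rewrite hf mulrDl scalerAl. Qed.

Lemma lin_mulr (B : algType k) X (f : X -> B) v : lin f -> lin (fun x => v * f x).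
Proof. by move=> hf a x y; rewrite hf mulrDr scalerAr. Qed.

Lemma lin_comul (C : coalgType k) X (f : X -> C) : lin f -> lin (fun x => comul (f x)).
Proof. by move=> hf a x y; rewrite hf linearP. Qed.

Lemma lin_counit (C : coalgType k) X (f : X -> C) :
  lin f -> lin (fun x => counit (f x) : k^o).
Proof. by move=> hf a x y; rewrite hf linearP. Qed.

Lemma lin_antipode (H : hopfType k) X (f : X -> H) :
  lin f -> lin (fun x => antipode (f x)).
Proof. by move=> hf a x y; rewrite hf linearP. Qed.

Lemma bil_for U V W (F : U -> V -> W) : bil F -> bilinear_for *:%R *:%R F.
Proof. by case=> hl hr; split=> [v|u] a x y; [exact: hl | exact: hr]. Qed.

Lemma bilP U V W (F : U -> V -> W) : bilinear_for *:%R *:%R F -> bil F.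
Proof. by case=> hl hr; split=> [v|u] a x y; [exact: hl | exact: hr]. Qed.

Lemma tliftE U V W (F : U -> V -> W) u v : bil F -> tlift F (u ⊗ v) = F u v.
Proof. by move=> hF; rewrite tlift_tens //; exact: bil_for. Qed.

Lemma tlift_lin U V W (F : U -> V -> W) : bil F -> lin (tlift F).
Proof. by move=> hF; exact: lin_tliftr (@lin_id _). Qed.

End Lin.

(** Extension point of [lin1], redefined once the swap of tensor factors is available. *)
Ltac lin_hook := fail.

(** Linearity is kept as the bare predicate [lin], so that it can be proved for a lambda-term by
    peeling off its outermost operation. Local maps are recognised through [lin] and [bil]
    hypotheses; many [have] steps below serve only to put such a hypothesis into the context. *)
Ltac lin1 :=
  match goal with
  | |- bil _ => split=> ?
  | |- bilinear_for _ _ _ => apply: bil_for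
  | |- GRing.linear_for _ _ => hnf
  | |- forall _, _ => intro
  | |- lin (fun x => x) => exact: lin_id
  | H : lin ?f |- lin ?f => exact: H
  | |- lin (fun x => GRing.add (@?f x) (@?g x)) => apply: (lin_add (f := f) (g := g))
  | |- lin (fun x => GRing.opp (@?f x)) => apply: (lin_opp (f := f))
  | |- lin (fun x => tens (@?f x) ?v) => apply: (lin_tensl (f := f))
  | |- lin (fun x => tens ?u (@?f x)) => apply: (lin_tensr (f := f))
  | |- lin (fun x => GRing.mul (@?f x) ?v) => apply: (lin_mull (f := f))
  | |- lin (fun x => GRing.mul ?u (@?f x)) => apply: (lin_mulr (f := f))
  | |- lin (fun x => GRing.scale ?u (@?f x)) => apply: (lin_scale (f := f))
  | |- lin (fun x => GRing.scale (@?f x) ?v) => apply: (lin_scalel (f := f))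
  | |- lin (fun x => comul (@?f x)) => apply: (lin_comul (f := f))
  | |- lin (fun x => counit (@?f x)) => apply: (lin_counit (f := f))
  | |- lin (fun x => antipode (@?f x)) => apply: (lin_antipode (f := f))
  | |- lin (fun x => tlift ?F (@?f x)) => apply: (lin_tliftr (F := F) (f := f))
  | |- lin (fun x => tlift (@?F x) ?t) => apply: (lin_tlift (F := F))
  | |- lin (fun x => GRing.Linear.sort ?g (@?f x)) => apply: (@lin_app _ _ _ _ g f)
  | |- lin (fun x => GRing.Linear.sort ?g (@?f x)) => apply: (@lin_scalar _ _ _ g f)
  | |- lin (GRing.Linear.sort ?g) => apply: (@lin_scalar _ _ _ g (fun x => x))
  | |- lin (slice (GRing.Linear.sort ?g)) => apply: (@lin_slice _ _ _ _ g (fun x => x))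
  | |- lin (fun x => slice (GRing.Linear.sort ?g) (@?f x)) => apply: (@lin_slice _ _ _ _ g f)
  | H : bil ?F |- lin (fun x => ?F (@?f x) ?v) => apply: (@lin_bill _ _ _ _ _ _ f v H)
  | H : bil ?F |- lin (fun x => ?F ?u (@?f x)) => apply: (@lin_bilr _ _ _ _ _ _ f u H)
  | H : bil ?F |- lin (?F ?u) => apply: (proj2 H)
  | H : bil ?F |- bil ?F => exact: H
  | H : lin ?F |- lin (fun x => ?F (@?f x)) => apply: (lin_comp (f := F) (g := f) H)
  | |- lin (GRing.Linear.sort ?g) => exact: linE
  | |- lin (tens ?u) => apply: (lin_tensr (f := fun x => x))
  | |- lin (GRing.scale ?u) => apply: (lin_scale (f := fun x => x))
  | |- lin (GRing.mul ?u) => apply: (lin_mulr (f := fun x => x))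
  | |- lin (tlift ?F) => apply: tlift_lin
  | |- lin (@comul _ _) => exact: linE
  | |- lin (@antipode _ _) => exact: linE
  | |- lin _ => lin_hook
  end.

Ltac lin := solve [repeat (lin1 || done)].

Definition trilin (k : fieldType) (U V W X : lmodType k) (F : U -> V -> W -> X) : Prop :=
  [/\ forall v w, lin (fun u => F u v w), forall u w, lin (fun v => F u v w) &
      forall u v, lin (F u v)].

Section SumCalculus.
Variable k : fieldType.
Implicit Types U V W X Y : lmodType k.

Lemma lin0 U V (f : U -> V) : lin f -> f 0 = 0.
Proof. by move=> hf; have /eqP := hf (-1) 0 0; rewrite scaler0 addr0 scaleN1r addNr => /eqP. Qed.

Lemma linD U V (f : U -> V) : lin f -> {morph f : x y / x + y}.
Proof. by move=> hf x y; have := hf 1 x y; rewrite !scale1r. Qed.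

Lemma linZ U V (f : U -> V) a : lin f -> {morph f : x / a *: x}.
Proof. by move=> hf x; have := hf a x 0; rewrite (lin0 hf) !addr0. Qed.

Lemma linB U V (f : U -> V) : lin f -> {morph f : x y / x - y}.
Proof. by move=> hf x y; rewrite -[- y]scaleN1r linD // linZ // scaleN1r. Qed.

Lemma lin_big U V (f : U -> V) (I : Type) (r : seq I) (F : I -> U) : lin f ->
  f (\sum_(i <- r) F i) = \sum_(i <- r) f (F i).
Proof. by move=> hf; rewrite -[f _]/(mklin hf _) linear_sum. Qed.

Lemma lin_tsum U V X Y (f : X -> Y) (F : U -> V -> X) (t : (U ⊗ V)%type) : lin f ->
  f (tlift F t) = \tsum_(u, v <- t) f (F u v).
Proof. by move=> hf; rewrite /tlift lin_big. Qed.

Lemma tsum_id U V (t : (U ⊗ V)%type) : \tsum_(u, v <- t) u ⊗ v = t.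
Proof. exact/esym/tens_sum. Qed.

Lemma tsum_tsum U V U' V' X (F : U' -> V' -> X) (G : U -> V -> (U' ⊗ V')%type)
  (t : (U ⊗ V)%type) : bil F ->
  tlift F (tlift G t) = \tsum_(u, v <- t) tlift F (G u v).
Proof. by move=> hF; rewrite lin_tsum //; lin. Qed.

Lemma tsum_exchange U V U' V' X (F : U -> V -> U' -> V' -> X) s t :
  \tsum_(u, v <- s) \tsum_(x, y <- t) F u v x y =
  \tsum_(x, y <- t) \tsum_(u, v <- s) F u v x y.
Proof. exact: exchange_big. Qed.

Lemma tsumB U V X (F G : U -> V -> X) t :
  \tsum_(u, v <- t) (F u v - G u v) = tlift F t - tlift G t.
Proof. exact: sumrB. Qed.

Lemma tsumZ U V X (F : U -> V -> X) a t :
  \tsum_(u, v <- t) (a *: F u v) = a *: tlift F t.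
Proof. by rewrite /tlift scaler_sumr. Qed.

Lemma tsum_ext U V X (F G : (U ⊗ V)%type -> X) : lin F -> lin G ->
  (forall u v, F (u ⊗ v) = G (u ⊗ v)) -> F =1 G.
Proof. by move=> hF hG FG; exact: (tens_ext (f := mklin hF) (g := mklin hG)). Qed.

Lemma tassoc_sum U V W X (F : U -> V -> W -> X) (t : ((U ⊗ V) ⊗ W)%type) : trilin F ->
  \tsum_(u, s <- tassoc t) \tsum_(v, w <- s) F u v w =
  \tsum_(s, w <- t) \tsum_(u, v <- s) F u v w.
Proof.
case=> h1 h2 h3; rewrite tsum_tsum; last by lin.
apply: eq_tlift => s w; rewrite tsum_tsum; last by lin.
by apply: eq_tlift => u v; rewrite tliftE ?tliftE; [| lin | lin].
Qed.

(** The axioms are equalities of tensors; here and in the next lemmas they are restated under an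
    arbitrary multilinear continuation, which is the form in which Sweedler computations rewrite
    with them. *)
Lemma comulA_sum (C : coalgType k) X (F : C -> C -> C -> X) (c : C) : trilin F ->
  \tsum_(x, y <- comul c) \tsum_(x1, x2 <- comul x) F x1 x2 y =
  \tsum_(x, y <- comul c) \tsum_(y1, y2 <- comul y) F x y1 y2.
Proof.
move=> tF; have [h1 h2 h3] := tF.
transitivity (\tsum_(s, w <- tmap (@comul k C) idfun (comul c)) \tsum_(u, v <- s) F u v w).
  rewrite tsum_tsum; last by lin.
  by apply: eq_tlift => x y; rewrite tliftE //; lin.
rewrite -tassoc_sum // comulA tsum_tsum; last by lin.
by apply: eq_tlift => x y; rewrite tliftE //; lin.
Qed.

Lemma counitl_sum (C : coalgType k) X (f : C -> X) (c : C) : lin f ->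
  \tsum_(x, y <- comul c) (counit x *: f y) = f c.
Proof.
move=> hf; rewrite -[in RHS](counitl c) lin_tsum //.
by apply: eq_tlift => x y; rewrite linZ.
Qed.

Lemma counitr_sum (C : coalgType k) X (f : C -> X) (c : C) : lin f ->
  \tsum_(x, y <- comul c) (counit y *: f x) = f c.
Proof.
move=> hf; rewrite -[in RHS](counitr c) lin_tsum //.
by apply: eq_tlift => x y; rewrite linZ.
Qed.

Lemma antipodel_sum (H : hopfType k) X (f : H -> X) (h : H) : lin f ->
  \tsum_(x, y <- comul h) f (antipode x * y) = counit h *: f 1.
Proof. by move=> hf; rewrite -linZ // -[_%:A]antipodel lin_tsum. Qed.

Lemma antipoder_sum (H : hopfType k) X (f : H -> X) (h : H) : lin f ->
  \tsum_(x, y <- comul h) f (x * antipode y) = counit h *: f 1.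
Proof. by move=> hf; rewrite -linZ // -[_%:A]antipoder lin_tsum. Qed.

Lemma comulM_sum (H : hopfType k) X (F : H -> H -> X) (g h : H) : bil F ->
  tlift F (comul (g * h)) =
  \tsum_(g1, g2 <- comul g) \tsum_(h1, h2 <- comul h) F (g1 * h1) (g2 * h2).
Proof.
move=> hF; rewrite comulM tsum_tsum //.
apply: eq_tlift => g1 g2; rewrite tsum_tsum //.
by apply: eq_tlift => h1 h2; rewrite tliftE.
Qed.

Lemma comul1_sum (H : hopfType k) X (F : H -> H -> X) : bil F ->
  tlift F (comul (1 : H)) = F 1 1.
Proof. by move=> hF; rewrite comul1 tliftE. Qed.

(** The chosen representative of [t] need not have its left entries in [S], so the comparison goes
    through the generators of [tsubl S] instead of through the summands. *)
Lemma tsubl_eq U V X (S : {pred U}) (F G : U -> V -> X) t : bil F -> bil G ->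
  t \in tsubl (V := V) S -> (forall u v, u \in S -> F u v = G u v) ->
  tlift F t = tlift G t.
Proof.
move=> hF hG tS FG; apply/eqP; rewrite -subr_eq0 -tsumB; apply/eqP.
have hB : bil (fun u v => F u v - G u v) by lin.
apply: (lspan_ker (f := mklin (tlift_lin hB))) tS => _ [u [v [uS ->]]] /=.
by rewrite tliftE // FG // subrr.
Qed.

Lemma tsubl_sub U V X (S : {pred U}) (K : submodClosed X) (F : U -> V -> X) t : bil F ->
  t \in tsubl (V := V) S -> (forall u v, u \in S -> F u v \in K) -> tlift F t \in K.
Proof.
move=> hF tS FK; apply: (lspan_map (f := mklin (tlift_lin hF))) tS => _ [u [v [uS ->]]] /=.
by rewrite tliftE // FK.
Qed.

Lemma tsubl_tens U V (S : {pred U}) u v : u \in S -> u ⊗ v \in tsubl (V := V) S.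
Proof. by move=> uS; apply: lspan_gen; exists u, v. Qed.

(** This is [slice_tsubl] for the zero subspace: a tensor all of whose slices vanish lies in
    [0 ⊗ V]. *)
Lemma slice_ext U V (s t : (U ⊗ V)%type) :
  (forall phi : {scalar V}, slice phi s = slice phi t) -> s = t.
Proof.
move=> st; apply/eqP; rewrite -subr_eq0; apply/eqP.
pose K : {pred U} := lspan set0.
have : s - t \in tsubl (V := V) K.
  by apply: slice_tsubl => phi; rewrite linearB /= st subrr rpred0.
move=> /(tsubl_eq (F := @tens k U V) (G := fun _ _ => 0)); rewrite tsum_id.
rewrite [in X in _ = X]/tlift [X in _ = X]big1 //; apply.
- by lin.
- by split=> ? a x y; rewrite scaler0 addr0.
move=> u v /(lspan_ker (f := idfun : {linear U -> U})) /= u0.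
by rewrite u0 ?tens0l.
Qed.

(** The slices of [t] form a subspace [K], and [t] lies in [K ⊗ V] by [slice_tsubl]. Having slices
    of [t] itself as left entries is what makes the span of the coefficients of a coaction a
    subcomodule. *)
Lemma slice_repr U V (t : (U ⊗ V)%type) :
  exists n (phi : 'I_n -> {scalar V}) (v : 'I_n -> V),
    t = \sum_(i < n) slice (phi i) t ⊗ v i.
Proof.
pose K : {pred U} := [pred u | `[< exists phi : {scalar V}, u = slice phi t >]].
have KZ a u : u \in K -> a *: u \in K.
  case/asboolP=> phi ->; apply/asboolP.
  have hphi : lin (V := k^o) (fun v => a * phi v).
    by move=> b x y; rewrite linearP /= mulrDr mulrCA.
  exists (mkscalar hphi).
  by rewrite /slice /tlift scaler_sumr; apply: eq_bigr => p _; rewrite scalerA.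
have Kclosed : GRing.submod_closed K.
  split=> [|a x y /(KZ a)/asboolP[phi ->] /asboolP[psi ->]]; apply/asboolP.
    have h0 : lin (V := k^o) (fun _ : V => 0) by move=> a x y; rewrite scaler0 addr0.
    exists (mkscalar h0).
    by rewrite /slice /tlift big1 // => p _ /=; rewrite scale0r.
  have hD : lin (V := k^o) (fun v => phi v + psi v).
    by move=> b u v; rewrite !linearP /= scalerDr addrACA.
  exists (mkscalar hD).
  by rewrite /slice /tlift -big_split; apply: eq_bigr => p _ /=; rewrite -scalerDl.
pose KS : submodClosed U := HB.pack K
  (GRing.isSubmodClosed.Build k U _ (GRing.submod_closed_semi Kclosed)).
have : t \in tsubl (V := V) KS.
  by apply: slice_tsubl => phi; apply/asboolP; exists phi.
case/asboolP=> n [c [x [Xx tE]]].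
have /choice[f fP] : forall i, exists p : {scalar V} * V, x i = slice p.1 t ⊗ p.2.
  by move=> i; have [u [v [/asboolP[phi ->] ->]]] := Xx i; exists (phi, v).
exists n, (fun i => (f i).1), (fun i => c i *: (f i).2).
by rewrite {1}tE; apply: eq_bigr => i _; rewrite fP tensZr.
Qed.
End SumCalculus.

(** * Zorn's lemma for linear graphs *)

Definition mklinear (R : pzRingType) (V W : lmodType R) (f : V -> W) (hf : linear f) :
  {linear V -> W} := HB.pack f (GRing.isLinear.Build R V W _ f hf).

Section LinearGraphs.
Variables (R : nzRingType) (V W : lmodType R) (psi : set (V * W) -> V * W -> Prop).

(** The graph of a linear map defined on a submodule of [V]. The base is a ring, since the lemma
    below is used over the field and over the algebra acting on a module. *)
Definition linear_graph (G : set (V * W)) : Prop :=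
  [/\ G 0, forall a x y, G x -> G y -> G (a *: x + y) & forall w, G (0, w) -> w = 0].

Definition good_graph (G : set (V * W)) : Prop :=
  linear_graph G /\ forall x, G x -> psi G x.

(** The condition [psi] on a point may refer to the whole graph, as colinearity involves the values
    at other points; its monotonicity carries it over to unions of chains. *)
Lemma zorn_graph (G0 : set (V * W)) :
  (forall G G' x, (G `<=` G')%classic -> psi G x -> psi G' x) -> good_graph G0 ->
  (forall G v, good_graph G -> (G0 `<=` G)%classic -> (forall w, ~ G (v, w)) ->
     exists G', [/\ good_graph G', (G `<=` G')%classic & exists w, G' (v, w)]) ->
  exists f : {linear V -> W},
    (forall v w, G0 (v, w) -> f v = w) /\ forall v, psi [set x | x.2 = f x.1] (v, f v).
Proof.
move=> psi_mono gG0 step; have [[G00 _ _] _] := gG0.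
pose P (X : set (V * W)) := (exists x, X x) -> (G0 `<=` X)%classic /\ good_graph X.
have [F FP Ftot|X [PX Xmax]] := @Zorn_bigcup _ P.
  move=> [x0 [X0 FX0 X0x0]].
  have good X x : F X -> X x -> (G0 `<=` X)%classic /\ good_graph X.
    by move=> FX Xx; apply: (FP X FX); exists x.
  have sub X : F X -> (X `<=` \bigcup_(Y in F) Y)%classic by move=> FX x Xx; exists X.
  split=> [x G0x|]; first by exists X0 => //; exact: (good _ _ FX0 X0x0).1.
  split.
    split=> [|a x y [X FX Xx] [Y FY Yy]|w [X FX Xw]].
    - by exists X0 => //; apply: (good _ _ FX0 X0x0).1.
    - have [XY|YX] := Ftot X Y FX FY.
        by exists Y => //; have [_ [[_ + _] _]] := good _ _ FY Yy; apply=> //; exact: XY.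
      by exists X => //; have [_ [[_ + _] _]] := good _ _ FX Xx; apply=> //; exact: YX.
    - by have [_ [[_ _ +] _]] := good _ _ FX Xw; apply.
  move=> x [X FX Xx]; have [_ [_ psiX]] := good _ _ FX Xx.
  by apply: psi_mono (sub _ FX) _; exact: psiX.
have [x Xx] : exists x, X x.
  have [//|XE] := pselect (exists x, X x); exfalso; apply: (Xmax G0) => [|_]; last first.
    by split=> //.
  by split=> [y Xy|G0X]; [case: XE; exists y | apply: XE; exists 0; exact: G0X].
have [G0X [[X0 Xlin Xfun] psiX]] := PX (ex_intro _ x Xx).
have Xdom v : exists w, X (v, w).
  have [//|nX] := pselect (exists w, X (v, w)).
  have [|w Xw|G' [gG' XG' [w G'w]]] := step X v _ G0X; first by [].
    by apply: nX; exists w.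
  exfalso; apply: (Xmax G') => [|_]; last by split=> // y /G0X /XG'.
  by split=> // G'X; apply: nX; exists w; exact: G'X.
have Xuniq v w w' : X (v, w) -> X (v, w') -> w = w'.
  move=> Xw Xw'; apply/eqP; rewrite -subr_eq0; apply/eqP/Xfun.
  have := Xlin (-1) _ _ Xw' Xw; rewrite scaleN1r.
  by congr X; congr pair; rewrite /= ?addNr // addrC.
pose f v : W := projT1 (cid (Xdom v)).
have fP v : X (v, f v) := projT2 (cid (Xdom v)).
have f_linear : linear f.
  by move=> a v v'; apply: Xuniq (fP _) _; have := Xlin a _ _ (fP v) (fP v').
exists (mklinear f_linear); split=> /= [v w G0vw|v].
  exact: Xuniq (fP v) (G0X _ G0vw).
apply: psi_mono (psiX _ (fP v)) => -[v' w'] /= Xw'.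
exact: Xuniq Xw' (fP v').
Qed.

End LinearGraphs.

Section VectorSpaces.
Variables (k : fieldType) (V W : lmodType k).

(** Chooses values linearly inside a total linear relation. With the full relation it extends linear
    maps, and with the relation [p w = v] it produces sections of [p]. *)
Lemma linear_selection (T : set (V * W)) (G0 : set (V * W)) :
  T 0 -> (forall a x y, T x -> T y -> T (a *: x + y)) -> (forall v, exists w, T (v, w)) ->
  linear_graph G0 -> (G0 `<=` T)%classic ->
  exists f : {linear V -> W},
    (forall v w, G0 (v, w) -> f v = w) /\ forall v, T (v, f v).
Proof.
move=> T0 Tlin Tdom lG0 G0T.
apply: (@zorn_graph k V W (fun _ => T)) => [//||G v [[G0' Glin Gfun] GT] _ nGv].
  by split=> // x /G0T.
have [w Tw] := Tdom v.
exists [set x | exists a y, G y /\ x = a *: (v, w) + y]; split; last first.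
- by exists w; exists 1, 0; rewrite scale1r addr0.
- by move=> y Gy; exists 0, y; rewrite scale0r add0r.
split=> [|_ [a [y [Gy ->]]]]; last by apply: Tlin => //; exact: GT.
split=> [|c _ _ [a [y [Gy ->]]] [b [z [Gz ->]]]|u [a [[y1 y2] [Gy]]]].
- by exists 0, 0; rewrite scale0r add0r.
- exists (c * a + b), (c *: y + z); split; first exact: Glin.
  by rewrite scalerDr scalerA scalerDl addrACA.
move=> -[/esym av uE].
have [a0|a0] := eqVneq a 0.
  by move: av uE; rewrite a0 !scale0r !add0r => y10 ->; apply: Gfun; rewrite -y10.
exfalso; apply: (nGv (- a^-1 *: y2)); have := Glin (- a^-1) _ _ Gy G0'; rewrite addr0.
congr G; congr pair; move/eqP: av; rewrite addrC addr_eq0 => /eqP ->.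
by rewrite scaleNr scalerN opprK scalerA mulVf // scale1r.
Qed.

(** As [i] need not be injective, this also factors a map through a surjection. *)
Lemma linear_extension (V' : lmodType k) (i : {linear V' -> V}) (f : {linear V' -> W}) :
  (forall x, i x = 0 -> f x = 0) -> exists g : {linear V -> W}, forall x, g (i x) = f x.
Proof.
move=> if0.
pose G0 : set (V * W) := [set x | exists y, x = (i y, f y)].
have lG0 : linear_graph G0.
  split=> [|a _ _ [y ->] [z ->]|w [y [/esym/if0 fy ->]]]; last by [].
    by exists 0; rewrite !linear0.
  by exists (a *: y + z); rewrite !linearP.
have [g [gP _]] := linear_selection (T := setT) I (fun _ _ _ _ _ => I)
  (fun v => ex_intro _ 0 I) lG0 (fun _ _ => I).
by exists g => x; apply: gP; exists x.
Qed.

End VectorSpaces.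

Lemma linear_section (k : fieldType) (V W : lmodType k) (p : {linear V -> W}) :
  (forall w, exists v, p v = w) -> exists s : {linear W -> V}, forall w, p (s w) = w.
Proof.
move=> p_surj.
pose T : set (W * V) := [set x | p x.2 = x.1].
have T0 : T 0 by exact: linear0.
have Tlin a x y : T x -> T y -> T (a *: x + y) by rewrite /T /= linearP => -> ->.
have l0 : linear_graph [set (0 : W * V)].
  by split=> [|a _ _ -> ->|w []//]; rewrite ?scaler0 ?addr0.
have [|s [_ sP]] := linear_selection T0 Tlin p_surj l0; first by move=> _ ->.
by exists s.
Qed.

(** * Antipode and relative Hopf modules *)

Section Antipode.
Variables (k : fieldType) (H : hopfType k).
Implicit Types g h : H.

(** Both sides are convolution inverses of the multiplication. The sum [X] is
    [S(g_1 h_1) g_2 h_2 S(h_3) S(g_3)]: contracting on the right leaves [S(g h)], contracting on the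
    left leaves [S(h) S(g)]. *)
Lemma antipodeM g h : antipode (g * h) = antipode h * antipode g.
Proof.
pose X := \tsum_(g1, g' <- comul g) \tsum_(h1, h' <- comul h)
  \tsum_(g2, g3 <- comul g') \tsum_(h2, h3 <- comul h')
    (antipode (g1 * h1) * (g2 * h2) * (antipode h3 * antipode g3)).
transitivity X.
  transitivity (\tsum_(g1, g' <- comul g) (counit g' *: antipode (g1 * h))).
    by rewrite counitr_sum //; lin.
  apply: eq_tlift => g1 g'.
  transitivity (\tsum_(h1, h' <- comul h) (counit h' *: (counit g' *: antipode (g1 * h1)))).
    by rewrite counitr_sum //; lin.
  apply: eq_tlift => h1 h'.
  transitivity (\tsum_(g2, g3 <- comul g')
    (counit h' *: (antipode (g1 * h1) * (g2 * antipode g3)))); last first.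
    apply: eq_tlift => g2 g3.
    rewrite -[RHS](eq_tlift (b := fun h2 h3 =>
      antipode (g1 * h1) * (g2 * (h2 * antipode h3) * antipode g3))); last first.
      by move=> h2 h3; rewrite !mulrA.
    rewrite (antipoder_sum (f := fun u => antipode (g1 * h1) * (g2 * u * antipode g3))) ?mulr1 //.
    by lin.
  rewrite tsumZ (antipoder_sum (f := fun u => antipode (g1 * h1) * u)) ?mulr1 //.
  by lin.
rewrite /X; under eq_tlift => g1 g' do rewrite tsum_exchange.
rewrite -(comulA_sum (F := fun g1 g2 g3 => \tsum_(h1, h' <- comul h)
  \tsum_(h2, h3 <- comul h')
    (antipode (g1 * h1) * (g2 * h2) * (antipode h3 * antipode g3)))); last by split=> *; lin.
transitivity (\tsum_(g', g3 <- comul g) (counit g' *: (antipode h * antipode g3))); last first.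
  by rewrite counitl_sum //; lin.
apply: eq_tlift => g' g3.
transitivity (\tsum_(h', h3 <- comul h) (counit h' *: (counit g' *: (antipode h3 * antipode g3)))); last first.
  by rewrite counitl_sum //; lin.
transitivity (\tsum_(g1, g2 <- comul g') \tsum_(h', h3 <- comul h) \tsum_(h1, h2 <- comul h')
  (antipode (g1 * h1) * (g2 * h2) * (antipode h3 * antipode g3))).
  apply: eq_tlift => g1 g2; rewrite comulA_sum //; split=> *; lin.
rewrite tsum_exchange; apply: eq_tlift => h' h3.
rewrite -(comulM_sum (F := fun x y => antipode x * y * (antipode h3 * antipode g3))); last by lin.
rewrite (antipodel_sum (f := fun u => u * (antipode h3 * antipode g3))); last by lin.
by rewrite counitM mul1r scalerA mulrC.
Qed.

Lemma antipode1 : antipode (1 : H) = 1.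
Proof.
have := antipodel (1 : H); rewrite -[tlift _ _]/(\tsum_(x, y <- comul 1) (antipode x * y)).
by rewrite comul1_sum ?mulr1 ?counit1 ?scale1r //; lin.
Qed.

(** The same uniqueness of convolution inverses, now for [Delta] with values in [H ⊗ H]: [Y] is the
    product of [Delta(S h_1)], [Delta(h_2)] and the swapped [(S ⊗ S) Delta(h_3)], and [Phi]
    multiplies by the third factor. *)
Lemma comul_antipode_sum (X : lmodType k) (F : H -> H -> X) h : bil F ->
  tlift F (comul (antipode h)) = \tsum_(x, y <- comul h) F (antipode y) (antipode x).
Proof.
move=> hF; pose Phi u (a b : H) := \tsum_(e, f <- comul u) F (a * antipode f) (b * antipode e).
pose Y := \tsum_(h1, h' <- comul h) \tsum_(h2, h'' <- comul h')
  \tsum_(a, b <- comul (antipode h1)) \tsum_(c, d <- comul h2) Phi h'' (a * c) (b * d).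
transitivity Y.
  transitivity (\tsum_(h1, h' <- comul h) (counit h' *: tlift F (comul (antipode h1)))).
    by rewrite counitr_sum //; lin.
  apply: eq_tlift => h1 h'; rewrite [RHS]tsum_exchange -tsumZ; apply: eq_tlift => a b.
  rewrite [RHS](comulA_sum (F := fun c d u => Phi u (a * c) (b * d))); last first.
    by rewrite /Phi; split=> *; lin.
  transitivity (\tsum_(c, u <- comul h') F (a * c * antipode u) b); last first.
    apply: eq_tlift => c u; rewrite /Phi.
    rewrite -(comulA_sum (F := fun d e f => F (a * c * antipode f) (b * d * antipode e))); last first.
      by split=> *; lin.
    rewrite -[LHS](counitl_sum (f := fun u => F (a * c * antipode u) b)); last by lin.
    apply: eq_tlift => x y; under eq_tlift => d e do rewrite -[b * d * _]mulrA.
    by rewrite (antipoder_sum (f := fun v => F (a * c * antipode y) (b * v))) ?mulr1 //; lin.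
  under [RHS]eq_tlift => c u do rewrite -mulrA.
  by rewrite (antipoder_sum (f := fun v => F (a * v) b)) ?mulr1 //; lin.
rewrite /Y -(comulA_sum (F := fun h1 h2 h'' => \tsum_(a, b <- comul (antipode h1))
  \tsum_(c, d <- comul h2) Phi h'' (a * c) (b * d))); last by rewrite /Phi; split=> *; lin.
rewrite -[RHS](counitl_sum (f := fun u => \tsum_(x, y <- comul u) F (antipode y) (antipode x))); last by lin.
apply: eq_tlift => x y.
have hPhi : bil (Phi y) by rewrite /Phi; lin.
under eq_tlift => x1 x2 do rewrite -(comulM_sum _ _ hPhi).
rewrite (antipodel_sum (f := fun u => tlift (Phi y) (comul u))); last by lin.
rewrite comul1_sum //.
by congr (_ *: _); apply: eq_tlift => e f; rewrite !mul1r.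
Qed.

End Antipode.

Section ComoduleSums.
Variables (k : fieldType) (C : coalgType k) (M X : lmodType k).

Lemma lcomodA_sum (lam : {linear M -> (C ⊗ M)%type}) (F : C -> C -> M -> X) m :
  is_lcomod lam -> trilin F ->
  \tsum_(c, m' <- lam m) \tsum_(c1, c2 <- comul c) F c1 c2 m' =
  \tsum_(c, m' <- lam m) \tsum_(c', m'' <- lam m') F c c' m''.
Proof.
case=> lamA _ tF; have [h1 h2 h3] := tF.
transitivity (\tsum_(s, w <- tmap (@comul k C) idfun (lam m)) \tsum_(u, v <- s) F u v w).
  rewrite tsum_tsum; last by lin.
  by apply: eq_tlift => x y; rewrite tliftE //; lin.
rewrite -tassoc_sum // lamA tsum_tsum; last by lin.
by apply: eq_tlift => x y; rewrite tliftE //; lin.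
Qed.

Lemma lcomod_counit_sum (lam : {linear M -> (C ⊗ M)%type}) (f : M -> X) m :
  is_lcomod lam -> lin f -> \tsum_(c, m' <- lam m) (counit c *: f m') = f m.
Proof.
case=> _ lam1 hf; rewrite -[in RHS](lam1 m) lin_tsum //.
by apply: eq_tlift => c m'; rewrite linZ.
Qed.

Lemma rcomodA_sum (rho : {linear M -> (M ⊗ C)%type}) (F : M -> C -> C -> X) m :
  is_rcomod rho -> trilin F ->
  \tsum_(x, c <- rho m) \tsum_(x', c' <- rho x) F x' c' c =
  \tsum_(x, c <- rho m) \tsum_(c1, c2 <- comul c) F x c1 c2.
Proof.
case=> rhoA _ tF; have [h1 h2 h3] := tF.
transitivity (\tsum_(s, w <- tmap rho idfun (rho m)) \tsum_(u, v <- s) F u v w).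
  rewrite tsum_tsum; last by lin.
  by apply: eq_tlift => x y; rewrite tliftE //; lin.
rewrite -tassoc_sum // rhoA tsum_tsum; last by lin.
by apply: eq_tlift => x y; rewrite tliftE //; lin.
Qed.

Lemma rcomod_counit_sum (rho : {linear M -> (M ⊗ C)%type}) (f : M -> X) m :
  is_rcomod rho -> lin f -> \tsum_(m', c <- rho m) (counit c *: f m') = f m.
Proof.
case=> _ rho1 hf; rewrite -[in RHS](rho1 m) lin_tsum //.
by apply: eq_tlift => c m'; rewrite linZ.
Qed.

End ComoduleSums.

(* [pi] makes [C] a left [H]-module factor coalgebra of [H]. *)
Record is_quotient (k : fieldType) (H : hopfType k) (C : coalgType k)
    (pi : {linear H -> C}) (act : H -> C -> C) : Prop := IsQuotient {
  quot_surj : forall c, exists h, pi h = c;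
  quot_comul : forall h, comul (pi h) = \tsum_(x, y <- comul h) pi x ⊗ pi y;
  quot_counit : forall h, counit (pi h) = counit h;
  quot_act : forall h x, act h (pi x) = pi (h * x)
}.

Section HopfModules.
Variables (k : fieldType) (H : hopfType k) (C : coalgType k).
Variables (pi : {linear H -> C}) (act : H -> C -> C).
Hypothesis qC : is_quotient pi act.
Implicit Types (L M X : lmodType k).

Definition is_lmod L (ha : H -> L -> L) : Prop :=
  [/\ bil ha, forall m, ha 1 m = m & forall g h m, ha (g * h) m = ha g (ha h m)].

Definition diag_act L (ha : H -> L -> L) (h : H) (t : (C ⊗ L)%type) : (C ⊗ L)%type :=
  \tsum_(h1, h2 <- comul h) \tsum_(c, m <- t) act h1 c ⊗ ha h2 m.

(* An object of the category of relative Hopf modules [{}_H^C M]. *)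
Definition is_hopf_mod M (ha : H -> M -> M) (lam : {linear M -> (C ⊗ M)%type}) : Prop :=
  [/\ is_lmod ha, is_lcomod lam & forall h m, lam (ha h m) = diag_act ha h (lam m)].

Lemma act_bil : bil act.
Proof.
split=> [c a x y|h a c d].
  by have [z <-] := quot_surj qC c; rewrite !(quot_act qC) mulrDl -scalerAl linearP.
have [x <-] := quot_surj qC c; have [y <-] := quot_surj qC d.
by rewrite -linearP !(quot_act qC) mulrDr -scalerAr linearP.
Qed.

Lemma act1 c : act 1 c = c.
Proof. by have [x <-] := quot_surj qC c; rewrite (quot_act qC) mul1r. Qed.

Lemma actM g h c : act (g * h) c = act g (act h c).
Proof. by have [x <-] := quot_surj qC c; rewrite !(quot_act qC) mulrA. Qed.

Lemma comul_act_sum X (F : C -> C -> X) h c : bil F ->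
  tlift F (comul (act h c)) =
  \tsum_(h1, h2 <- comul h) \tsum_(c1, c2 <- comul c) F (act h1 c1) (act h2 c2).
Proof.
have [x <-] := quot_surj qC c; move=> hF; have hact := act_bil.
rewrite (quot_act qC) !(quot_comul qC) tsum_tsum //.
under [RHS]eq_tlift => h1 h2 do (rewrite tsum_tsum; last by lin).
under eq_tlift => u v do rewrite tliftE //.
rewrite (comulM_sum (F := fun u v => F (pi u) (pi v))); last by lin.
apply: eq_tlift => h1 h2; apply: eq_tlift => x1 x2.
by rewrite tliftE ?(quot_act qC) //; lin.
Qed.

Lemma comul_quot_sum X (F : C -> C -> X) h : bil F ->
  tlift F (comul (pi h)) = \tsum_(x, y <- comul h) F (pi x) (pi y).
Proof.
move=> hF; rewrite (quot_comul qC) tsum_tsum //.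
by apply: eq_tlift => x y; rewrite tliftE.
Qed.

Section DiagonalAction.
Variables (L : lmodType k) (ha : H -> L -> L).
Hypothesis haL : is_lmod ha.

Lemma diag_act_bil : bil (diag_act ha).
Proof. by have [hb _ _] := haL; have hact := act_bil; rewrite /diag_act; lin. Qed.

Lemma diag_act_tens h c m :
  diag_act ha h (c ⊗ m) = \tsum_(h1, h2 <- comul h) act h1 c ⊗ ha h2 m.
Proof.
have [hb _ _] := haL; have hact := act_bil.
by apply: eq_tlift => h1 h2; rewrite tliftE //; lin.
Qed.

Lemma diag_act_lmod : is_lmod (diag_act ha).
Proof.
have [hb h1 hM] := haL; have hact := act_bil; have hdact := diag_act_bil.
split=> [//|t|g h].
  rewrite /diag_act comul1_sum; last by lin.
  by rewrite -[RHS]tsum_id; apply: eq_tlift => c m; rewrite act1 h1.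
apply: tsum_ext; [by lin | by lin | move=> c m].
rewrite !diag_act_tens comulM_sum; last by lin.
rewrite lin_tsum; last by lin.
rewrite tsum_exchange; apply: eq_tlift => h1' h2'; rewrite diag_act_tens.
by apply: eq_tlift => g1 g2; rewrite actM hM.
Qed.

(** Since [S] reverses the comultiplication, [S(x_1) (pi x_2 ⊗ m)] is [pi (S(x_2) x_3) ⊗ S(x_1) m],
    where the first leg collapses to [pi 1]. *)
Lemma diag_act_antipode X (f : (C ⊗ L)%type -> X) x (m : L) : lin f ->
  \tsum_(x1, x2 <- comul x) f (diag_act ha (antipode x1) (pi x2 ⊗ m)) =
  f (pi 1 ⊗ ha (antipode x) m).
Proof.
have [hb _ _] := haL; have hact := act_bil => hf.
transitivity (\tsum_(x1, x2 <- comul x) \tsum_(y1, y2 <- comul x1)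
    f (pi (antipode y2 * x2) ⊗ ha (antipode y1) m)).
  apply: eq_tlift => x1 x2; rewrite diag_act_tens lin_tsum //.
  rewrite (comul_antipode_sum (F := fun a b => f (act a (pi x2) ⊗ ha b m))); last by lin.
  by apply: eq_tlift => y1 y2; rewrite (quot_act qC).
rewrite (comulA_sum (F := fun y1 y2 x2 => f (pi (antipode y2 * x2) ⊗ ha (antipode y1) m))); last first.
  by split=> *; lin.
rewrite -[RHS](counitr_sum (f := fun y => f (pi 1 ⊗ ha (antipode y) m))); last by lin.
apply: eq_tlift => y1 y.
by rewrite (antipodel_sum (f := fun u => f (pi u ⊗ ha (antipode y1) m))) //; lin.
Qed.

End DiagonalAction.

End HopfModules.

(** * Projectivity over A implies injectivity over H / H A^+ *)

Definition mksub (k : fieldType) (V : lmodType k) (K : {pred V})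
    (hK : GRing.submod_closed K) : submodClosed V :=
  HB.pack K (GRing.isSubmodClosed.Build k V K (GRing.submod_closed_semi hK)).

Section FreeObjects.
Variables (k : fieldType) (H : hopfType k).

Definition free_ract (Z : lmodType k) (t : (Z ⊗ H)%type) (a : H) : (Z ⊗ H)%type :=
  \tsum_(z, h <- t) z ⊗ (h * a).

Definition free_rho (Z : lmodType k) (t : (Z ⊗ H)%type) : ((Z ⊗ H) ⊗ H)%type :=
  \tsum_(z, h <- t) \tsum_(h1, h2 <- comul h) (z ⊗ h1) ⊗ h2.

Lemma free_ract_bil (Z : lmodType k) : bil (@free_ract Z).
Proof. by rewrite /free_ract; lin. Qed.

Lemma free_ract_tens (Z : lmodType k) (z : Z) h a : free_ract (z ⊗ h) a = z ⊗ (h * a).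
Proof. by rewrite /free_ract tliftE //; lin. Qed.

Lemma free_rho_lin (Z : lmodType k) : lin (@free_rho Z).
Proof. by rewrite /free_rho; lin. Qed.

Lemma free_rho_tens (Z : lmodType k) (z : Z) h :
  free_rho (z ⊗ h) = \tsum_(h1, h2 <- comul h) (z ⊗ h1) ⊗ h2.
Proof. by rewrite /free_rho tliftE //; lin. Qed.

Variable A : rcSubalg H.

(* Subobjects of [Z ⊗ H] in [M_A^H] are direct summands as [A]-modules: [e] is an
   [A]-linear projection with kernel [S]. *)
Definition free_subobjects_split : Prop :=
  forall (Z : lmodType k) (S : submodClosed (Z ⊗ H)%type),
    (forall t a, t \in S -> a \in rcs_pred A -> free_ract t a \in S) ->
    (forall t, t \in S -> free_rho t \in tsubl S) ->
  exists e : {linear (Z ⊗ H)%type -> (Z ⊗ H)%type},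
    [/\ forall t a, a \in rcs_pred A -> e (free_ract t a) = free_ract (e t) a,
        forall t, t \in S -> e t = 0 & forall t, t - e t \in S].

Lemma coideal_sum_eq (X : lmodType k) (F G : H -> H -> X) a : bil F -> bil G ->
  a \in rcs_pred A -> (forall x y, x \in rcs_pred A -> F x y = G x y) ->
  tlift F (comul a) = tlift G (comul a).
Proof. by move=> hF hG /rcs_coideal; exact: tsubl_eq. Qed.

Section SplitMorphisms.
Hypothesis splitA : free_subobjects_split.
Variables (Y Z : lmodType k) (d : {linear (Y ⊗ H)%type -> (Z ⊗ H)%type}).
Hypothesis d_ract : forall t a, a \in rcs_pred A -> d (free_ract t a) = free_ract (d t) a.
Hypothesis d_rho : forall t, free_rho (d t) = \tsum_(y, h <- free_rho t) d y ⊗ h.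

Let ker_closed : GRing.submod_closed [pred t | d t == 0].
Proof.
split=> [|a x y]; first by rewrite inE linear0.
by rewrite !inE => /eqP dx /eqP dy; rewrite linearP dx dy scaler0 addr0.
Qed.

Let im_closed : GRing.submod_closed [pred t | `[< exists y, d y = t >]].
Proof.
split=> [|a x y]; first by apply/asboolP; exists 0; rewrite linear0.
by move=> /asboolP[x' <-] /asboolP[y' <-]; apply/asboolP; exists (a *: x' + y'); rewrite linearP.
Qed.

(** Kernel and image of [d] are subobjects, and [eK], [eI] are the projections along them. The
    preimage [f t] of [t - eI t] is merely chosen; [eK] kills the ambiguity, which makes [eK (f t)]
    linear in [t] and compatible with [A]. *)
Lemma morphism_regular : exists g : {linear (Z ⊗ H)%type -> (Y ⊗ H)%type},
  (forall t a, a \in rcs_pred A -> g (free_ract t a) = free_ract (g t) a) /\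
  forall t, d (g (d t)) = d t.
Proof.
have hr := @free_ract_bil.
have [|t|eK [eK_ract eK0 eKS]] := splitA (S := mksub ker_closed).
- move=> t a; rewrite !inE => /eqP dt aA; rewrite d_ract // dt.
  by rewrite (lin0 ((hr Z).1 a)).
- rewrite inE => /eqP dt; apply: slice_tsubl => phi; rewrite inE; apply/eqP.
  transitivity (slice phi (free_rho (d t))).
    rewrite d_rho; move: (free_rho t) => s; rewrite (lin_tsum (f := slice phi)); last by lin.
    rewrite [in LHS]/slice (lin_tsum (f := d)); last by lin.
    by apply: eq_tlift => u v; rewrite slice_tens linearZ.
  by rewrite dt (lin0 (@free_rho_lin Z)) linear0.
have [|t|eI [eI_ract eI0 eIS]] := splitA (S := mksub im_closed).
- move=> t a /asboolP[y <-] aA; apply/asboolP; exists (free_ract y a).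
  by rewrite d_ract.
- case/asboolP=> y <-; rewrite d_rho /tlift; apply: rpred_sum => p _.
  by apply: tsubl_tens; apply/asboolP; exists p.1.
have /choice[f fP] t : exists y, d y = t - eI t by exact/asboolP/eIS.
have dK y y' : d y = d y' -> eK y = eK y'.
  move=> dy; apply/eqP; rewrite -subr_eq0 -linearB eK0 //.
  by rewrite inE linearB /= dy subrr.
have g_lin : lin (fun t => eK (f t)).
  move=> a x y; rewrite -linearP; apply: dK; rewrite linearP /= !fP.
  by rewrite linearP /= scalerBr opprD addrACA.
have deK y : d (eK y) = d y.
  by apply/eqP; rewrite eq_sym -subr_eq0 -linearB; exact: eKS.
exists (mklin g_lin); split=> [t a aA|t] /=.
  rewrite -eK_ract //; apply: dK; rewrite d_ract // !fP eI_ract //.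
  by rewrite (linB ((hr Z).1 a)).
rewrite deK fP eI0 ?subr0 //; apply/asboolP; by exists t.
Qed.

End SplitMorphisms.

End FreeObjects.

Section SubalgebraToFactor.
Variables (k : fieldType) (H : hopfType k) (A : rcSubalg H) (C : coalgType k).
Variables (pi : {linear H -> C}) (act : H -> C -> C).
Hypothesis qC : is_quotient pi act.
Hypothesis ker_pi : forall x, pi x = 0 <-> x \in HAplus A.
Implicit Types (L M X U Y Z : lmodType k).

Lemma quot_mulA h a : a \in rcs_pred A -> pi (h * a) = counit a *: pi h.
Proof.
move=> aA; apply/eqP; rewrite -subr_eq0 -linearZ -linearB; apply/eqP/ker_pi.
apply: lspan_gen; exists h, (a - counit a *: 1); split.
- by apply: rpredB => //; apply: rpredZ; exact: rpred1.
- by rewrite linearB linearZ /= counit1 mulr1 subrr.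
- by rewrite mulrBr -scalerAr mulr1.
Qed.

Lemma quot_factor X (f : H -> X) : lin f ->
  (forall h a, a \in rcs_pred A -> f (h * a) = counit a *: f h) ->
  forall x y, pi x = pi y -> f x = f y.
Proof.
move=> hf fA x y /eqP; rewrite -subr_eq0 -linearB => /eqP/ker_pi xy.
apply/eqP; rewrite -subr_eq0 -(linB hf); apply/eqP.
apply: (lspan_ker (f := mklin hf)) xy => _ [h [a [aA ea ->]]] /=.
by rewrite fA // ea scale0r.
Qed.

Let act_bilC : bil act := act_bil qC.
Variable s : {linear C -> H}.
Hypothesis sK : forall c, pi (s c) = c.

(* The well-defined map [pi x |-> \sum F x_1 (S x_2)] on [H / H A^+]. *)
Lemma twist_factor X (F : H -> H -> X) x : bil F ->
  (forall u v a, a \in rcs_pred A -> F (u * a) v = F u (a * v)) ->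
  \tsum_(x1, x2 <- comul (s (pi x))) F x1 (antipode x2) =
  \tsum_(x1, x2 <- comul x) F x1 (antipode x2).
Proof.
move=> hF FA; apply: (quot_factor (f := fun x => \tsum_(x1, x2 <- comul x) F x1 (antipode x2))).
- by lin.
- move=> h a aA; rewrite comulM_sum; last by lin.
  rewrite -tsumZ; apply: eq_tlift => h1 h2.
  (* As [a_1] lies in [A], it can be moved to the second argument of [F], where it meets
     [S(a_2)]. *)
  rewrite (coideal_sum_eq (A := A) (G := fun a1 a2 => F h1 (a1 * antipode a2 * antipode h2))) //.
  + by rewrite (antipoder_sum (f := fun u => F h1 (u * antipode h2))) ?mul1r //; lin.
  + by lin.
  + by lin.
  + by move=> u v uA; rewrite FA // antipodeM mulrA.
- exact: sK.
Qed.

Section Split.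
Hypothesis splitA : free_subobjects_split A.

(** [A] is itself a subobject of the free object on [Z = k]. The complement of the projection [e]
    along it, read through [I : k ⊗ H -> H], is the retraction. *)
Lemma subalg_retraction : exists p : {linear H -> H},
  [/\ forall h, p h \in rcs_pred A, forall a, a \in rcs_pred A -> p a = a &
      forall h a, a \in rcs_pred A -> p (h * a) = p h * a].
Proof.
pose I (t : (k^o ⊗ H)%type) : H := tlift (fun (z : k^o) (h : H) => (z : k) *: h) t.
have hI : lin I by rewrite /I; lin.
have IE (z : k^o) h : I (z ⊗ h) = (z : k) *: h by rewrite /I tliftE //; lin.
have IK t : t = 1 ⊗ I t.
  apply: (tsum_ext (F := id) (G := fun t => 1 ⊗ I t)); [by [] | by lin | move=> z h].
  by rewrite IE tensZr -tensZl; congr (_ ⊗ _); exact/esym/mulr1.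
have Sclosed : GRing.submod_closed [pred t | I t \in rcs_pred A].
  split=> [|a x y]; first by rewrite inE (lin0 hI) rpred0.
  by rewrite !inE hI => ? ?; apply: rpredD => //; exact: rpredZ.
have [t a||e [eA e0 eS]] := splitA (S := mksub Sclosed).
- rewrite !inE {2}[t]IK free_ract_tens IE scale1r => tA aA.
  exact: rpredM.
- move=> t tS; rewrite [t]IK free_rho_tens.
  apply: (tsubl_sub (F := fun h1 h2 => (1 ⊗ h1) ⊗ h2) (S := rcs_pred A)).
  + by lin.
  + exact: rcs_coideal.
  + by move=> u v uA; apply: tsubl_tens; rewrite inE /= IE scale1r.
pose p h := I (1 ⊗ h - e (1 ⊗ h)).
have hp : lin p by rewrite /p; lin.
exists (mklin hp); split=> [h|a aA|h a aA] /=; rewrite /p.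
- exact: eS.
- by rewrite e0 ?subr0 ?IE ?scale1r // inE /= IE scale1r.
- rewrite -free_ract_tens eA // -(linB ((free_ract_bil _ _).1 a)).
  by move: (_ - _) => t; rewrite {1}[t]IK free_ract_tens IE scale1r.
Qed.

Lemma coinv_sub_subalg h :
  \tsum_(x, y <- comul h) pi x ⊗ y = pi 1 ⊗ h -> h \in rcs_pred A.
Proof.
move=> hC; have [p [pA pid pM]] := subalg_retraction.
pose F y x1 x2 := p x1 * x2 * y.
have hF y : bil (F y) by rewrite /F; lin.
have FA y u v a : a \in rcs_pred A -> F y (u * a) v = F y u (a * v).
  by move=> aA; rewrite /F pM // !mulrA.
(* [Q (pi x) y] is [\sum p(x_1) S(x_2) y], well defined by [twist_factor]. It sends the two sides of
   the coinvariance equation to [p h] and to [h]. *)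
pose Q (c : C) (y : H) := \tsum_(x1, x2 <- comul (s c)) F y x1 (antipode x2).
have hQ : bil Q by rewrite /Q /F; lin.
have := congr1 (tlift Q) hC; rewrite tliftE // tsum_tsum //.
rewrite {2}/Q (twist_factor _ (hF h) (FA h)) comul1_sum; last by rewrite /F; lin.
under eq_tlift => x y do rewrite tliftE // /Q (twist_factor _ (hF y) (FA y)).
rewrite {2}/F pid ?rpred1 // antipode1 !mul1r /F.
rewrite (comulA_sum (F := fun x1 x2 y => p x1 * antipode x2 * y)); last by split=> *; lin.
have E x y : \tsum_(y1, y2 <- comul y) (p x * antipode y1 * y2) = counit y *: p x.
  under eq_tlift => y1 y2 do rewrite -mulrA.
  by rewrite (antipodel_sum (f := fun u => p x * u)) ?mulr1 //; lin.
under eq_tlift => x y do rewrite E.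
by rewrite counitr_sum => [<-|]; [exact: pA | lin].
Qed.

(** * Linear systems in relative Hopf modules *)

Section LinearSystem.
Variables (U Z M : lmodType k) (alpha : {linear (U ⊗ C)%type -> Z}) (beta : {linear U -> Z}).
Variables (ha : H -> M -> M) (lam : {linear M -> (C ⊗ M)%type}).
Hypothesis hM : is_hopf_mod act ha lam.

(** The system [\sum alpha (u ⊗ m_{-1}) ⊗ m_0 - beta u ⊗ m] for the comodule [H] in place of [M]. It
    commutes with right multiplication by [A] because [h_1] enters only through [pi], and with the
    right coaction because only the left leg of [h] is touched. *)
Let d_fun (t : (U ⊗ H)%type) : (Z ⊗ H)%type :=
  \tsum_(u, h <- t) (\tsum_(h1, h2 <- comul h) alpha (u ⊗ pi h1) ⊗ h2 - beta u ⊗ h).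

Let d_lin : lin d_fun. Proof. by rewrite /d_fun; lin. Qed.

Let d := mklin d_lin.

Let dE u h : d (u ⊗ h) = \tsum_(h1, h2 <- comul h) alpha (u ⊗ pi h1) ⊗ h2 - beta u ⊗ h.
Proof. by rewrite /= /d_fun tliftE //; lin. Qed.

Let d_ract t a : a \in rcs_pred A -> d (free_ract t a) = free_ract (d t) a.
Proof.
move=> aA; have hr := @free_ract_bil k H.
apply: (tsum_ext (F := fun t => d (free_ract t a)) (G := fun t => free_ract (d t) a)).
- by apply: lin_app; exact: (hr U).1.
- by apply: lin_comp (linE d); exact: (hr Z).1.
move=> u h; rewrite free_ract_tens !dE (linB ((hr Z).1 a)) free_ract_tens; congr (_ - _).
rewrite comulM_sum; last by lin.
rewrite (lin_tsum (f := fun t => free_ract t a)); last exact: (hr Z).1.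
apply: eq_tlift => h1 h2.
rewrite (coideal_sum_eq (A := A)
  (G := fun a1 a2 => counit a1 *: (alpha (u ⊗ pi h1) ⊗ (h2 * a2)))) //.
- by rewrite counitl_sum ?free_ract_tens //; lin.
- by lin.
- by lin.
- by move=> x y xA; rewrite quot_mulA // tensZr linearZ tensZl.
Qed.

Let d_rho t : free_rho (d t) = \tsum_(y, h <- free_rho t) d y ⊗ h.
Proof.
have hr := @free_rho_lin k H.
apply: (tsum_ext (F := fun t => free_rho (d t)) (G := fun t => \tsum_(y, h <- free_rho t) d y ⊗ h)).
- by apply: lin_comp (linE d); exact: hr.
- by apply: lin_tliftr; [lin | exact: hr].
move=> u h; rewrite free_rho_tens tsum_tsum; last by lin.
under [RHS]eq_tlift => h1 h2 do (rewrite tliftE; last by lin).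
rewrite dE (linB (hr Z)) free_rho_tens.
under [RHS]eq_tlift => h1 h2 do rewrite dE tensBl.
rewrite tsumB; congr (_ - _); rewrite (lin_tsum (f := @free_rho k H Z)); last exact: hr.
under eq_tlift => h1 h2 do rewrite free_rho_tens.
rewrite -(comulA_sum (F := fun x y z => alpha (u ⊗ pi x) ⊗ y ⊗ z)); last by split=> *; lin.
by apply: eq_tlift => h1 h2; rewrite (lin_tsum (f := fun t => t ⊗ h2)); last by lin.
Qed.

(* [gam Phi (z ⊗ (pi x ⊗ m)) = \sum Phi (z ⊗ x_1) (S x_2 m)], i.e. the map induced by
   [Phi] on [(Z ⊗ H) ⊗_A L], which is identified with [Z ⊗ (C ⊗ L)]. *)
Let gam L X (hL : H -> L -> L) (Phi : (Z ⊗ H)%type -> L -> X) (t : (Z ⊗ (C ⊗ L))%type) : X :=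
  \tsum_(z, r <- t) \tsum_(c, m <- r)
    \tsum_(x1, x2 <- comul (s c)) Phi (z ⊗ x1) (hL (antipode x2) m).

(** The condition for [Phi] to factor through the tensor product over [A]. *)
Let balanced L X (hL : H -> L -> L) (Phi : (Z ⊗ H)%type -> L -> X) :=
  forall t a m, a \in rcs_pred A -> Phi (free_ract t a) m = Phi t (hL a m).

Let gam_lin L X hL (Phi : (Z ⊗ H)%type -> L -> X) : is_lmod hL -> bil Phi -> lin (gam hL Phi).
Proof. by case=> hb _ _ hP; rewrite /gam; lin. Qed.

Let gam_tens L X hL (Phi : (Z ⊗ H)%type -> L -> X) z c m : is_lmod hL -> bil Phi ->
  gam hL Phi (z ⊗ (c ⊗ m)) = \tsum_(x1, x2 <- comul (s c)) Phi (z ⊗ x1) (hL (antipode x2) m).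
Proof.
case=> hb _ _ hP; rewrite /gam tliftE; last by lin.
by rewrite tliftE //; lin.
Qed.

Let gam_pi L X hL (Phi : (Z ⊗ H)%type -> L -> X) z x m : is_lmod hL -> bil Phi -> balanced hL Phi ->
  gam hL Phi (z ⊗ (pi x ⊗ m)) = \tsum_(x1, x2 <- comul x) Phi (z ⊗ x1) (hL (antipode x2) m).
Proof.
move=> hLm hP PA; have [hb h1 hMul] := hLm; rewrite gam_tens //.
rewrite (twist_factor (F := fun x y => Phi (z ⊗ x) (hL y m))) //; first by lin.
by move=> u v a aA; rewrite -free_ract_tens PA // hMul.
Qed.

Let mact Y L (hL : H -> L -> L) (q : (Y ⊗ H)%type) (m : L) : (Y ⊗ L)%type :=
  \tsum_(u, h <- q) u ⊗ hL h m.

Let lamT (w : (Z ⊗ M)%type) : (Z ⊗ (C ⊗ M))%type := \tsum_(z, m <- w) z ⊗ lam m.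

(** The same system for the cofree comodule [C ⊗ M]; under [H ⊗_A M = C ⊗ M] it is [d ⊗_A M]. *)
Let Dt (y : (U ⊗ (C ⊗ M))%type) : (Z ⊗ (C ⊗ M))%type :=
  \tsum_(u, r <- y) \tsum_(c, m <- r)
    (\tsum_(c1, c2 <- comul c) alpha (u ⊗ c1) ⊗ (c2 ⊗ m) - beta u ⊗ (c ⊗ m)).

(** The solution is obtained by applying [g ⊗_A M] to [lamT w] and then letting [H] act on [M]. The
    system takes there the value of [(d g) ⊗_A M] at [lamT w], again followed by the action. Since
    [lamT w = Dt y0] is in the image of [d ⊗_A M], on which [d g] acts as the identity, the counit
    returns [w]. *)
Lemma solve_hopf_system w y0 : Dt y0 = lamT w ->
  exists y : (U ⊗ M)%type,
    \tsum_(u, m <- y) (\tsum_(c, m' <- lam m) alpha (u ⊗ c) ⊗ m' - beta u ⊗ m) = w.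
Proof.
move=> y0E; have [hLm hlam lam_ha] := hM; have [hb h1 hMul] := hLm.
have hr := @free_ract_bil k H.
have mact_bil Y L (hL : H -> L -> L) : is_lmod hL -> bil (mact hL : (Y ⊗ H)%type -> _).
  by case=> *; rewrite /mact; lin.
have mact_tens Y L (hL : H -> L -> L) (u : Y) h m : is_lmod hL ->
    mact hL (u ⊗ h) m = u ⊗ hL h m.
  by case=> *; rewrite /mact tliftE //; lin.
have mact_ract Y L (hL : H -> L -> L) (q : (Y ⊗ H)%type) a m : is_lmod hL ->
    mact hL (free_ract q a) m = mact hL q (hL a m).
  move=> hLL; have [hLb _ hLM] := hLL; have hmb := mact_bil Y L hL hLL; have hrY := hr Y.
  apply: (tsum_ext (F := fun q => mact hL (free_ract q a) m)
    (G := fun q => mact hL q (hL a m))) q => [||u h].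
  - by lin.
  - by lin.
  - by rewrite free_ract_tens !mact_tens // hLM.
have [g [g_ract dgd]] := morphism_regular splitA d_ract d_rho.
have gPhi L (hL : H -> L -> L) X (B : (U ⊗ H)%type -> L -> X) : is_lmod hL -> bil B ->
    (forall q a m, B (free_ract q a) m = B q (hL a m)) ->
    bil (fun t m => B (g t) m) /\ balanced hL (fun t m => B (g t) m).
  move=> hLL hB BA; split; first by lin.
  by move=> t a m aA; rewrite g_ract // BA.
have hmU := mact_bil U M ha hLm; have hmZ := mact_bil Z M ha hLm.
have [hP0 bP0] := gPhi _ _ _ _ hLm hmU (fun q a m => mact_ract _ _ _ q a m hLm).
pose Phid t m := mact ha (d (g t)) m.
have hPd : bil Phid by rewrite /Phid; lin.
have bPd : balanced ha Phid.
  by move=> t a m aA; rewrite /Phid g_ract // d_ract // mact_ract.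
exists (gam ha (fun t m => mact ha (g t) m) (lamT w)).
pose AL (y : (U ⊗ M)%type) : (Z ⊗ M)%type :=
  \tsum_(u, m <- y) \tsum_(c, m' <- lam m) alpha (u ⊗ c) ⊗ m'.
pose BE (y : (U ⊗ M)%type) : (Z ⊗ M)%type := \tsum_(u, m <- y) beta u ⊗ m.
have hAL : lin AL by rewrite /AL; lin.
have hBE : lin BE by rewrite /BE; lin.
rewrite tsumB -[X in X - _]/(AL _) -[X in _ - X]/(BE _).
pose am (u : U) (r : (C ⊗ M)%type) : (Z ⊗ M)%type := \tsum_(c, m <- r) alpha (u ⊗ c) ⊗ m.
have ham : bil am by rewrite /am; lin.
have amE u c m : am u (c ⊗ m) = alpha (u ⊗ c) ⊗ m by rewrite /am tliftE //; lin.
have hdl := diag_act_lmod qC hLm; have [hdb hd1 hdM] := hdl.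
(* [B1] is the [alpha] part of [d] followed by the action on [M]; [B2] is its analogue for the
   diagonal module [C ⊗ M], and the two agree on [pi 1 ⊗ m]. *)
pose B1 (q : (U ⊗ H)%type) (m : M) : (Z ⊗ M)%type :=
  \tsum_(u, h <- q) \tsum_(h1, h2 <- comul h) alpha (u ⊗ pi h1) ⊗ ha h2 m.
have hB1 : bil B1 by rewrite /B1; lin.
pose B2 (q : (U ⊗ H)%type) (r : (C ⊗ M)%type) : (Z ⊗ M)%type :=
  \tsum_(u, h <- q) am u (diag_act act ha h r).
have hB2 : bil B2 by rewrite /B2; lin.
have B2_ract q a r : B2 (free_ract q a) r = B2 q (diag_act act ha a r).
  apply: (tsum_ext (F := fun q => B2 (free_ract q a) r)
    (G := fun q => B2 q (diag_act act ha a r))) q => [||u h].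
  - by have hrU := hr U; lin.
  - by lin.
  - rewrite free_ract_tens /B2 !tliftE ?hdM //; lin.
have [hP2 bP2] := gPhi _ _ _ _ hdl hB2 B2_ract.
have B21 q m : B2 q (pi 1 ⊗ m) = B1 q m.
  apply: eq_tlift => u h; rewrite (diag_act_tens qC) // (lin_tsum (f := am u)); last by lin.
  by apply: eq_tlift => h1' h2'; rewrite amE (quot_act qC) mulr1.
have hP1 : bil (fun t m => B1 (g t) m) by lin.
have lamT_lin : lin lamT by rewrite /lamT; lin.
have lamT_tens z m : lamT (z ⊗ m) = z ⊗ lam m by rewrite /lamT tliftE //; lin.
have gamE L X hL (Phi : (Z ⊗ H)%type -> L -> X) z r : is_lmod hL -> bil Phi ->
    gam hL Phi (z ⊗ r) = \tsum_(c, m <- r) gam hL Phi (z ⊗ (c ⊗ m)).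
  move=> hLL hPhi; have hg := gam_lin hLL hPhi.
  have hgz : lin (fun r => gam hL Phi (z ⊗ r)) by lin.
  by rewrite -[in LHS](tsum_id r) (lin_tsum _ _ hgz).
(* [H]-linearity of [lam] turns [AL] into [B2] evaluated at a coaction. Coassociativity then
   replaces the iterated coaction by a comultiplication of [C], and [diag_act_antipode] reduces the
   second copy of [C] to [pi 1]. *)
have ALE : AL (gam ha (fun t m => mact ha (g t) m) (lamT w)) = gam ha (fun t m => B1 (g t) m) (lamT w).
  have hg0 := gam_lin hLm hP0; have hg1 := gam_lin hLm hP1; have hg2 := gam_lin hdl hP2.
  apply: (tsum_ext (F := fun w => AL (gam ha (fun t m => mact ha (g t) m) (lamT w)))
    (G := fun w => gam ha (fun t m => B1 (g t) m) (lamT w))) => [||z m]; [by lin | by lin |].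
  rewrite lamT_tens.
  have ALm q m' : AL (mact ha q m') = B2 q (lam m').
    rewrite /mact (lin_tsum _ _ hAL); apply: eq_tlift => u h.
    rewrite /AL tliftE; last by lin.
    by rewrite lam_ha.
  transitivity (\tsum_(c, m' <- lam m) gam (diag_act act ha) (fun t r => B2 (g t) r) (z ⊗ (c ⊗ lam m'))).
    rewrite gamE // (lin_tsum _ _ hAL); apply: eq_tlift => c m'.
    rewrite gam_tens // gam_tens // (lin_tsum _ _ hAL); apply: eq_tlift => x1 x2.
    by rewrite ALm lam_ha.
  transitivity (\tsum_(c, m' <- lam m) \tsum_(c', m'' <- lam m')
      gam (diag_act act ha) (fun t r => B2 (g t) r) (z ⊗ (c ⊗ (c' ⊗ m'')))).
    apply: eq_tlift => c m'; rewrite -[in LHS](tsum_id (lam m')).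
    by rewrite (lin_tsum (f := fun r => gam (diag_act act ha) (fun t r => B2 (g t) r) (z ⊗ (c ⊗ r))));
      last by lin.
  rewrite -(lcomodA_sum (F := fun c1 c2 m' =>
    gam (diag_act act ha) (fun t r => B2 (g t) r) (z ⊗ (c1 ⊗ (c2 ⊗ m'))))) //; last by split=> *; lin.
  rewrite gamE //; apply: eq_tlift => c m'.
  rewrite gam_tens // -{1}[c]sK (comul_quot_sum qC); last by lin.
  under eq_tlift => x y do rewrite gam_pi //.
  rewrite (comulA_sum (F := fun x1 x2 y =>
    B2 (g (z ⊗ x1)) (diag_act act ha (antipode x2) (pi y ⊗ m')))); last by split=> *; lin.
  apply: eq_tlift => x1 x2.
  by rewrite (diag_act_antipode qC hLm (f := fun r => B2 (g (z ⊗ x1)) r)) ?B21 //; lin.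
have BEE : BE (gam ha (fun t m => mact ha (g t) m) (lamT w)) =
    gam ha (fun t m => BE (mact ha (g t) m)) (lamT w).
  rewrite /gam (lin_tsum _ _ hBE); apply: eq_tlift => z r.
  rewrite (lin_tsum _ _ hBE); apply: eq_tlift => c m.
  by rewrite (lin_tsum _ _ hBE).
(* The parts [B1] and [BE] recombine to [d]. *)
have subE : gam ha (fun t m => B1 (g t) m) (lamT w) - gam ha (fun t m => BE (mact ha (g t) m)) (lamT w) =
    gam ha Phid (lamT w).
  rewrite /gam -tsumB; apply: eq_tlift => z r; rewrite -tsumB; apply: eq_tlift => c m.
  rewrite -tsumB; apply: eq_tlift => x1 x2; rewrite /Phid.
  move: (g _) (ha _ _) => q {c z r x1 x2 m} m.
  apply: (tsum_ext (F := fun q => B1 q m - BE (mact ha q m)) (G := fun q => mact ha (d q) m)) q.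
  - by lin.
  - by lin.
  move=> u h; rewrite dE mact_tens // (linB (hmZ.1 m)) mact_tens //; congr (_ - _).
    rewrite /B1 tliftE; last by lin.
    rewrite (lin_tsum _ _ (hmZ.1 m)); apply: eq_tlift => h1' h2'.
    by rewrite mact_tens.
  by rewrite /BE tliftE //; lin.
rewrite ALE BEE subE -y0E.
(* The counit on the middle factor, a left inverse of [lamT]. *)
pose Ev (t : (Z ⊗ (C ⊗ M))%type) : (Z ⊗ M)%type :=
  \tsum_(z, r <- t) \tsum_(c, m <- r) counit c *: (z ⊗ m).
have hEv : lin Ev by rewrite /Ev; lin.
have EvE z c m : Ev (z ⊗ (c ⊗ m)) = counit c *: (z ⊗ m).
  by rewrite /Ev !tliftE //; lin.
have -> : w = Ev (lamT w).
  apply: (tsum_ext (F := id) (G := fun w => Ev (lamT w))) => [||z m]; [by []|by lin|].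
  rewrite lamT_tens /Ev tliftE; last by lin.
  by rewrite lcomod_counit_sum //; lin.
rewrite -y0E; have hgd := gam_lin hLm hPd.
have hDt : lin Dt by rewrite /Dt; lin.
have DtE u c m : Dt (u ⊗ (c ⊗ m)) =
    \tsum_(c1, c2 <- comul c) alpha (u ⊗ c1) ⊗ (c2 ⊗ m) - beta u ⊗ (c ⊗ m).
  by rewrite /Dt !tliftE //; lin.
apply: (tsum_ext (F := fun y => gam ha Phid (Dt y)) (G := fun y => Ev (Dt y))); [by lin|by lin|].
move=> u r; apply: (tsum_ext (F := fun r => gam ha Phid (Dt (u ⊗ r)))
  (G := fun r => Ev (Dt (u ⊗ r)))); [by lin|by lin|] => {r} c m.
rewrite DtE -(sK c); move: (s c) => x.
rewrite (linB hgd) (linB hEv) (lin_tsum _ _ hgd) (lin_tsum _ _ hEv).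
under [in RHS]eq_tlift => c1 c2 do rewrite EvE.
rewrite EvE (counitr_sum (f := fun c => alpha (u ⊗ c) ⊗ m)); last by lin.
rewrite (comul_quot_sum qC); last by lin.
under eq_tlift => x1 x2 do rewrite gam_pi //.
rewrite gam_pi // -(comulA_sum (F := fun x1 x2 x3 =>
  Phid (alpha (u ⊗ pi x1) ⊗ x2) (ha (antipode x3) m))); last by split=> *; lin.
rewrite -tsumB.
(* This is where [d g d = d] enters, at [u ⊗ x_1]. What follows uses only the antipode and the
   counit. *)
transitivity (\tsum_(x1, x2 <- comul x) mact ha (d (u ⊗ x1)) (ha (antipode x2) m)).
  apply: eq_tlift => x1 x2; have := dgd (u ⊗ x1); rewrite {1}dE => <-.
  rewrite -/(Phid _ _) (linB (hPd.1 _)); congr (_ - _).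
  by rewrite (lin_tsum _ _ (hPd.1 _)).
transitivity (\tsum_(x1, x3 <- comul x) (\tsum_(y1, y2 <- comul x1)
    alpha (u ⊗ pi y1) ⊗ ha (y2 * antipode x3) m - beta u ⊗ ha (x1 * antipode x3) m)).
  apply: eq_tlift => x1 x3; rewrite dE (linB (hmZ.1 _)) mact_tens // hMul; congr (_ - _).
  rewrite (lin_tsum _ _ (hmZ.1 _)); apply: eq_tlift => y1 y2.
  by rewrite mact_tens // hMul.
rewrite tsumB (antipoder_sum (f := fun v => beta u ⊗ ha v m)); last by lin.
rewrite h1 (quot_counit qC); congr (_ - _).
rewrite (comulA_sum (F := fun y1 y2 x3 => alpha (u ⊗ pi y1) ⊗ ha (y2 * antipode x3) m)); last first.
  by split=> *; lin.
rewrite -[RHS](counitr_sum (f := fun x => alpha (u ⊗ pi x) ⊗ m)); last by lin.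
apply: eq_tlift => x1 x2.
by rewrite (antipoder_sum (f := fun v => alpha (u ⊗ pi x1) ⊗ ha v m)) ?h1 //; lin.
Qed.
End LinearSystem.
End Split.
End SubalgebraToFactor.

(** * Extension of colinear maps *)

Section Injectivity.
Variables (k : fieldType) (H : hopfType k) (A : rcSubalg H) (C : coalgType k).
Variables (pi : {linear H -> C}) (act : H -> C -> C).
Hypothesis qC : is_quotient pi act.
Hypothesis ker_pi : forall x, pi x = 0 <-> x \in HAplus A.
Hypothesis splitA : free_subobjects_split A.
Variables (M : lmodType k) (ha : H -> M -> M) (lam : {linear M -> (C ⊗ M)%type}).
Hypothesis hM : is_hopf_mod act ha lam.
Variables (P : lmodType k) (lamP : {linear P -> (C ⊗ P)%type}).
Hypothesis hP : is_lcomod lamP.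

(* [x = (p, m)] has its two coactions represented by one and the same element of [C ⊗ G]. *)
Let colin (G : set (P * M)) (x : P * M) : Prop :=
  exists n (c : 'I_n -> C) (y : 'I_n -> P * M),
    [/\ forall j, G (y j), lamP x.1 = \sum_(j < n) c j ⊗ (y j).1 &
        lam x.2 = \sum_(j < n) c j ⊗ (y j).2].

Let colin_mono (G G' : set (P * M)) x : G `<=` G' -> colin G x -> colin G' x.
Proof. by move=> GG' [n [c [y [Gy Py My]]]]; exists n, c, y; split=> // j; exact: GG'. Qed.

Let colin_lin G a x y : colin G x -> colin G y -> colin G (a *: x + y).
Proof.
move=> [n [c [z [Gz Pz Mz]]]] [m [d [w [Gw Pw Mw]]]].
exists (n + m)%N, (fun i => match split i with inl j => a *: c j | inr j => d j end).
exists (fun i => match split i with inl j => z j | inr j => w j end).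
have sl j : split (lshift m j : 'I_(n + m)) = inl j by exact: (unsplitK (inl j)).
have sr j : split (rshift n j : 'I_(n + m)) = inr j by exact: (unsplitK (inr j)).
split=> [i||]; first by case: (split i).
- rewrite big_split_ord /= linearP Pz Pw scaler_sumr; congr (_ + _); apply: eq_bigr => j _.
    by rewrite sl tensZl.
  by rewrite sr.
- rewrite big_split_ord /= linearP Mz Mw scaler_sumr; congr (_ + _); apply: eq_bigr => j _.
    by rewrite sl tensZl.
  by rewrite sr.
Qed.

(** The [v j] are slices of the coaction of [p], so coassociativity puts their coactions into the
    span of the [C ⊗ v j]. They may be linearly dependent; the relations among them are dealt with
    where the lemma is used. *)
Lemma finite_subcomodule (p : P) : exists n (v : 'I_n -> P) (e : 'I_n -> k) (kap : 'I_n -> 'I_n -> C),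
  p = \sum_(j < n) e j *: v j /\ forall i, lamP (v i) = \sum_(j < n) kap i j ⊗ v j.
Proof.
pose t := \tsum_(c, p' <- lamP p) p' ⊗ c; have [n [phi [c tE]]] := slice_repr t.
pose v i := \tsum_(c, p' <- lamP p) (phi i c *: p').
have hv i : v i = slice (phi i) t.
  rewrite (lin_tsum (f := slice (phi i))); last by lin.
  by apply: eq_tlift => u w; rewrite slice_tens.
have lamPE : lamP p = \sum_(j < n) c j ⊗ v j.
  transitivity (\tsum_(u, w <- t) w ⊗ u).
    rewrite /t tsum_tsum; last by lin.
    by rewrite -[LHS]tsum_id; apply: eq_tlift => u w; rewrite tliftE //; lin.
  rewrite tE (lin_big (f := tlift (fun u w => w ⊗ u))); last by lin.
  by apply: eq_bigr => j _; rewrite tliftE ?hv //; lin.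
exists n, v, (fun j => counit (c j)).
exists (fun i j => \tsum_(c1, c2 <- comul (c j)) (phi i c1 *: c2)); split=> [|i].
  have := hP.2 p; rewrite lamPE (lin_big (f := tlift (fun c x => counit c *: x))); last by lin.
  by move=> <-; apply: eq_bigr => j _; rewrite tliftE //; lin.
rewrite {1}/v (lin_tsum (f := lamP)); last by lin.
transitivity (\tsum_(c', p' <- lamP p) \tsum_(c1, c2 <- comul c') (phi i c1 *: c2) ⊗ p').
  rewrite (lcomodA_sum (F := fun c1 c2 p' => (phi i c1 *: c2) ⊗ p')) //; last by split=> *; lin.
  apply: eq_tlift => c' p'; rewrite linearZ /= -[lamP p' in LHS]tsum_id -tsumZ.
  by apply: eq_tlift => c2 p2; rewrite tensZl.
rewrite lamPE (lin_big (f := tlift _)); last by lin.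
apply: eq_bigr => j _; rewrite tliftE; last by lin.
by rewrite (lin_tsum (f := fun x => x ⊗ v j)); last by lin.
Qed.

(** The unknowns are values [yc i] for the generators [v i], subject to
    [lam (yc i) = \sum_j kap i j ⊗ yc j] and to agreement with [G] wherever a combination of the
    [v i] is already in its domain. They are the coordinates of a single tensor in [U ⊗ M]; the
    first component of [Z] carries the coaction equations and the second the prescribed values. *)
Lemma colinear_graph_step (G : set (P * M)) p : good_graph colin G ->
  exists G', [/\ good_graph colin G', G `<=` G' & exists m, G' (p, m)].
Proof.
move=> [lG cG]; have [G0 Glin Gfun] := lG.
have [n [v [e [kap [pE vE]]]]] := finite_subcomodule p.
(* A linear extension of the graph to [P], in general not colinear. The map [gl] below is the
   colinear map into the cofree comodule [C ⊗ M] that it induces, and it supplies the solution [y0]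
   there. *)
have [g0 [g0G _]] := linear_selection (T := setT) I (fun _ _ _ _ _ => I)
  (fun v => ex_intro _ (0 : M) I) lG (fun _ _ => I).
pose U := 'rV[k]_n; pose E i : U := delta_mx 0 i.
(* Each [r] with [\sum_i r_i v_i] in the domain of [G] prescribes a combination of the unknowns.
   [Kp] is the common kernel of these functionals, so every one of them factors through [q]; linear
   relations among the [v i] are included, with prescribed value [0]. *)
pose Kp : {pred U} := [pred u : U | `[< forall r : U, (exists w, G (\sum_i r 0 i *: v i, w)) ->
  \sum_i r 0 i * u 0 i = 0 >]].
have Kclosed : GRing.submod_closed Kp.
  split=> [|a x y /asboolP hx /asboolP hy]; apply/asboolP => r hr.
    by rewrite big1 // => i _; rewrite mxE mulr0.
  rewrite (eq_bigr (fun i => a * (r 0 i * x 0 i) + r 0 i * y 0 i)).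
    by rewrite big_split /= -mulr_sumr hx // hy // mulr0 addr0.
  by move=> i _; rewrite !mxE mulrDr mulrCA.
pose K := mksub Kclosed; pose q : {linear U -> lquot K} := @lproj k U K.
pose Z : lmodType k := ((U ⊗ C) * lquot K)%type.
have inl_lin : lin (fun t : (U ⊗ C)%type => (t, 0) : Z).
  by move=> a x y; congr pair; rewrite /= scaler0 addr0.
have inr_lin : lin (fun t : lquot K => (0, t) : Z).
  by move=> a x y; congr pair; rewrite /= scaler0 addr0.
have fst_lin : lin (fun z : Z => z.1) by [].
have snd_lin : lin (fun z : Z => z.2) by [].
have coord_lin i : lin (V := k^o) (fun u : U => u 0 i) by move=> a x y; rewrite !mxE.
(* The transposed coefficient matrix: comparing the coordinates in [U] of both sides gives the
   coaction equation for each [yc i]. *)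
pose beta0 (u : U) : (U ⊗ C)%type := \sum_j \sum_i u 0 j *: (E i ⊗ kap i j).
have beta0_lin : lin beta0.
  move=> a x y; rewrite scaler_sumr -big_split; apply: eq_bigr => j _ /=.
  rewrite scaler_sumr -big_split; apply: eq_bigr => i _ /=.
  by rewrite !mxE scalerDl scalerA.
have beta_lin : lin (fun u => (beta0 u, - q u) : Z).
  move=> a x y; congr pair; first by rewrite /= beta0_lin.
  by rewrite /= linearP opprD scalerN.
pose gl p' : (C ⊗ M)%type := \tsum_(c, p'' <- lamP p') c ⊗ g0 p''.
have gl_lin : lin gl by rewrite /gl; lin.
have glG p' w : G (p', w) -> gl p' = lam (g0 p').
  move=> Gpw; rewrite (g0G _ _ Gpw).
  have [m [c [y [Gy /= Py ->]]]] := cG _ Gpw.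
  rewrite /gl Py (lin_big (f := tlift _)); last by lin.
  apply: eq_bigr => j _; rewrite tliftE; last by lin.
  by rewrite (g0G (y j).1 (y j).2) // -surjective_pairing.
pose w := \sum_i ((0, q (E i)) : Z) ⊗ g0 (v i).
pose y0 := \sum_i E i ⊗ gl (v i).
have beta0E i : beta0 (E i) = \sum_l E l ⊗ kap l i.
  rewrite /beta0 (bigD1 i) //= [X in _ + X]big1 ?addr0.
    by apply: eq_bigr => l _; rewrite mxE !eqxx scale1r.
  by move=> j ji; rewrite big1 // => l _; rewrite mxE (negbTE ji) andbF scale0r.
have solve : \tsum_(u, r <- y0) \tsum_(c, m <- r)
    (\tsum_(c1, c2 <- comul c) mklin inl_lin (u ⊗ c1) ⊗ (c2 ⊗ m) - mklin beta_lin u ⊗ (c ⊗ m)) =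
    \tsum_(z, m <- w) z ⊗ lam m.
  rewrite (lin_big (f := tlift _)); last by lin.
  rewrite [RHS](lin_big (f := tlift (fun z m => z ⊗ lam m))); last by lin.
  under eq_bigr => i _ do (rewrite tliftE; last by lin).
  under [RHS]eq_bigr => i _ do (rewrite tliftE; last by lin).
  have E1 i : \tsum_(c, m <- gl (v i)) (\tsum_(c1, c2 <- comul c)
      mklin inl_lin (E i ⊗ c1) ⊗ (c2 ⊗ m) - mklin beta_lin (E i) ⊗ (c ⊗ m)) =
      \sum_j mklin inl_lin (E i ⊗ kap i j) ⊗ gl (v j) - mklin inl_lin (beta0 (E i)) ⊗ gl (v i)
      + mklin inr_lin (q (E i)) ⊗ gl (v i).
    rewrite tsumB; have -> : mklin beta_lin (E i) = mklin inl_lin (beta0 (E i)) - mklin inr_lin (q (E i)).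
      by rewrite /=; congr pair; rewrite /= ?subr0 ?sub0r.
    rewrite -addrA; congr (_ + _); last first.
      transitivity (- ((mklin inl_lin (beta0 (E i)) - mklin inr_lin (q (E i))) ⊗ gl (v i))).
        congr (- _); rewrite -[in RHS](tsum_id (gl (v i))).
        by rewrite (lin_tsum (f := fun r => _ ⊗ r)); last by lin.
      by rewrite tensBl opprB addrC.
    rewrite /gl tsum_tsum; last by lin.
    transitivity (\tsum_(c, p' <- lamP (v i)) \tsum_(c', p'' <- lamP p')
       mklin inl_lin (E i ⊗ c) ⊗ (c' ⊗ g0 p'')).
      rewrite -(lcomodA_sum (F := fun c c' p'' => mklin inl_lin (E i ⊗ c) ⊗ (c' ⊗ g0 p''))) //; last first.
        by split=> *; lin.
      by apply: eq_tlift => c p'; rewrite tliftE //; lin.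
    rewrite vE (lin_big (f := tlift _)); last by lin.
    apply: eq_bigr => j _; rewrite tliftE; last by lin.
    by rewrite [RHS](lin_tsum (f := fun r => mklin inl_lin (E i ⊗ kap i j) ⊗ r)) //; last by lin.
  rewrite (eq_bigr _ (fun i _ => E1 i)) big_split sumrB /= .
  rewrite [X in X - _]exchange_big /= [X in _ - X](eq_bigr (fun i =>
    \sum_l mklin inl_lin (E l ⊗ kap l i) ⊗ gl (v i))); last first.
    move=> i _; rewrite -[(beta0 _, 0)]/(mklin inl_lin (beta0 (E i))) beta0E linear_sum.
    by rewrite (lin_big (f := fun z => z ⊗ gl (v i))); last by lin.
  rewrite subrr add0r; apply/eqP; rewrite -subr_eq0 -sumrB; apply/eqP.
  (* What remains is [\sum_i q (E i) ⊗ D (v i) = 0]. Sliced by [phi], it says that the vector of the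
     [phi (D (v i))] lies in [K], which holds because [D] vanishes on the domain of [G]. *)
  apply: slice_ext => phi; rewrite linear0 linear_sum /=.
  pose D p' := gl p' - lam (g0 p'); have D_lin : lin D by rewrite /D; lin.
  rewrite (eq_bigr (fun i => mklin inr_lin (q (phi (D (v i)) *: E i)))); last first.
    move=> i _; rewrite linearB /= !slice_tens -scalerBl -linearB linearZ /=.
    exact/esym/(linZ _ inr_lin).
  rewrite -linear_sum -linear_sum /= .
  suff -> : q (\sum_i phi (D (v i)) *: E i) = 0 by [].
  rewrite -(linear0 q); apply/eqP; rewrite /q lproj_eq subr0; apply/asboolP => r [w' Gw'].
  rewrite (eq_bigr (fun i => phi (D (r 0 i *: v i)))); last first.
    move=> i _; rewrite summxE (bigD1 i) //= big1 => [|j ji].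
      by rewrite !mxE !eqxx mulr1 addr0 (linZ _ D_lin) linearZ.
    by rewrite !mxE [i == j]eq_sym (negbTE ji) mulr0.
  rewrite -linear_sum -(lin_big _ _ D_lin) /D (glG _ _ Gw') subrr.
  exact: linear0.
have [s sK] := linear_section (quot_surj qC).
have [y yE] := solve_hopf_system qC ker_pi sK splitA hM solve.
pose yc i := \tsum_(u, m <- y) ((u : U) 0 i *: m).
have yfst : \tsum_(u, m <- y) \tsum_(c, m' <- lam m) (u ⊗ c) ⊗ m' = \tsum_(u, m <- y) beta0 u ⊗ m.
  apply/eqP; rewrite -subr_eq0 -tsumB; apply/eqP.
  have := congr1 (tlift (fun (z : Z) (m : M) => z.1 ⊗ m)) yE.
  rewrite (lin_tsum (f := tlift _)); last by lin.
  rewrite /w (lin_big (f := tlift _)); last by lin.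
  rewrite [RHS]big1 => [<-|i _]; last by rewrite tliftE ?tens0l //; lin.
  apply: eq_tlift => u m; rewrite (linB (f := tlift _)); last by lin.
  rewrite tliftE; last by lin.
  congr (_ - _); rewrite (lin_tsum (f := tlift _)); last by lin.
  by apply: eq_tlift => c m'; rewrite tliftE //; lin.
have ysnd : \tsum_(u, m <- y) q u ⊗ m = \sum_i q (E i) ⊗ g0 (v i).
  have := congr1 (tlift (fun (z : Z) (m : M) => z.2 ⊗ m)) yE.
  rewrite (lin_tsum (f := tlift _)); last by lin.
  rewrite /w [RHS](lin_big (f := tlift _)); last by lin.
  under [RHS]eq_bigr => i _ do (rewrite tliftE /=; last by lin).
  move=> <-; apply: eq_tlift => u m; rewrite (linB (f := tlift _)); last by lin.
  rewrite tliftE /=; last by lin.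
  rewrite (lin_tsum (f := tlift _)); last by lin.
  rewrite tensNl opprK [X in X + _](_ : _ = 0) ?add0r //.
  under eq_tlift => c m' do (rewrite tliftE /=; last by lin).
  by rewrite /tlift big1 // => p' _; rewrite tens0l.
have lam_yc i : lam (yc i) = \sum_j kap i j ⊗ yc j.
  pose F (t : (U ⊗ C)%type) (m : M) : (C ⊗ M)%type := \tsum_(u, c <- t) ((u : U) 0 i *: (c ⊗ m)).
  have hF : bil F by rewrite /F; lin.
  have FE u c m : F (u ⊗ c) m = u 0 i *: (c ⊗ m) by rewrite /F tliftE //; lin.
  have := congr1 (tlift F) yfst; rewrite !tsum_tsum //.
  rewrite /yc (lin_tsum (f := lam)); last by lin.
  have -> : \tsum_(u, m <- y) tlift F (\tsum_(c, m' <- lam m) u ⊗ c ⊗ m') =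
      \tsum_(u, m <- y) lam ((u : U) 0 i *: m).
    apply: eq_tlift => u m; rewrite tsum_tsum // linearZ /= -[lam m in RHS]tsum_id -tsumZ.
    by apply: eq_tlift => c m'; rewrite tliftE.
  move=> ->; rewrite [RHS](eq_bigr (fun j => \tsum_(u, m <- y) ((u : U) 0 j *: (kap i j ⊗ m)))); last first.
    by move=> j _; rewrite (lin_tsum (f := fun m => kap i j ⊗ m)); last lin;
       apply: eq_tlift => u m; rewrite tensZr.
  rewrite [RHS]exchange_big /=; apply: eq_bigr => -[u m] _ /=; rewrite tliftE //.
  rewrite /beta0 (lin_big (f := F^~ m)); last by lin.
  apply: eq_bigr => j _; rewrite (lin_big (f := F^~ m)); last by lin.
  rewrite (bigD1 i) //= [X in _ + X]big1 ?addr0 => [|l li].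
    by rewrite (linZ (f := F^~ m)) ?FE ?mxE ?eqxx ?scale1r //; exact: hF.1.
  rewrite (linZ (f := F^~ m)) ?FE; last exact: hF.1.
  by rewrite mxE [i == l]eq_sym (negbTE li) andbF scale0r scaler0.
have yc_rel (r : U) w' : G (\sum_i r 0 i *: v i, w') -> \sum_i r 0 i *: yc i = w'.
  move=> Gr; have dot_lin : lin (V := k^o) (fun u : U => \sum_i r 0 i * u 0 i).
    move=> a x z; rewrite scaler_sumr -big_split; apply: eq_bigr => i _ /=.
    by rewrite !mxE mulrDr mulrCA.
  (* Pairing with [r] vanishes on [K] by the choice of [Kp], so it factors through [q] as [rb]. *)
  have [u /eqP|rb rbE] := linear_extension (i := q) (f := mklin dot_lin).
    rewrite -(linear0 q) /q lproj_eq subr0 => /asboolP; apply; by exists w'.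
  have := congr1 (tlift (fun (z : lquot K) (m : M) => (rb z : k) *: m)) ysnd.
  rewrite (lin_tsum (f := tlift _)); last by lin.
  rewrite [RHS](lin_big (f := tlift _)); last by lin.
  under eq_tlift => u m do (rewrite tliftE; last by lin).
  under [RHS]eq_bigr => i _ do (rewrite tliftE; last by lin).
  have -> : \tsum_(u, m <- y) (rb (q u) *: m) = \sum_i r 0 i *: yc i.
    rewrite /yc /tlift; under [RHS]eq_bigr => i _ do rewrite scaler_sumr.
    rewrite exchange_big; apply: eq_bigr => p' _ /=; rewrite rbE /= scaler_suml.
    by apply: eq_bigr => i _; rewrite scalerA.
  move=> ->; rewrite -(g0G _ _ Gr) linear_sum; apply: eq_bigr => i _.
  rewrite rbE /= linearZ; congr (_ *: _); rewrite (bigD1 i) //= [X in _ + X]big1 ?addr0.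
    by rewrite mxE !eqxx mulr1.
  by move=> j ji; rewrite mxE (negbTE ji) andbF mulr0.
pose G' : set (P * M) := [set x | exists r : U, exists2 z, G z &
  x = (\sum_i r 0 i *: v i, \sum_i r 0 i *: yc i) + z].
have GG' : G `<=` G'.
  move=> z Gz; exists 0; exists z => //.
  by rewrite !big1 ?add0r // => i _; rewrite mxE scale0r.
have G'v i : G' (v i, yc i).
  exists (E i), 0; rewrite // addr0; congr pair; rewrite (bigD1 i) //= [X in _ + X]big1 ?addr0;
  by [rewrite mxE !eqxx scale1r | move=> j ji; rewrite mxE (negbTE ji) andbF scale0r].
have G'lin a x z : G' x -> G' z -> G' (a *: x + z).
  move=> [r1 [z1 Gz1 ->]] [r2 [z2 Gz2 ->]]; exists (a *: r1 + r2); exists (a *: z1 + z2).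
    exact: Glin.
  rewrite scalerDr addrACA; congr (_ + _); congr pair; rewrite /= scaler_sumr -big_split;
  by apply: eq_bigr => i _; rewrite /= !mxE scalerDl scalerA.
have G'0 : G' 0 by exact: GG'.
exists G'; split=> //; last first.
  exists (\sum_j e j *: yc j), (\row_j e j), 0 => //; rewrite addr0 pE.
  by congr pair; apply: eq_bigr => j _; rewrite mxE.
split; first split=> // [m [r [z Gz]]].
  case: z Gz => z1 z2 Gz [/esym/eqP]; rewrite addr_eq0 => /eqP rv ->.
  rewrite (yc_rel r (- z2)) ?addNr // rv.
  by have := Glin (-1) _ _ Gz G0; rewrite addr0 scaleN1r.
have c0 : colin G' 0.
  by exists 0%N, (fun=> 0), (fun=> 0); rewrite !big_ord0 !linear0.
have colinD x z : colin G' x -> colin G' z -> colin G' (x + z).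
  by move=> cx cz; rewrite -[x]scale1r; exact: colin_lin.
move=> _ [r [z Gz ->]]; apply: (colinD _ _); last exact: colin_mono GG' (cG _ Gz).
have -> : (\sum_i r 0 i *: v i, \sum_i r 0 i *: yc i) = \sum_i r 0 i *: (v i, yc i).
  by rewrite [RHS]surjective_pairing !raddf_sum.
apply: (big_ind _ c0 colinD) => i _; rewrite -[_ *: _]addr0; apply: colin_lin c0.
by exists n, (kap i), (fun j => (v j, yc j)); split=> [j||]; [exact: G'v|exact: vE|exact: lam_yc].
Qed.

Lemma hopf_mod_extension (N : lmodType k) (lamN : {linear N -> (C ⊗ N)%type})
    (i : {linear N -> P}) (f : {linear N -> M}) :
  (forall n, lamP (i n) = tmap idfun i (lamN n)) ->
  (forall n, lam (f n) = tmap idfun f (lamN n)) -> injective i ->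
  exists g : {linear P -> M}, (forall p, lam (g p) = tmap idfun g (lamP p)) /\
    forall n, g (i n) = f n.
Proof.
move=> iC fC i_inj; pose G0 : set (P * M) := [set x | exists n, x = (i n, f n)].
have gG0 : good_graph colin G0.
  split=> [|_ [n ->]]; first split=> [|a _ _ [x ->] [y ->]|m [n []]].
  - by exists 0; rewrite !linear0.
  - by exists (a *: x + y); rewrite !linearP.
  - by move=> /esym/eqP; rewrite raddf_eq0 // => /eqP -> ->; rewrite linear0.
  (* One representative of [lamN n], pushed forward along [i] and along [f], represents both
     coactions with the same elements of [C]. *)
  have rE := tens_sum (lamN n); rewrite (big_nth (0, 0)) big_mkord in rE.
  pose r j := nth (0, 0) (repr (lamN n)) j.
  exists (size (repr (lamN n))), (fun j => (r j).1), (fun j => (i (r j).2, f (r j).2)).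
  split=> [j||] /=; first by exists (r j).2.
  - rewrite iC {1}rE [LHS]linear_sum; apply: eq_bigr => j _; exact: tmap_tens.
  - rewrite fC {1}rE [LHS]linear_sum; apply: eq_bigr => j _; exact: tmap_tens.
have [G p gG _ _|g [gG gC]] := zorn_graph colin_mono gG0.
- exact: colinear_graph_step.
exists g; split=> [p|n]; last by apply: gG; exists n.
have [n [c [y [/= yg lp lg]]]] := gC p; rewrite lg lp [RHS]linear_sum; apply: eq_bigr => j _.
by rewrite yg; apply/esym; exact: tmap_tens.
Qed.

End Injectivity.

(** * Injectivity over C implies projectivity over the coinvariants *)

Section Subspace.
Variables (k : fieldType) (V : lmodType k) (S : submodClosed V).

(** The subspace as a vector space of its own, needed to treat [ker pi] as a relative Hopf
    module. *)
Definition lsub : Type := {x : V | x \in S}.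
HB.instance Definition _ := SubChoice.on lsub.
HB.instance Definition _ := [SubChoice_isSubLmodule of lsub by <:].

Definition lsub_val (x : lsub) : V := \val x.
Lemma lsub_val_linear : linear lsub_val. Proof. by move=> a x y; exact: linearP. Qed.
HB.instance Definition _ := GRing.isLinear.Build k lsub V _ lsub_val lsub_val_linear.

Lemma lsub_valP x : lsub_val x \in S. Proof. exact: valP. Qed.

Lemma lsub_retraction : exists p : {linear V -> lsub}, forall x, p (lsub_val x) = x.
Proof.
have [x x0|p pE] := linear_extension (i := lsub_val) (f := idfun); last by exists p.
by apply: val_inj; rewrite [LHS]x0 -[RHS]/(lsub_val 0) linear0.
Qed.

End Subspace.

Section FactorToSubalgebra.
Variables (k : fieldType) (H : hopfType k) (A : rcSubalg H) (C : coalgType k).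
Variables (pi : {linear H -> C}) (act : H -> C -> C).
Hypothesis qC : is_quotient pi act.
Hypothesis coinvA : forall a, a \in rcs_pred A <-> \tsum_(x, y <- comul a) pi x ⊗ y = pi 1 ⊗ a.
Implicit Types (L M X : lmodType k).

(* Every object of [{}_H^C M] is a direct summand, as a comodule, of a cofree comodule. *)
Definition coactions_split : Prop :=
  forall M (ha : H -> M -> M) (lam : {linear M -> (C ⊗ M)%type}), is_hopf_mod act ha lam ->
  exists r : {linear (C ⊗ M)%type -> M},
    (forall m, r (lam m) = m) /\
    forall c m, lam (r (c ⊗ m)) = \tsum_(c1, c2 <- comul c) c1 ⊗ r (c2 ⊗ m).

Let act_bilC : bil act := act_bil qC.

Lemma quot_coinv a : a \in rcs_pred A -> pi a = counit a *: pi 1.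
Proof.
move=> /coinvA E; have := congr1 (tlift (fun c h => counit h *: c)) E.
rewrite tsum_tsum; last by lin.
rewrite tliftE => [<-|]; last by lin.
under eq_tlift => x y do (rewrite tliftE; last by lin).
by rewrite (counitr_sum (f := pi)) //; exact: linE.
Qed.

Lemma quot_mul_coinv h a : a \in rcs_pred A -> pi (h * a) = counit a *: pi h.
Proof.
move=> /quot_coinv E; rewrite -(quot_act qC) E (linZ _ (act_bilC.2 h)).
by rewrite (quot_act qC) mulr1.
Qed.

Let regular_lin : lin (fun h : H => \tsum_(x, y <- comul h) pi x ⊗ y). Proof. by lin. Qed.

Definition regular_coact : {linear H -> (C ⊗ H)%type} := mklin regular_lin.

Lemma regular_hopf_mod : is_hopf_mod act (fun g h : H => g * h) regular_coact.
Proof.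
split.
- by split=> [|h|g h m]; [lin | rewrite mul1r | rewrite mulrA].
- split=> h.
    rewrite /tmap /tassoc /= !tsum_tsum; try by lin.
    under eq_tlift => x y do (rewrite tliftE; last by lin).
    under [RHS]eq_tlift => x y do (rewrite tliftE; last by lin).
    transitivity (\tsum_(x, y <- comul h) \tsum_(x1, x2 <- comul x) pi x1 ⊗ (pi x2 ⊗ y)).
      apply: eq_tlift => x y; rewrite tliftE; last by lin.
      by rewrite (comul_quot_sum qC) //; lin.
    rewrite (comulA_sum (F := fun x y z => pi x ⊗ (pi y ⊗ z))); last by split=> *; lin.
    by apply: eq_tlift => x y; rewrite (lin_tsum (f := fun t => pi x ⊗ t)) //; lin.
  rewrite /= tsum_tsum; last by lin.
  under eq_tlift => x y do (rewrite tliftE ?(quot_counit qC); last by lin).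
  exact: counitl.
- move=> g h /=; rewrite comulM_sum; last by lin.
  rewrite /diag_act; apply: eq_tlift => g1 g2.
  rewrite tsum_tsum; last by lin.
  by apply: eq_tlift => h1 h2; rewrite tliftE ?(quot_act qC) //; lin.
Qed.

Section Retraction.
Variables (M : lmodType k) (ha : H -> M -> M) (lam : {linear M -> (C ⊗ M)%type}).
Hypothesis hM : is_hopf_mod act ha lam.
Variable r : {linear (C ⊗ M)%type -> M}.
Hypothesis r_lam : forall m, r (lam m) = m.
Hypothesis r_colin : forall c m, lam (r (c ⊗ m)) = \tsum_(c1, c2 <- comul c) c1 ⊗ r (c2 ⊗ m).

(** The convolution of [S] with the colinear map [h |-> r (pi h ⊗ m)]; the antipode cancels the
    coaction that [h] contributes. *)
Definition coinv_part (m : M) (h : H) : M :=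
  \tsum_(h1, h2 <- comul h) ha (antipode h1) (r (pi h2 ⊗ m)).

Let ha_bil : bil ha. Proof. by have [[]] := hM. Qed.

Lemma coinv_part_bil : bil coinv_part.
Proof. by rewrite /coinv_part; lin. Qed.

Lemma coinv_part_coinv m h : lam (coinv_part m h) = pi 1 ⊗ coinv_part m h.
Proof.
have [hL _ lam_ha] := hM; have [_ _ hMul] := hL; have hd := diag_act_bil qC hL.
rewrite (lin_tsum (f := lam)); last by lin.
transitivity (\tsum_(h1, h2 <- comul h) \tsum_(x, y <- comul h2)
    diag_act act ha (antipode h1) (pi x ⊗ r (pi y ⊗ m))).
  apply: eq_tlift => h1 h2; rewrite lam_ha r_colin (comul_quot_sum qC) //; last by lin.
  by rewrite (lin_tsum (f := diag_act act ha (antipode h1))); last by lin.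
rewrite -(comulA_sum (F := fun h1 x y =>
  diag_act act ha (antipode h1) (pi x ⊗ r (pi y ⊗ m)))); last by split=> *; lin.
rewrite [RHS](lin_tsum (f := fun n => pi 1 ⊗ n)); last by lin.
apply: eq_tlift => h1 h2.
by rewrite (diag_act_antipode qC hL (f := id)).
Qed.

(** Convolving with the identity of [H] undoes the antipode. As [pi] and [r] are surjective, the
    coinvariant elements [coinv_part m h] therefore generate [M] over [H]. *)
Lemma coinv_part_sum X (f : M -> X) m h : lin f ->
  \tsum_(h1, h2 <- comul h) f (ha h1 (coinv_part m h2)) = f (r (pi h ⊗ m)).
Proof.
move=> hf; have [[_ h1E hMul] _ _] := hM.
transitivity (\tsum_(h1, h2 <- comul h) \tsum_(x, y <- comul h2) f (ha (h1 * antipode x) (r (pi y ⊗ m)))).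
  apply: eq_tlift => h1 h2; rewrite /coinv_part (lin_tsum (f := ha h1)); last by lin.
  by rewrite (lin_tsum _ _ hf); apply: eq_tlift => x y; rewrite hMul.
rewrite -(comulA_sum (F := fun h1 x y => f (ha (h1 * antipode x) (r (pi y ⊗ m))))); last by split=> *; lin.
rewrite -[RHS](counitl_sum (f := fun h => f (r (pi h ⊗ m)))); last by lin.
apply: eq_tlift => x y.
by rewrite (antipoder_sum (f := fun u => f (ha u (r (pi y ⊗ m))))) ?h1E //; lin.
Qed.

End Retraction.

Hypothesis splitC : coactions_split.

Let ker_closed : GRing.submod_closed [pred x | pi x == 0].
Proof.
split=> [|a x y]; first by rewrite inE linear0.
by rewrite !inE => /eqP xI /eqP yI; rewrite linearP xI yI scaler0 addr0.
Qed.

Lemma quot_ker_HAplus x : pi x = 0 <-> x \in HAplus A.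
Proof.
split; last first.
  by apply: lspan_ker => _ [h [a [aA ea ->]]]; rewrite quot_mul_coinv // ea scale0r.
move=> x0; pose I := mksub ker_closed; pose v : {linear lsub I -> H} := @lsub_val k H I.
have [p pK] := lsub_retraction I.
have vI y : pi (v y) = 0 by have := lsub_valP y; rewrite inE => /eqP.
have vp y : pi y = 0 -> v (p y) = y.
  move=> y0; have yI : y \in I by rewrite inE y0.
  by rewrite -[y]/(v (Sub y yI)) pK.
(* The structure of [I] is computed in [H] through the inclusion [v] and brought back by the linear
   retraction [p]. *)
pose hI h y := p (h * v y); have hI_bil : bil hI by rewrite /hI; lin.
have vhI h y : v (hI h y) = h * v y.
  by rewrite /hI vp // -(quot_act qC) vI (lin0 (act_bilC.2 h)).
have lamI_lin : lin (fun y => \tsum_(c, z <- regular_coact (v y)) c ⊗ p z) by lin.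
pose lamI := mklin lamI_lin.
have lamIE y : lamI y = \tsum_(c, z <- regular_coact (v y)) c ⊗ p z by [].
(* The error [z - v (p z)] vanishes on [ker pi], hence depends on [pi z] only. On the coaction of an
   element of [I] it then contributes a function of [Delta (pi y)], which is zero. *)
have [dlt dltE] : exists d : {linear C -> H}, forall z, d (pi z) = z - v (p z).
  have idvp : lin (fun z => z - v (p z)) by lin.
  have [z z0|d dE] := linear_extension (i := pi) (f := mklin idvp); last by exists d.
  by rewrite /= vp // subrr.
(* The coaction of [H] maps [I] to [C ⊗ I]. *)
have vlamI X (F : C -> H -> X) y : bil F ->
    \tsum_(c, z <- regular_coact (v y)) F c (v (p z)) = tlift F (regular_coact (v y)).
  move=> hF; apply/eqP; rewrite eq_sym -subr_eq0 -tsumB; apply/eqP.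
  transitivity (\tsum_(c, z <- regular_coact (v y)) F c (dlt (pi z))).
    by apply: eq_tlift => c z; rewrite dltE (linB (hF.2 c)).
  rewrite /= tsum_tsum; last by lin.
  under eq_tlift => c z do (rewrite tliftE; last by lin).
  rewrite -(comul_quot_sum qC (F := fun c z => F c (dlt z))); last by lin.
  by rewrite vI linear0 (lin0 (f := tlift _)) //; lin.
have regH := regular_hopf_mod; have [regL regC regE] := regH.
have hMI : is_hopf_mod act hI lamI.
  split.
  - split=> // [y|g h y]; apply: val_inj; rewrite -![val _]/(v _).
      by rewrite vhI mul1r.
    by rewrite !vhI mulrA.
  - split=> y; last first.
      rewrite lamIE tsum_tsum; last by lin.
      under eq_tlift => c z do (rewrite tliftE; last by lin).
      by rewrite (lcomod_counit_sum (f := p)) ?pK //; lin.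
    rewrite !lamIE; move: regC (vlamI) => {}regC {}vlamI.
    rewrite /tmap [RHS]tsum_tsum; last by lin.
    under [RHS]eq_tlift => c z do (rewrite tliftE ?lamIE; last by lin).
    rewrite [in LHS]tsum_tsum; last by lin.
    rewrite /tassoc tsum_tsum; last by lin.
    rewrite (vlamI _ (fun c z => c ⊗ \tsum_(c', z' <- regular_coact z) c' ⊗ p z')); last by lin.
    transitivity (\tsum_(c, z <- regular_coact (v y)) \tsum_(c', z' <- regular_coact z) c ⊗ (c' ⊗ p z')); last first.
      by apply: eq_tlift => c z; rewrite [RHS](lin_tsum (f := fun t => c ⊗ t)); last by lin.
    rewrite -(lcomodA_sum (F := fun c c' z' => c ⊗ (c' ⊗ p z'))) //; last by split=> *; lin.
    apply: eq_tlift => c z; rewrite tliftE; last by lin.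
    by rewrite tliftE //; lin.
  - move=> h y; rewrite !lamIE vhI regE /diag_act.
    rewrite [LHS]tsum_tsum; last by lin.
    apply: eq_tlift => h1 h2; rewrite [LHS]tsum_tsum; last by lin.
    rewrite [RHS]tsum_tsum; last by lin.
    rewrite -(vlamI _ (fun c z => tlift (fun c z => c ⊗ p z) (act h1 c ⊗ (h2 * z)))); last by lin.
    by apply: eq_tlift => c z; rewrite !tliftE //; lin.
have [r [r_lam r_colin]] := splitC hMI; have hcp := coinv_part_bil hMI r.
have n_subalg y h : v (coinv_part hI r y h) \in rcs_pred A.
  apply/coinvA; have := coinv_part_coinv hMI r_colin y h.
  have hF : bil (fun (c : C) (z : lsub I) => c ⊗ v z) by lin.
  move: (coinv_part _ _ _ _) => n E; rewrite -(tliftE (pi 1) n hF) -E lamIE tsum_tsum //.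
  under [RHS]eq_tlift => c z do (rewrite tliftE; last by lin).
  by rewrite (vlamI _ (fun c z => c ⊗ z)) ?tsum_id //; lin.
have xI : x \in I by rewrite inE x0.
(* Being [r] of its coaction, [x] is a sum of terms [h_1 n] with [n] a coinvariant of [ker pi]. Such
   an [n] lies in [A], and its counit vanishes since [counit n = counit (pi n)]. *)
rewrite -[x]/(v (Sub x xI)) -(r_lam (Sub x xI)); move: (lamI _) => t.
rewrite -(tsum_id t) (lin_tsum (f := fun t => v (r t))); last by lin.
apply: rpred_sum => -[c y] _ /=; have [h <-] := quot_surj qC c.
rewrite -(coinv_part_sum hMI r (f := v)); last by lin.
apply: rpred_sum => -[h1 h2] _ /=; rewrite vhI; apply: lspan_gen.
exists h1, (v (coinv_part hI r y h2)); split=> //.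
by rewrite -(quot_counit qC) vI linear0.
Qed.

End FactorToSubalgebra.

(* A right [A]-module which is a right [H]-comodule, as an object of [M_A^H]. The action is
   extended to a bilinear map on [X * H]; only its values on [A] matter. *)
Definition is_right_hopf_mod (k : fieldType) (H : hopfType k) (A : rcSubalg H) (X : lmodType k)
    (ra : X -> H -> X) (rho : {linear X -> (X ⊗ H)%type}) : Prop :=
  [/\ bil ra, forall x, ra x 1 = x,
      forall x a b, a \in rcs_pred A -> b \in rcs_pred A -> ra (ra x a) b = ra x (a * b),
      is_rcomod rho &
      forall x a, a \in rcs_pred A -> rho (ra x a) =
        \tsum_(a1, a2 <- comul a) \tsum_(x0, x1 <- rho x) ra x0 a1 ⊗ (x1 * a2)].

Definition right_subobject (k : fieldType) (H : hopfType k) (A : rcSubalg H) (X : lmodType k)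
    (ra : X -> H -> X) (rho : {linear X -> (X ⊗ H)%type}) (S : {pred X}) : Prop :=
  (forall x a, x \in S -> a \in rcs_pred A -> ra x a \in S) /\
  (forall x, x \in S -> rho x \in tsubl S).

Section RightHopfModules.
Variables (k : fieldType) (H : hopfType k) (A : rcSubalg H) (C : coalgType k).
Variables (pi : {linear H -> C}) (act : H -> C -> C).
Hypothesis qC : is_quotient pi act.
Hypothesis coinvA : forall a, a \in rcs_pred A <-> \tsum_(x, y <- comul a) pi x ⊗ y = pi 1 ⊗ a.
Hypothesis splitC : coactions_split act.
Variables (X : lmodType k) (ra : X -> H -> X) (rho : {linear X -> (X ⊗ H)%type}).
Hypothesis hX : is_right_hopf_mod A ra rho.

Let act_bilC : bil act := act_bil qC.
Let ra_bil : bil ra. Proof. by case: hX. Qed.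

(* The map [u ⊗ g |-> \sum u_0 n_g(u_1)], which factors through [X / X A^+ ⊗ H] and inverts
   [x |-> \sum x_0 ⊗ x_1]. *)
Lemma reconstruction : exists Om : X -> H -> X,
  [/\ bil Om, forall x, \tsum_(x0, x1 <- rho x) Om x0 x1 = x,
      forall x a g, a \in rcs_pred A -> Om (ra x a) g = counit a *: Om x g &
      forall (S : submodClosed X) x g, right_subobject A ra rho S -> x \in S -> Om x g \in S].
Proof.
have [_ ra1 raM rhoC rho_ra] := hX.
have regH := regular_hopf_mod qC; have [r [r_lam r_colin]] := splitC regH.
pose n := coinv_part pi (fun g h : H => g * h) r.
have n_bil : bil n := coinv_part_bil pi regH r.
have nA g h : n g h \in rcs_pred A.
  by apply/coinvA; exact: (coinv_part_coinv qC regH r_colin g h).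
pose Om x g := \tsum_(u0, u1 <- rho x) ra u0 (n g u1).
have Om_bil : bil Om by rewrite /Om; lin.
(* The sum is [\sum S(y_1) r (pi y_2 ⊗ y_3)], where [pi y_2 ⊗ y_3] is the coaction of the regular
   object; the retraction property leaves [S(y_1) y_2]. This is why [Om] inverts [rho]. *)
have n_diag y : \tsum_(y1, y2 <- comul y) n y2 y1 = (counit y)%:A.
  rewrite /n /coinv_part (comulA_sum (F := fun a b c => antipode a * r (pi b ⊗ c))); last by split=> *; lin.
  rewrite -antipodel; apply: eq_tlift => a b; rewrite -[in RHS](r_lam b).
  by rewrite [RHS](lin_tsum (f := fun t => antipode a * r t)); last by lin.
(* The factor [S(a_2)] coming from [n] cancels [a_1], and [pi] turns the remaining [a] into its
   counit. This makes [Om] vanish on [X A^+] in its first argument. *)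
have n_mul g h a : a \in rcs_pred A ->
    \tsum_(a1, a2 <- comul a) (a1 * n g (h * a2)) = counit a *: n g h.
  move=> aA; transitivity (\tsum_(h1, h2 <- comul h)
      (antipode h1 * r (pi (h2 * a) ⊗ g))); last first.
    rewrite -[RHS]tsumZ; apply: eq_tlift => h1 h2.
    by rewrite (quot_mul_coinv qC coinvA) // tensZl linearZ scalerAr.
  transitivity (\tsum_(a1, a2 <- comul a) \tsum_(h1, h2 <- comul h) \tsum_(b1, b2 <- comul a2)
      (a1 * antipode b1 * (antipode h1 * r (pi (h2 * b2) ⊗ g)))).
    apply: eq_tlift => a1 a2; rewrite /n /coinv_part comulM_sum; last by lin.
    rewrite (lin_tsum (f := fun u => a1 * u)); last by lin.
    apply: eq_tlift => h1 h2; rewrite (lin_tsum (f := fun u => a1 * u)); last by lin.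
    by apply: eq_tlift => b1 b2; rewrite antipodeM !mulrA.
  rewrite tsum_exchange; apply: eq_tlift => h1 h2.
  rewrite -(comulA_sum (F := fun a1 b1 b2 =>
    a1 * antipode b1 * (antipode h1 * r (pi (h2 * b2) ⊗ g)))); last by split=> *; lin.
  rewrite -[RHS](counitl_sum (f := fun a => antipode h1 * r (pi (h2 * a) ⊗ g))); last by lin.
  apply: eq_tlift => x b2.
  by rewrite (antipoder_sum (f := fun u => u * (antipode h1 * r (pi (h2 * b2) ⊗ g)))) ?mul1r //; lin.
exists Om; split=> // [x|x a g aA|S x g [SA Srho] xS].
- rewrite /Om (rcomodA_sum (F := fun u0 u1 x1 => ra u0 (n x1 u1))) //; last by split=> *; lin.
  rewrite -[RHS](rcomod_counit_sum (rho := rho) (f := id)) //.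
  apply: eq_tlift => x0 x1.
  rewrite -(lin_tsum (f := ra x0) (fun c1 c2 => n c2 c1)); last by lin.
  by rewrite n_diag (linZ _ (ra_bil.2 x0)) ra1.
- rewrite /Om rho_ra // tsum_tsum; last by lin.
  under eq_tlift => a1 a2 do (rewrite tsum_tsum; last by lin).
  under eq_tlift => a1 a2 do under eq_tlift => x0 x1 do (rewrite tliftE; last by lin).
  rewrite tsum_exchange -tsumZ; apply: eq_tlift => x0 x1.
  rewrite (coideal_sum_eq (A := A) (G := fun a1 a2 => ra x0 (a1 * n g (x1 * a2)))) //.
  + by rewrite -(lin_tsum (f := ra x0) (fun a1 a2 => a1 * n g (x1 * a2))) ?n_mul ?(linZ _ (ra_bil.2 x0)) //; lin.
  + by lin.
  + by lin.
  + by move=> u v uA; rewrite raM.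
- apply: (tsubl_sub (S := S)) => [||u v uS]; [by lin|exact: Srho|].
  by apply: SA.
Qed.
End RightHopfModules.

(** A spanning family of minimal length is a basis of [S] modulo [K]; the functionals [q] are its
    dual basis, defined on all of [X]. *)
Lemma basis_modulo (k : fieldType) (X : lmodType k) (K S : submodClosed X) n (x : 'I_n -> X) :
  (forall j, x j \in S) ->
  (forall y, y \in S -> exists c : 'I_n -> k, y - \sum_j c j *: x j \in K) ->
  exists r (s : 'I_r -> X) (q : 'I_r -> {scalar X}),
    [/\ forall a, s a \in S, forall b y, y \in K -> q b y = 0,
        forall a b, q b (s a) = (a == b)%:R &
        forall y, y \in S -> y - \sum_a q a y *: s a \in K].
Proof.
move=> xS xspan.
pose spans r := exists s : 'I_r -> X, (forall a, s a \in S) /\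
  forall y, y \in S -> exists c : 'I_r -> k, y - \sum_a c a *: s a \in K.
have ex : exists r, `[< spans r >] by exists n; apply/asboolP; exists x.
case: (ex_minnP ex) => r /asboolP[s [sS sspan]] rmin.
(* [T b] is [K] plus the span of the [s a] with [a] other than [b]. It does not contain [s b], since
   otherwise [s b] could be dropped, so [separation] provides the dual functional. *)
pose T b : {pred X} := [pred y | `[< exists c : 'I_r -> k, c b = 0 /\ y - \sum_a c a *: s a \in K >]].
have Tclosed b : GRing.submod_closed (T b).
  split=> [|a y z /asboolP[c [cb yc]] /asboolP[d [db zd]]]; apply/asboolP.
    exists (fun=> 0); split=> //; rewrite sub0r big1 ?oppr0 ?rpred0 // => i _.
    by rewrite scale0r.
  exists (fun i => a * c i + d i); rewrite cb db mulr0 addr0; split=> //.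
  rewrite (eq_bigr (fun i => a *: (c i *: s i) + d i *: s i)).
    rewrite big_split /= -scaler_sumr opprD addrACA -scalerBr.
    by apply: rpredD => //; exact: rpredZ.
  by move=> i _; rewrite scalerDl scalerA.
have sT b : s b \notin T b.
  apply/negP => /asboolP[d [db sd]].
  case: r => [|r] in s sS sspan rmin T Tclosed b d db sd *; first by case: b db sd.
  have: `[< spans r >]; last by move=> /rmin; rewrite ltnn.
  apply/asboolP; exists (fun j => s (lift b j)); split=> [j|y /sspan[c yc]]; first exact: sS.
  exists (fun j => c (lift b j) + c b * d (lift b j)).
  have -> : y - \sum_(a < r) (c (lift b a) + c b * d (lift b a)) *: s (lift b a) =
      (y - \sum_a c a *: s a) + c b *: (s b - \sum_a d a *: s a).
    rewrite (bigD1_ord b) //= [X in s b - X](bigD1_ord b) //= db scale0r add0r.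
    rewrite scalerBr addrA opprD addrA [_ - c b *: s b - _]addrAC subrK -addrA -opprD.
    congr (_ - _); rewrite scaler_sumr -big_split; apply: eq_bigr => j _ /=.
    by rewrite scalerDl scalerA.
  by apply: rpredD => //; exact: rpredZ.
have /choice[q qP] b : exists phi : {scalar X}, phi (s b) = 1 /\ forall y, y \in T b -> phi y = 0.
  exact: separation (Tclosed b) (sT b).
have qK b y : y \in K -> q b y = 0.
  move=> yK; apply: (qP b).2; apply/asboolP; exists (fun=> 0); split=> //.
  by rewrite big1 ?subr0 // => i _; rewrite scale0r.
have qs a b : q b (s a) = (a == b)%:R.
  have [->|ab] := eqVneq a b; first exact: (qP b).1.
  apply: (qP b).2; apply/asboolP; exists (fun i => (i == a)%:R); split.
    by rewrite eq_sym (negbTE ab).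
  rewrite (bigD1 a) //= [X in - (_ + X)]big1 ?addr0 => [|i ia].
    by rewrite eqxx scale1r subrr rpred0.
  by rewrite (negbTE ia) scale0r.
exists r, s, q; split=> // y yS; have [c yc] := sspan y yS.
rewrite (eq_bigr (fun a => c a *: s a)) // => b _; congr (_ *: _).
rewrite -[y](subrK (\sum_a c a *: s a)) linearD qK // add0r linear_sum (bigD1 b) //=.
rewrite [X in _ + X]big1 ?addr0 => [|a ab]; rewrite linearZ /= qs ?eqxx ?mulr1 //.
by rewrite (negbTE ab) mulr0.
Qed.

(** * The relative Hopf module [H ⊗ W] of a comodule [W] *)

Section FreeHopfModule.
Variables (k : fieldType) (H : hopfType k) (C : coalgType k).
Variables (pi : {linear H -> C}) (act : H -> C -> C).
Hypothesis qC : is_quotient pi act.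
Variables (W : lmodType k) (lamW : {linear W -> (C ⊗ W)%type}).
Hypothesis hW : is_lcomod lamW.

Let act_bilC : bil act := act_bil qC.

Definition free_lact (h : H) (t : (H ⊗ W)%type) : (H ⊗ W)%type :=
  \tsum_(g, w <- t) (h * g) ⊗ w.

Let lam_fun (t : (H ⊗ W)%type) : (C ⊗ (H ⊗ W))%type :=
  \tsum_(g, w <- t) \tsum_(g1, g2 <- comul g) \tsum_(c, w' <- lamW w) act g1 c ⊗ (g2 ⊗ w').

Let lam_fun_lin : lin lam_fun. Proof. by rewrite /lam_fun; lin. Qed.

Definition free_coact : {linear (H ⊗ W)%type -> (C ⊗ (H ⊗ W))%type} := mklin lam_fun_lin.

Lemma free_coact_tens g w : free_coact (g ⊗ w) =
  \tsum_(g1, g2 <- comul g) \tsum_(c, w' <- lamW w) act g1 c ⊗ (g2 ⊗ w').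
Proof. by rewrite /= /lam_fun tliftE //; lin. Qed.

Lemma free_lact_tens h g w : free_lact h (g ⊗ w) = (h * g) ⊗ w.
Proof. by rewrite /free_lact tliftE //; lin. Qed.

Lemma free_hopf_mod : is_hopf_mod act free_lact free_coact.
Proof.
have hb : bil free_lact by rewrite /free_lact; lin.
split.
- split=> // [t|g h].
    by rewrite /free_lact -[RHS]tsum_id; apply: eq_tlift => g w; rewrite mul1r.
  apply: tsum_ext; [by lin | by lin | move=> x w].
  by rewrite !free_lact_tens mulrA.
- split.
    have tl : lin (@tassoc k C C (H ⊗ W)%type) by rewrite /tassoc; lin.
    have ml : lin (tmap (@comul k C) (@idfun (H ⊗ W)%type)) by rewrite /tmap; lin.
    have mr : lin (tmap (@idfun C) free_coact) by rewrite /tmap; lin.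
    apply: tsum_ext; [by lin | by lin | move=> g w].
    rewrite free_coact_tens.
    transitivity (\tsum_(g1, g2 <- comul g) \tsum_(c, w' <- lamW w)
      \tsum_(x, y <- comul g1) \tsum_(c1, c2 <- comul c) act x c1 ⊗ (act y c2 ⊗ (g2 ⊗ w'))).
      rewrite (lin_tsum (f := fun t => tassoc (tmap _ _ t))); last by lin.
      apply: eq_tlift => g1 g2; rewrite (lin_tsum (f := fun t => tassoc (tmap _ _ t))); last by lin.
      apply: eq_tlift => c w'; rewrite /tmap tliftE; last by lin.
      rewrite /tassoc tliftE; last by lin.
      by rewrite (comul_act_sum qC) //; lin.
    transitivity (\tsum_(g1, g2 <- comul g) \tsum_(c, w' <- lamW w)
      \tsum_(x, y <- comul g2) \tsum_(c', w'' <- lamW w') act g1 c ⊗ (act x c' ⊗ (y ⊗ w''))); last first.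
      rewrite [RHS](lin_tsum (f := tmap _ _)); last by lin.
      apply: eq_tlift => g1 g2; rewrite [RHS](lin_tsum (f := tmap _ _)); last by lin.
      apply: eq_tlift => c w'; rewrite /tmap tliftE; last by lin.
      rewrite /idfun free_coact_tens (lin_tsum (f := fun t => act g1 c ⊗ t)); last by lin.
      by apply: eq_tlift => x y; rewrite (lin_tsum (f := fun t => act g1 c ⊗ t)); last by lin.
    under eq_tlift => g1 g2 do rewrite tsum_exchange.
    rewrite (comulA_sum (F := fun x y g2 => \tsum_(c, w' <- lamW w) \tsum_(c1, c2 <- comul c)
      act x c1 ⊗ (act y c2 ⊗ (g2 ⊗ w')))); last by split=> *; lin.
    apply: eq_tlift => g1 g2; rewrite [RHS]tsum_exchange; apply: eq_tlift => x y.
    by rewrite (lcomodA_sum (F := fun c1 c2 w' => act g1 c1 ⊗ (act x c2 ⊗ (y ⊗ w')))) //; split=> *; lin.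
  apply: tsum_ext; [by lin | by lin | move=> g w].
  have cact h c : counit (act h c) = counit h * counit c.
    by have [x <-] := quot_surj qC c; rewrite (quot_act qC) !(quot_counit qC) counitM.
  rewrite free_coact_tens (lin_tsum (f := tlift _)); last by lin.
  rewrite -[RHS](counitl_sum (f := fun g => g ⊗ w)); last by lin.
  apply: eq_tlift => g1 g2; rewrite (lin_tsum (f := tlift _)); last by lin.
  rewrite -(lcomod_counit_sum (f := fun w => g2 ⊗ w) w hW) -?tsumZ; last by lin.
  by apply: eq_tlift => c w'; rewrite tliftE ?cact ?scalerA //; lin.
- move=> h; have hL : is_lmod free_lact.
    split=> // [t|g1 g2].
      by rewrite /free_lact -[RHS]tsum_id; apply: eq_tlift => g w; rewrite mul1r.
    apply: tsum_ext; [by lin | by lin | move=> x w].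
    by rewrite !free_lact_tens mulrA.
  have hd := diag_act_bil qC hL.
  apply: tsum_ext; [by lin | by lin | move=> g w].
  rewrite free_lact_tens !free_coact_tens comulM_sum; last by lin.
  rewrite [RHS](lin_tsum (f := diag_act act free_lact h)); last by lin.
  rewrite tsum_exchange; apply: eq_tlift => g1 g2.
  rewrite [RHS](lin_tsum (f := diag_act act free_lact h)); last by lin.
  rewrite [LHS]tsum_exchange; apply: eq_tlift => c w'.
  rewrite (diag_act_tens qC hL); apply: eq_tlift => h1 h2.
  by rewrite free_lact_tens (actM qC).
Qed.

End FreeHopfModule.

Lemma submod_rpredB (k : fieldType) (V : lmodType k) (S : submodClosed V) (x y : V) :
  x \in S -> y \in S -> x - y \in S.
Proof. by move=> xS yS; rewrite -scaleN1r rpredD // rpredZ. Qed.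

(** * Dual bases of subquotients [S2/S1] *)

Section Projectivity.
Variables (k : fieldType) (H : hopfType k) (A : rcSubalg H) (C : coalgType k).
Variables (pi : {linear H -> C}) (act : H -> C -> C).
Hypothesis qC : is_quotient pi act.
Hypothesis coinvA : forall a, a \in rcs_pred A <-> \tsum_(x, y <- comul a) pi x ⊗ y = pi 1 ⊗ a.
Hypothesis splitC : coactions_split act.
Variables (X : lmodType k) (ra : X -> H -> X) (rho : {linear X -> (X ⊗ H)%type}).
Hypothesis hX : is_right_hopf_mod A ra rho.

Let act_bilC : bil act := act_bil qC.
Let ra_bil : bil ra. Proof. by case: hX. Qed.

Section Step.
Variables (S1 S2 : submodClosed X).
Hypotheses (hS1 : right_subobject A ra rho S1) (hS2 : right_subobject A ra rho S2).

(* The kernel [S1 + S2 A^+] of [S2 -> S2/S1 ⊗_A k]. *)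
Definition fiber_ker : {pred X} :=
  lspan [set y | y \in S1 \/ exists z a, [/\ z \in S2, a \in rcs_pred A, counit a = 0 & y = ra z a]].

Variables (r : nat) (s : 'I_r -> X) (q : 'I_r -> {scalar X}).
Hypothesis sS : forall a, s a \in S2.
Hypothesis qK : forall b y, y \in fiber_ker -> q b y = 0.
Hypothesis qs : forall a b, q b (s a) = (a == b)%:R.
Hypothesis sK : forall y, y \in S2 -> y - \sum_a q a y *: s a \in fiber_ker.

Let W := 'rV[k]_r.
Let e (a : 'I_r) : W := delta_mx 0 a.
(** Evaluation of functionals: [W] stands for the dual of [S2] modulo [fiber_ker], with [e a] dual
    to [s a]. *)
Let pr (w : W) (x : X) : k := \sum_a w 0 a * q a x.

Let coord_lin i : lin (V := k^o) (fun w : W => w 0 i).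
Proof. by move=> a x y; rewrite !mxE. Qed.

Let pr_bil : @bil k W X k^o pr.
Proof.
split=> [x a w w'|w a x x']; rewrite /pr scaler_sumr -big_split; apply: eq_bigr => i _ /=.
  by rewrite !mxE mulrDl -mulrA.
by rewrite linearP mulrDr mulrCA.
Qed.

Let sum_delta (V : lmodType k) (w : W) (F : 'I_r -> V) b :
  (forall a, w 0 a = (a == b)%:R) -> \sum_a w 0 a *: F a = F b.
Proof.
move=> wE; rewrite (bigD1 b) //= [X in _ + X]big1 ?addr0 => [|a ab].
  by rewrite wE eqxx scale1r.
by rewrite wE (negbTE ab) scale0r.
Qed.

Let eE b a : e b 0 a = (a == b)%:R. Proof. by rewrite mxE. Qed.

Let prE b x : pr (e b) x = q b x.
Proof. exact: (sum_delta (V := k^o) (fun a => q a x) (eE b)). Qed.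

Let pr_expand w : \sum_a pr w (s a) *: e a = w.
Proof.
have prs b : pr w (s b) = w 0 b.
  rewrite /pr (bigD1 b) //= [X in _ + X]big1 ?addr0 ?qs ?eqxx ?mulr1 // => a ab.
  by rewrite qs eq_sym (negbTE ab) mulr0.
rewrite [RHS]row_sum_delta; apply: eq_bigr => a _; by rewrite prs.
Qed.

Let q_ra b x a : x \in S2 -> a \in rcs_pred A -> q b (ra x a) = counit a * q b x.
Proof.
move=> xS aA; apply/eqP; rewrite -subr_eq0 -linearZ -linearB; apply/eqP/qK.
have [_ ra1 _ _ _] := hX; apply: lspan_gen; right; exists x, (a - (counit a)%:A); split=> //.
- by apply: rpredB => //; apply: rpredZ; exact: rpred1.
- by rewrite linearB linearZ /= counit1 mulr1 subrr.
- by rewrite (linB (ra_bil.2 x)) (linZ _ (ra_bil.2 x)) ra1.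
Qed.

Let pr_ra w x a : x \in S2 -> a \in rcs_pred A -> pr w (ra x a) = counit a * pr w x.
Proof.
move=> xS aA; rewrite /pr mulr_sumr; apply: eq_bigr => b _.
by rewrite q_ra // mulrCA.
Qed.

Let pr_S1 w x : x \in S1 -> pr w x = 0.
Proof.
move=> xS; rewrite /pr big1 // => a _; rewrite qK ?mulr0 //.
by apply: lspan_gen; left.
Qed.

(** Matrix coefficients of the right [C]-coaction induced by [rho] on [S2] modulo [fiber_ker]. With
    the indices transposed they define the left coaction of the dual. *)
Let B b a : C := \tsum_(x0, x1 <- rho (s a)) (q b x0 *: pi x1).

Let lamW_fun (w : W) : (C ⊗ W)%type := \sum_b \sum_a w 0 b *: (B b a ⊗ e a).

Let lamW_lin : lin lamW_fun.
Proof.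
move=> c x y; rewrite scaler_sumr -big_split; apply: eq_bigr => b _ /=.
rewrite scaler_sumr -big_split; apply: eq_bigr => a _ /=.
by rewrite !mxE scalerDl scalerA.
Qed.

Let lamW := mklin lamW_lin.

Let lamWE b : lamW (e b) = \sum_a B b a ⊗ e a.
Proof.
rewrite /= /lamW_fun exchange_big; apply: eq_bigr => a _.
exact: (sum_delta (fun b => B b a ⊗ e a) (eE b)).
Qed.

(* [W] is the dual comodule of [S2/S1 ⊗_A k]. *)
Let pr_coact (Y : lmodType k) (f : C -> Y) w x : lin f -> x \in S2 ->
  \tsum_(x0, x1 <- rho x) (pr w x0 *: f (pi x1)) = \tsum_(c, w' <- lamW w) (pr w' x *: f c).
Proof.
move=> hf; have [_ _ _ _ rho_ra] := hX.
pose L w x := \tsum_(x0, x1 <- rho x) ((pr w x0 : k) *: f (pi x1)).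
pose R w x := \tsum_(c, w' <- lamW w) ((pr w' x : k) *: f c).
have hL : bil L by rewrite /L; lin.
have hR : bil R by rewrite /R; lin.
(* Both sides vanish on [fiber_ker], so it suffices to compare them on the [s a]. On [z a] with
   [counit a = 0] the left side vanishes because [pr] absorbs [a_1] and [pi] absorbs [a_2]. *)
have LK y : y \in fiber_ker -> L w y = 0.
  apply: (lspan_ker (f := mklin (hL.2 w))) => {}y [yS|[z [a [zS aA ea ->]]]] /=.
    rewrite /L (tsubl_eq (S := S1) (G := fun _ _ => 0)) //.
    + by rewrite /tlift big1.
    + by lin.
    + by split=> ? c u v; rewrite scaler0 addr0.
    + exact: hS1.2.
    + by move=> u v uS; rewrite pr_S1 // scale0r.
  rewrite /L rho_ra // tsum_tsum; last by lin.
  under eq_tlift => a1 a2 do (rewrite tsum_tsum; last by lin).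
  under eq_tlift => a1 a2 do under eq_tlift => x0 x1 do (rewrite tliftE; last by lin).
  rewrite (coideal_sum_eq (A := A) (G := fun a1 a2 => counit a1 *:
    \tsum_(x0, x1 <- rho z) (pr w x0 *: f (pi (x1 * a2))))) //; [|by lin|by lin|].
    rewrite counitl_sum; last by lin.
    rewrite /tlift big1 // => -[x0 x1] _ /=.
    by rewrite (quot_mul_coinv qC coinvA) // ea scale0r (lin0 hf) scaler0.
  move=> u v uA; rewrite -tsumZ; apply: (tsubl_eq (S := S2)); [by lin|by lin|exact: hS2.2|].
  by move=> x0 x1 x0S; rewrite pr_ra // scalerA.
have RK y : y \in fiber_ker -> R w y = 0.
  move=> yK; rewrite /R /tlift big1 // => p _.
  by rewrite /pr big1 ?scale0r // => a _; rewrite qK ?mulr0.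
move=> xS; rewrite -/(L w x) -/(R w x) -[x](subrK (\sum_a q a x *: s a)).
rewrite (linD (hL.2 w)) (linD (hR.2 w)) (LK _ (sK xS)) (RK _ (sK xS)) !add0r.
rewrite (lin_big _ _ (hL.2 w)) (lin_big _ _ (hR.2 w)); apply: eq_bigr => a _.
rewrite (linZ _ (hL.2 w)) (linZ _ (hR.2 w)); congr (_ *: _) => {x xS}.
transitivity (\sum_b w 0 b *: f (B b a)).
  rewrite /B /L; under [RHS]eq_bigr => b _ do rewrite (lin_tsum _ _ hf) /tlift scaler_sumr.
  rewrite exchange_big; apply: eq_bigr => -[x0 x1] _ /=; rewrite /pr scaler_suml.
  by apply: eq_bigr => b _; rewrite (linZ _ hf) scalerA.
rewrite /R /= /lamW_fun (lin_big (f := tlift _)); last by lin.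
apply: eq_bigr => b _; rewrite (lin_big (f := tlift _)); last by lin.
rewrite (bigD1 a) //= [X in _ + X]big1 ?addr0 => [|a' a'a].
  by rewrite (linZ (f := tlift _)) ?tliftE ?prE ?qs ?eqxx ?scale1r //; lin.
rewrite (linZ (f := tlift _)) ?tliftE; [|lin|lin].
by rewrite prE qs eq_sym (negbTE a'a) scale0r scaler0.
Qed.

(** The coefficients form a comatrix: [Delta (B b a) = \sum_c B b c ⊗ B c a] by coassociativity of
    [rho] and [pr_coact], and [counit (B b a)] is the Kronecker delta. *)
Let comodW : is_lcomod lamW.
Proof.
have [_ _ _ rhoC _] := hX.
have BE b a : comul (B b a) = \sum_c B b c ⊗ B c a.
  rewrite /B (lin_tsum (f := @comul k C)); last by lin.
  transitivity (\tsum_(x0, x1 <- rho (s a)) \tsum_(u0, u1 <- rho x0) (q b u0 *: (pi u1 ⊗ pi x1))).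
    rewrite (rcomodA_sum (F := fun u0 u1 x1 => q b u0 *: (pi u1 ⊗ pi x1))) //; last by split=> *; lin.
    apply: eq_tlift => x0 x1; rewrite linearZ /= (quot_comul qC).
    by rewrite (lin_tsum (f := fun t => q b x0 *: t)); last by lin.
  transitivity (\tsum_(x0, x1 <- rho (s a)) \sum_c q c x0 *: (B b c ⊗ pi x1)).
    apply: (tsubl_eq (S := S2)); [by lin| |exact: hS2.2|].
      split=> [v|u]; apply: (@lin_sum k) => c; lin.
    move=> x0 x1 x0S; under eq_tlift => u0 u1 do rewrite -(prE b).
    rewrite (pr_coact (f := fun c => c ⊗ pi x1)) //; last by lin.
    rewrite lamWE (lin_big (f := tlift _)); last by lin.
    by apply: eq_bigr => c _; rewrite tliftE ?prE //; lin.
  rewrite /tlift exchange_big; apply: eq_bigr => c _ /=.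
  rewrite -[LHS]/(\tsum_(x0, x1 <- rho (s a)) (q c x0 *: (B b c ⊗ pi x1))).
  rewrite -[X in _ = _ ⊗ X]/(\tsum_(x0, x1 <- rho (s a)) (q c x0 *: pi x1)).
  rewrite [RHS](lin_tsum (f := fun t => B b c ⊗ t)); last by lin.
  by apply: eq_tlift => x0 x1; rewrite tensZr.
have Bc b a : counit (B b a) = (a == b)%:R.
  rewrite -qs -(rcomod_counit_sum (f := fun x => q b x : k^o) (s a) rhoC); last by lin.
  have hc : lin (V := k^o) (@counit k C) := lin_counit (@lin_id k C).
  rewrite /B [LHS](lin_tsum _ _ hc).
  apply: eq_bigr => -[x0 x1] _ /=; rewrite linearZ /= (quot_counit qC); exact: mulrC.
have tl : lin (@tassoc k C C W) by rewrite /tassoc; lin.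
have ml : lin (tmap (@comul k C) (@idfun W)) by rewrite /tmap; lin.
have mr : lin (tmap (@idfun C) lamW) by rewrite /tmap; lin.
have el (V : lmodType k) (f g : W -> V) : lin f -> lin g -> (forall b, f (e b) = g (e b)) -> f =1 g.
  move=> hf hg fg w; rewrite -(pr_expand w) (lin_big _ _ hf) (lin_big _ _ hg).
  by apply: eq_bigr => b _; rewrite (linZ _ hf) (linZ _ hg) fg.
split; (apply: el => [||b]; [by lin|by lin|]).
  rewrite lamWE (lin_big (f := fun t => tassoc (tmap _ _ t))) ?[RHS](lin_big (f := tmap _ _)); [|by lin|by lin].
  transitivity (\sum_a \sum_c B b c ⊗ (B c a ⊗ e a)).
    apply: eq_bigr => a _; rewrite /tmap tliftE; last by lin.
    rewrite /tassoc tliftE ?BE; last by lin.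
    rewrite (lin_big (f := tlift _)); last by lin.
    by apply: eq_bigr => c _; rewrite tliftE //; lin.
  rewrite exchange_big; apply: eq_bigr => c _; rewrite /tmap tliftE; last by lin.
  by rewrite lamWE (lin_big (f := fun t => idfun (B b c) ⊗ t)) //; lin.
rewrite lamWE (lin_big (f := tlift _)); last by lin.
under eq_bigr => a _ do (rewrite tliftE; last by lin).
under eq_bigr => a _ do rewrite Bc.
by rewrite -[RHS](sum_delta e (eE b)); apply: eq_bigr => a _; rewrite eE eq_sym.
Qed.

(** [g ⊗ w] acts as [x |-> \sum w(x_0) g x_1]. On [S2] these maps are right [A]-linear and vanish on
    [S1], so they are candidates for functionals on [S2/S1], but with values in [H]. *)
Let Psi (n : (H ⊗ W)%type) (x : X) : H :=
  \tsum_(g, w <- n) \tsum_(x0, x1 <- rho x) (pr w x0 *: (g * x1)).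

Let Psi_bil : bil Psi. Proof. by rewrite /Psi; lin. Qed.

Let Psi_tens g w x : Psi (g ⊗ w) x = \tsum_(x0, x1 <- rho x) (pr w x0 *: (g * x1)).
Proof. by rewrite /Psi tliftE //; lin. Qed.

Let Psi_mul g n x : Psi (free_lact g n) x = g * Psi n x.
Proof.
rewrite /Psi /free_lact tsum_tsum; last by lin.
rewrite [RHS](lin_tsum (f := fun u => g * u)); last by lin.
apply: eq_tlift => h w; rewrite tliftE; last by lin.
rewrite [RHS](lin_tsum (f := fun u => g * u)); last by lin.
by apply: eq_tlift => x0 x1; rewrite -scalerAr mulrA.
Qed.

Let Psi_S1 n x : x \in S1 -> Psi n x = 0.
Proof.
move=> xS; rewrite /Psi /tlift big1 // => -[g w] _ /=.
rewrite -[LHS]/(\tsum_(x0, x1 <- rho x) (pr w x0 *: (g * x1))).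
rewrite (tsubl_eq (S := S1) (G := fun _ _ => 0)) //.
- by rewrite /tlift big1.
- by lin.
- by split=> ? c u v; rewrite scaler0 addr0.
- exact: hS1.2.
- by move=> u v uS; rewrite pr_S1 // scale0r.
Qed.

Let Psi_ra n x a : x \in S2 -> a \in rcs_pred A -> Psi n (ra x a) = Psi n x * a.
Proof.
move=> xS aA; have [_ _ _ _ rho_ra] := hX.
rewrite /Psi (lin_tsum (f := fun u => u * a)); last by lin.
apply: eq_tlift => g w; rewrite rho_ra // tsum_tsum; last by lin.
under eq_tlift => a1 a2 do (rewrite tsum_tsum; last by lin).
under eq_tlift => a1 a2 do under eq_tlift => x0 x1 do (rewrite tliftE; last by lin).
rewrite (coideal_sum_eq (A := A) (G := fun a1 a2 => counit a1 *:
    \tsum_(x0, x1 <- rho x) (pr w x0 *: (g * (x1 * a2))))) //; [|by lin|by lin|].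
  rewrite counitl_sum; last by lin.
  rewrite (lin_tsum (f := fun u => u * a)); last by lin.
  by apply: eq_tlift => x0 x1; rewrite -scalerAl mulrA.
move=> u v uA; rewrite -tsumZ; apply: (tsubl_eq (S := S2)); [by lin|by lin|exact: hS2.2|].
by move=> x0 x1 x0S; rewrite pr_ra // scalerA.
Qed.

(** For [x] in [S2], [Psi] carries the coaction of [H ⊗ W] to that of [H], by [pr_coact]; hence a
    coinvariant [n] has coinvariant values, which lie in [A]. *)
Let Psi_coinv n x : free_coact qC lamW n = pi 1 ⊗ n -> x \in S2 -> Psi n x \in rcs_pred A.
Proof.
have [_ _ _ rhoC _] := hX; move=> nC xS; apply/coinvA.
have E (t : (H ⊗ W)%type) : \tsum_(u, v <- comul (Psi t x)) pi u ⊗ v =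
    \tsum_(c, m <- free_coact qC lamW t) c ⊗ Psi m x.
  pose F (t : (H ⊗ W)%type) := \tsum_(u, v <- comul (Psi t x)) pi u ⊗ v.
  pose G (t : (H ⊗ W)%type) := \tsum_(c, m <- free_coact qC lamW t) c ⊗ Psi m x.
  apply: (tsum_ext (F := F) (G := G)); [by rewrite /F; lin | by rewrite /G; lin |].
  move=> g w; rewrite /F /G free_coact_tens Psi_tens.
  pose D h := \tsum_(u, v <- comul h) pi u ⊗ v; have hD : lin D by rewrite /D; lin.
  rewrite -/(D _) (lin_tsum _ _ hD).
  transitivity (\tsum_(x0, x1 <- rho x) \tsum_(g1, g2 <- comul g) \tsum_(y1, y2 <- comul x1)
      ((pr w x0 : k) *: (act g1 (pi y1) ⊗ (g2 * y2) : (C ⊗ H)%type))).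
    apply: eq_tlift => x0 x1; rewrite (linZ _ hD) /D comulM_sum; last by lin.
    rewrite -tsumZ; apply: eq_tlift => g1 g2; rewrite -tsumZ; apply: eq_tlift => y1 y2.
    by rewrite (quot_act qC).
  rewrite tsum_exchange [RHS](lin_tsum (f := tlift _)); last by lin.
  apply: eq_tlift => g1 g2; rewrite [RHS](lin_tsum (f := tlift _)); last by lin.
  rewrite -(rcomodA_sum (F := fun x0 y1 y2 => pr w x0 *: (act g1 (pi y1) ⊗ (g2 * y2) : (C ⊗ H)%type))) //; last first.
    by split=> *; lin.
  transitivity (\tsum_(x0, x1 <- rho x) \tsum_(c, w' <- lamW w) ((pr w' x0 : k) *: (act g1 c ⊗ (g2 * x1) : (C ⊗ H)%type))).
    apply: (tsubl_eq (S := S2)); [by lin|by lin|exact: hS2.2|].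
    by move=> x0 x1 x0S; rewrite (pr_coact (f := fun c => act g1 c ⊗ (g2 * x1))) //; lin.
  rewrite tsum_exchange; apply: eq_tlift => c w'; rewrite tliftE; last by lin.
  rewrite Psi_tens [RHS](lin_tsum (f := fun t => act g1 c ⊗ t)); last by lin.
  by apply: eq_tlift => x0 x1; rewrite tensZr.
by rewrite E nC tliftE //; lin.
Qed.

(** The [t i] and [al i] form a dual basis of [S2] modulo [S1]. The functionals come from the
    coinvariants of [H ⊗ W] attached to [1 ⊗ e a], and the elements are the left legs of
    [rho (s a)]. *)
Lemma split_step : exists (I : finType) (t : I -> X) (al : I -> {linear X -> H}),
  forall y, y \in S2 ->
    [/\ forall i, al i y \in rcs_pred A,
        forall i a, a \in rcs_pred A -> al i (ra y a) = al i y * a,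
        y \in S1 -> forall i, al i y = 0 &
        y - \sum_i ra (t i) (al i y) \in S1].
Proof.
have [_ _ raM rhoC rho_ra] := hX.
have [Om [Om_bil Om_id Om_ra Om_S]] := reconstruction qC coinvA splitC hX.
have hM := free_hopf_mod qC comodW; have [R [R_lam R_colin]] := splitC hM.
pose nn a h := coinv_part pi (@free_lact k H W) R (1 ⊗ e a) h.
have nn_lin a : lin (nn a) := (coinv_part_bil pi hM R).2 (1 ⊗ e a).
(* Since the index set has to be a finite type, the terms of the representative of [rho (s a)] are
   numbered; an index is a pair of [a] and a term. *)
pose N a := size (repr (rho (s a))).
pose tp a (j : 'I_(N a)) := nth (0, 0) (repr (rho (s a))) j.
have rhos (V : lmodType k) (F : X -> H -> V) a : tlift F (rho (s a)) =
    \sum_(j < N a) F (tp a j).1 (tp a j).2.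
  by rewrite /tlift (big_nth (0, 0)) big_mkord.
have al_lin (i : {a : 'I_r & 'I_(N a)}) : lin (fun x => Psi (nn (tag i) (tp _ (tagged i)).2) x).
  by lin.
pose I : finType := {a : 'I_r & 'I_(N a)}.
exists I, (fun i => (tp _ (tagged i)).1), (fun i => mklin (al_lin i)) => y yS.
have nnC a h : free_coact qC lamW (nn a h) = pi 1 ⊗ nn a h by exact: (coinv_part_coinv qC hM R_colin).
have alA (i : I) x : x \in S2 -> mklin (al_lin i) x \in rcs_pred A.
  by move=> xS; exact: Psi_coinv.
split=> [i|i a aA|yS1 i|].
- exact: alA.
- exact: Psi_ra.
- exact: Psi_S1.
pose E := \sum_a \tsum_(t, h <- rho (s a)) ra t (Psi (nn a h) y).
have -> : \sum_(i : I) ra (tp _ (tagged i)).1 (mklin (al_lin i) y) = E.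
  rewrite /E; under [RHS]eq_bigr => a _ do rewrite rhos.
  by rewrite sig_big_dep.
have PsiS2 a h : Psi (nn a h) y \in rcs_pred A by exact: Psi_coinv.
have ES2 : E \in S2.
  apply: rpred_sum => a _; apply: (tsubl_sub (S := S2)); [by lin|exact/hS2.2/sS|].
  by move=> u v uS; exact: hS2.1.
pose D := y - E; have DS2 : D \in S2 by exact: submod_rpredB.
(* [Psi (1 ⊗ w)] takes the same value at [y] and at [E]: write [1 ⊗ w] as [R] of its coaction, pass
   to [rho (s a)] by [pr_coact], and expand with [coinv_part_sum]. *)
have PsiD w : Psi (1 ⊗ w) D = 0.
  rewrite (linB (Psi_bil.2 _)) -[X in _ - X]/(Psi (1 ⊗ w) E); apply/eqP; rewrite subr_eq0; apply/eqP.
  rewrite /E (lin_big _ _ (Psi_bil.2 _)).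
  transitivity (\sum_a Psi (R (\tsum_(c, w' <- lamW w) ((pr w' (s a) : k) *: (c ⊗ (1 ⊗ e a))))) y).
    transitivity (Psi (R (free_coact qC lamW (1 ⊗ w))) y); first by rewrite R_lam.
    rewrite free_coact_tens comul1_sum; last by lin.
    rewrite -(lin_big (f := fun t => Psi (R t) y)); last by lin.
    congr (Psi (R _) y); rewrite /tlift exchange_big; apply: eq_bigr => -[c w'] _ /=.
    rewrite (act1 qC) -[in LHS](pr_expand w').
    rewrite (lin_big (f := fun w => c ⊗ (1 ⊗ w))); last by lin.
    by apply: eq_bigr => a _; rewrite tensZr tensZr.
  apply: eq_bigr => a _.
  transitivity (\tsum_(x0, x1 <- rho (s a)) ((pr w x0 : k) *: Psi (R (pi x1 ⊗ (1 ⊗ e a))) y)).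
    rewrite (pr_coact (f := fun c => Psi (R (c ⊗ (1 ⊗ e a))) y)) ?sS //; last by lin.
    rewrite (lin_tsum (f := fun t => Psi (R t) y)); last by lin.
    by apply: eq_tlift => c w'; rewrite (linZ (f := fun t => Psi (R t) y)) //; lin.
  transitivity (\tsum_(x0, x1 <- rho (s a)) \tsum_(h1, h2 <- comul x1)
      ((pr w x0 : k) *: (h1 * Psi (nn a h2) y))).
    apply: eq_tlift => x0 x1.
    rewrite -(coinv_part_sum pi hM R (f := fun n => Psi n y)); last by lin.
    by rewrite -tsumZ; apply: eq_tlift => h1 h2; rewrite Psi_mul.
  rewrite -(rcomodA_sum (F := fun x0 h1 h2 => (pr w x0 : k) *: (h1 * Psi (nn a h2) y))) //; last first.
    by split=> *; lin.
  rewrite [RHS](lin_tsum (f := Psi (1 ⊗ w))); last by lin.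
  apply: (tsubl_eq (S := S2)); [by lin|by lin|exact/hS2.2/sS|].
  move=> x0 x1 x0S; rewrite Psi_ra // Psi_tens (lin_tsum (f := fun u => u * Psi (nn a x1) y)); last by lin.
  by apply: eq_tlift => u0 u1; rewrite mul1r scalerAl.
rewrite -/D -(Om_id D).
(* By [PsiD] at [e a] the coordinates of [rho D] along the [s a] vanish, so [x0] may be replaced by
   its part in [fiber_ker]. There [Om] has values in [S1], since it kills [z a] with [counit a = 0]
   and preserves [S1]. *)
have -> : \tsum_(x0, x1 <- rho D) Om x0 x1 =
    \tsum_(x0, x1 <- rho D) Om (x0 - \sum_a q a x0 *: s a) x1.
  under [in RHS]eq_tlift => x0 x1 do rewrite (linB (Om_bil.1 x1)).
  rewrite tsumB -[LHS]subr0; congr (_ - _).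
  transitivity (\sum_a Om (s a) (Psi (1 ⊗ e a) D)).
    by rewrite big1 // => a _; rewrite PsiD (lin0 (Om_bil.2 _)).
  under [RHS]eq_tlift => x0 x1 do rewrite (lin_big _ _ (Om_bil.1 x1)).
  rewrite /tlift exchange_big; apply: eq_bigr => a _ /=.
  rewrite -[RHS]/(\tsum_(x0, x1 <- rho D) Om (q a x0 *: s a) x1) Psi_tens.
  rewrite (lin_tsum (f := Om (s a))); last by lin.
  apply: eq_tlift => x0 x1; rewrite mul1r prE (linZ _ (Om_bil.1 x1)) (linZ _ (Om_bil.2 (s a))).
  by [].
have hF : bil (fun x0 x1 => Om (x0 - \sum_a q a x0 *: s a) x1).
  split=> [v|u]; last by lin.
  apply: lin_comp (Om_bil.1 v) _; apply: lin_add; first exact: lin_id.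
  by apply: lin_opp; apply: (@lin_sum k) => a; lin.
apply: (tsubl_sub (S := S2)); [by []|exact: hS2.2|move=> x0 x1 /sK].
move: (_ - _) => z zK; apply: (lspan_map (f := mklin (Om_bil.1 x1))) zK => v /=.
move=> [vS|[z' [a [_ aA ea ->]]]]; first exact: Om_S.
by rewrite Om_ra // ea scale0r rpred0.
Qed.

End Step.
End Projectivity.

Lemma tsubl_subset (k : fieldType) (U V : lmodType k) (S T : {pred U}) (t : (U ⊗ V)%type) :
  {subset S <= T} -> t \in tsubl S -> t \in tsubl T.
Proof.
move=> ST; apply: lspan_min => _ [u [v [uS ->]]].
by apply: tsubl_tens; exact: ST.
Qed.

(** * Lifting linear maps defined on relative Hopf modules *)

Section Lifting.
Variables (k : fieldType) (H : hopfType k) (A : rcSubalg H) (C : coalgType k).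
Variables (pi : {linear H -> C}) (act : H -> C -> C).
Hypothesis qC : is_quotient pi act.
Hypothesis coinvA : forall a, a \in rcs_pred A <-> \tsum_(x, y <- comul a) pi x ⊗ y = pi 1 ⊗ a.
Hypothesis splitC : coactions_split act.

Section FiniteExtension.
Variables (X : lmodType k) (ra : X -> H -> X) (rho : {linear X -> (X ⊗ H)%type}).
Hypothesis hX : is_right_hopf_mod A ra rho.
Variables (S1 : submodClosed X) (m : X).
Hypothesis hS1 : right_subobject A ra rho S1.

(** [S2] is [S1 + \sum_j x_j A], where the slices [x_j] of [rho m] span a subcomodule containing
    [m]. Modulo [S2 A^+] the element [x_j a] equals [counit a *: x_j], so the quotient by
    [fiber_ker] is spanned by the finitely many [x_j]. *)
Lemma adjoin_element : exists S2 : submodClosed X,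
  [/\ right_subobject A ra rho S2, forall x, x \in S1 -> x \in S2, m \in S2 &
    exists n (x : 'I_n -> X), (forall j, x j \in S2) /\
      forall y, y \in S2 -> exists c : 'I_n -> k,
        y - \sum_j c j *: x j \in fiber_ker A ra S1 S2].
Proof.
have [ra_bil ra1 raM rhoC rho_ra] := hX.
have [n [phi [h rhom]]] := slice_repr (rho m); set x := fun j => slice (phi j) (rho m) in rhom.
pose S2 : {pred X} := lspan [set y | y \in S1 \/ exists j a, a \in rcs_pred A /\ y = ra (x j) a].
pose Sp : {pred X} := lspan [set y | exists j, y = x j].
have xS2 j : x j \in S2 by apply: lspan_gen; right; exists j, 1; rewrite ra1 rpred1.
have SpS2 u a : u \in Sp -> a \in rcs_pred A -> ra u a \in S2.
  move=> uS aA; apply: (lspan_map (f := mklin (ra_bil.1 a))) uS => _ [j ->] /=.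
  by apply: lspan_gen; right; exists j, a.
have rhox j : rho (x j) \in tsubl Sp.
  have -> : rho (x j) = \sum_l \tsum_(c1, c2 <- comul (h l)) (phi j c2 *: (x l ⊗ c1)).
    rewrite -[x j]/(\tsum_(x0, x1 <- rho m) phi j x1 *: x0) (lin_tsum (f := rho)); last by lin.
    transitivity (\tsum_(x0, x1 <- rho m) \tsum_(c1, c2 <- comul x1) (phi j c2 *: (x0 ⊗ c1))).
      rewrite -(rcomodA_sum (F := fun x0 c1 c2 => phi j c2 *: (x0 ⊗ c1))) //; last by split=> *; lin.
      apply: eq_tlift => x0 x1; rewrite linearZ /= -[rho x0 in LHS]tsum_id.
      by rewrite (lin_tsum (f := fun t => phi j x1 *: t)); last by lin.
    rewrite {1}rhom (lin_big (f := tlift _)); last by lin.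
    by apply: eq_bigr => l _; rewrite tliftE //; lin.
  apply: rpred_sum => l _; apply: rpred_sum => p _; apply: rpredZ; apply: tsubl_tens.
  by apply: lspan_gen; exists l.
have S12 y : y \in S1 -> y \in S2 by move=> yS; apply: lspan_gen; left.
have S2A y a : y \in S2 -> a \in rcs_pred A -> ra y a \in S2.
  move=> yS aA; apply: (lspan_map (f := mklin (ra_bil.1 a))) yS => z /= [zS|[j [b [bA ->]]]].
    by apply: S12; exact: hS1.1.
  by apply: lspan_gen; right; exists j, (b * a); rewrite raM // rpredM.
have S2rho y : y \in S2 -> rho y \in tsubl S2.
  apply: lspan_map => {}y [yS|[j [a [aA ->]]]].
    by apply: (tsubl_subset S12); exact: hS1.2.
  rewrite rho_ra //; apply: (tsubl_sub (S := rcs_pred A)); [by lin|exact: rcs_coideal|].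
  move=> a1 a2 a1A; apply: (tsubl_sub (S := Sp)); [by lin|exact: rhox|].
  by move=> x0 x1 x0S; apply: tsubl_tens; exact: SpS2.
pose S2s : submodClosed X := mksub (lspan_closed [set y | y \in S1 \/ exists j a, a \in rcs_pred A /\ y = ra (x j) a]).
exists S2s; split=> //.
- have -> : m = \sum_j counit (h j) *: x j.
    rewrite -{1}[m](rcomod_counit_sum (f := id) _ rhoC) //.
    rewrite {1}rhom (lin_big (f := tlift _)); last by lin.
    by apply: eq_bigr => j _; rewrite tliftE //; lin.
  by apply: rpred_sum => j _; apply: rpredZ; exact: xS2.
exists n, x; split=> // y yS; pose K := fiber_ker A ra S1 S2s.
pose Q : {pred X} := [pred y | `[< exists c : 'I_n -> k, y - \sum_j c j *: x j \in K >]].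
have Qclosed : GRing.submod_closed Q.
  split=> [|a u v /asboolP[c uc] /asboolP[d vd]]; apply/asboolP.
    by exists (fun=> 0); rewrite sub0r big1 ?oppr0 ?rpred0 // => i _; rewrite scale0r.
  exists (fun i => a * c i + d i).
  rewrite (eq_bigr (fun i => a *: (c i *: x i) + d i *: x i)).
    rewrite big_split /= -scaler_sumr opprD addrACA -scalerBr.
    by apply: rpredD => //; exact: rpredZ.
  by move=> i _; rewrite scalerDl scalerA.
suff : y \in mksub Qclosed by move=> /asboolP.
apply: lspan_min yS => {}y [yS|[j [a [aA ->]]]]; apply/asboolP.
  exists (fun=> 0); rewrite big1 ?subr0 => [|i _]; last by rewrite scale0r.
  by apply: lspan_gen; left.
exists (fun i => counit a * (i == j)%:R); rewrite (bigD1 j) //= [X in - (_ + X)]big1 ?addr0.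
  apply: lspan_gen; right; exists (x j), (a - (counit a)%:A); split.
  - exact: xS2.
  - by apply: rpredB => //; apply: rpredZ; exact: rpred1.
  - by rewrite linearB linearZ /= counit1 mulr1 subrr.
  - by rewrite eqxx mulr1 (linB (ra_bil.2 _)) (linZ _ (ra_bil.2 _)) ra1.
by move=> i ij; rewrite (negbTE ij) mulr0 scale0r.
Qed.

End FiniteExtension.

(** * Modules over an algebra [B] that is anti-isomorphic to [A] through [bv] *)

Section Projective.
Variables (B : algType k) (M : lmodType B).
Variables (ra : kspace M -> H -> kspace M) (rho : {linear kspace M -> (kspace M ⊗ H)%type}).
Hypothesis hM : is_right_hopf_mod A ra rho.
Variable bv : {linear B -> H}.
Hypotheses (bvA : forall b, bv b \in rcs_pred A)
  (bv_surj : forall a, a \in rcs_pred A -> exists b, bv b = a) (bv_inj : injective bv)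
  (bvM : forall b c, bv (b * c) = bv c * bv b)
  (ra_bv : forall b (m : kspace M), ra m (bv b) = kact b m).

Section Lift.
Variables (N P : lmodType B) (p : {linear N -> P}) (f : {linear M -> P}).
Hypothesis p_surj : forall y, exists x, p x = y.

Let dom (G : set (M * N)) : {pred kspace M} := [pred x : kspace M | `[< exists w, G (x, w) >]].

(** Besides lifting [f], each point must have its coaction in [dom G ⊗ H]. This makes the domain of
    a good graph a subobject, as [split_step] requires of [S1]. *)
Let psi (G : set (M * N)) (x : M * N) : Prop :=
  p x.2 = f x.1 /\ rho (x.1 : kspace M) \in tsubl (V := H) (dom G).

Let psi_mono (G G' : set (M * N)) x : G `<=` G' -> psi G x -> psi G' x.
Proof.
move=> GG' [px rx]; split=> //; apply: tsubl_subset rx => y /asboolP[w Gw].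
by apply/asboolP; exists w; exact: GG'.
Qed.

Let lift_step (G : set (M * N)) (m : M) : good_graph psi G ->
  exists G', [/\ good_graph psi G', G `<=` G' & exists w, G' (m, w)].
Proof.
move=> [[G0 Glin Gfun] Gpsi]; have [ra_bil ra1 raM rhoC rho_ra] := hM.
have dom_closed : GRing.submod_closed (dom G).
  split=> [|a x y /asboolP[w Gw] /asboolP[w' Gw']]; apply/asboolP; first by exists 0.
  by exists ((a%:A : B) *: w + w'); exact: (Glin a%:A (x, w) (y, w')).
have hS1 : right_subobject A ra rho (mksub dom_closed).
  split=> [x a /asboolP[w Gw] /bv_surj[b <-]|x /asboolP[w /Gpsi[] //]].
  apply/asboolP; exists (b *: w); rewrite ra_bv.
  by have := Glin b _ _ Gw G0; rewrite addr0.
have [S2 [hS2 S12 mS [n [x [xS xspan]]]]] := adjoin_element hM (m : kspace M) hS1.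
have [r [s [q [sS qK qs sK]]]] := basis_modulo xS xspan.
have [I [t [al alP]]] := split_step qC coinvA splitC hM hS1 hS2 sS qK qs sK.
have /choice[nu nuP] i : exists w, p w = f (t i) by exact: p_surj.
(* The extension of the partial map [g] with graph [G] is [y |-> g (y - \sum_i b_i t_i) + \sum_i b_i
   nu_i], where [b_i] in [B] corresponds to [al i y] and [nu i] lifts [f (t i)]. *)
pose G' : set (M * N) := [set y | (y.1 : kspace M) \in S2 /\ exists b : I -> B,
  (forall i, bv (b i) = al i y.1) /\
  G (y.1 - \sum_i b i *: (t i : M), y.2 - \sum_i b i *: nu i)].
have al0 (y : kspace M) : (forall i, al i y = 0) -> forall b : I -> B,
    (forall i, bv (b i) = al i y) -> forall i, b i = 0.
  by move=> y0 b bE i; apply: bv_inj; rewrite bE y0 linear0.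
have bexists (y : kspace M) : y \in S2 -> exists b : I -> B, forall i, bv (b i) = al i y.
  move=> /alP[alA _ _ _].
  have /choice[b bE] i : exists b, bv b = al i y by exact: bv_surj.
  by exists b.
have G'dom (y : kspace M) : y \in S2 -> y \in dom G'.
  move=> yS; have [b bE] := bexists y yS; have [_ _ _] := alP y yS.
  have -> : \sum_i ra (t i) (al i y) = (\sum_i b i *: (t i : M) : M).
    by apply: eq_bigr => i _; rewrite -bE ra_bv.
  case/asboolP=> w Gw; apply/asboolP; exists (w + \sum_i b i *: nu i); split=> //.
  by exists b; split=> //=; rewrite addrK.
have GG' : G `<=` G'.
  move=> [y w] Gyw; have yS1 : (y : kspace M) \in mksub dom_closed by apply/asboolP; exists w.
  have yS2 := S12 _ yS1; split=> //; exists (fun=> 0); split=> [i|].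
    by have [_ _ -> //] := alP _ yS2; rewrite linear0.
  by rewrite /= !big1 ?subr0 // => i _; rewrite scale0r.
exists G'; split=> //; last by have /asboolP := G'dom _ mS.
split; first split.
- exact: GG'.
- move=> b y z [yS [c [cE Gc]]] [zS [d [dE Gd]]].
  have [_ alM _ _] := alP _ yS; split.
    by rewrite /=; apply: rpredD => //; rewrite -[b *: _]/(kact b _) -ra_bv; apply: hS2.1.
  exists (fun i => b * c i + d i); split=> [i|].
    rewrite linearD bvM cE dE /=; have := alM i (bv b) (bvA b); rewrite ra_bv => <-.
    by rewrite -linearD.
  have := Glin b _ _ Gc Gd; congr G; rewrite [LHS]surjective_pairing /=.
  by congr pair; rewrite scalerBr scaler_sumr addrACA -opprD -big_split; congr (_ - _);
    apply: eq_bigr => i _; rewrite scalerDl scalerA.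
- move=> w [_ [b [bE]]] /=; have b0 : forall i, b i = 0.
    by apply: al0 bE => i; rewrite linear0.
  by rewrite !big1 ?subr0 => [/Gfun //|i _|i _]; rewrite b0 scale0r.
move=> [y w] [yS [b [bE Gb]]]; split.
  have [/= pE _] := Gpsi _ Gb; rewrite /= -[w](subrK (\sum_i b i *: nu i)).
  rewrite -[y in RHS](subrK (\sum_i b i *: (t i : M))) [LHS]linearD [RHS]linearD pE; congr (_ + _).
  by rewrite !linear_sum; apply: eq_bigr => i _; rewrite !linearZ /= nuP.
by apply: tsubl_subset (hS2.2 _ yS) => z; exact: G'dom.
Qed.

Lemma hopf_lift : exists g : {linear M -> N}, forall m, p (g m) = f m.
Proof.
have g0 : good_graph psi [set 0].
  split=> [|_ ->]; first by split=> [|b _ _ -> ->|w []//]; rewrite ?scaler0 ?addr0.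
  by split=> /=; rewrite !linear0 // rpred0.
have [G m gG _ _|g [_ gP]] := zorn_graph psi_mono g0; first exact: lift_step.
by exists g => m; have [] := gP m.
Qed.

End Lift.

Lemma hopf_projective : projective M.
Proof. by move=> N P p f; exact: hopf_lift. Qed.

End Projective.
End Lifting.

(** * The converse Hopf algebra *)

Section TensorSwap.
Variables (k : fieldType) (U V : lmodType k).

Definition tswap (t : (U ⊗ V)%type) : (V ⊗ U)%type := \tsum_(u, v <- t) v ⊗ u.

Lemma tswap_lin : lin tswap. Proof. by rewrite /tswap; lin. Qed.
HB.instance Definition _ :=
  GRing.isLinear.Build k (U ⊗ V)%type (V ⊗ U)%type *:%R tswap tswap_lin.

Lemma tswap_tens u v : tswap (u ⊗ v) = v ⊗ u.
Proof. by rewrite /tswap tliftE //; lin. Qed.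

Lemma tswap_sum (X : lmodType k) (F : V -> U -> X) t : bil F ->
  tlift F (tswap t) = \tsum_(u, v <- t) F v u.
Proof.
move=> hF; rewrite tsum_tsum //.
by apply: eq_tlift => u v; rewrite tliftE.
Qed.

End TensorSwap.

Ltac lin_hook ::=
  match goal with
  | |- lin (fun x => tswap (@?f x)) => apply: (lin_comp (f := @tswap _ _ _) (g := f)); first exact: tswap_lin
  end.

Lemma tswapK (k : fieldType) (U V : lmodType k) : cancel (@tswap k U V) (@tswap k V U).
Proof.
move=> t; apply: (tsum_ext (F := fun t => tswap (tswap t)) (G := id)) t => [||u v].
- exact: (lin_comp (@tswap_lin k V U) (@tswap_lin k U V)).
- by [].
- by rewrite !tswap_tens.
Qed.

Section CoOpposite.
Variables (k : fieldType) (C : coalgType k).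

Definition cop : Type := C.
HB.instance Definition _ := GRing.Lmodule.on cop.

Let cop_comul (c : cop) : (cop ⊗ cop)%type := tswap (comul (c : C)).

Let cop_comul_lin : linear cop_comul.
Proof. by move=> a x y; rewrite /cop_comul !linearP. Qed.

Let cop_counit_scalar : scalar (@counit k C : cop -> k).
Proof. by move=> a x y; rewrite linearP. Qed.

Let cop_comulA (c : cop) : tassoc (tmap cop_comul idfun (cop_comul c)) =
  tmap idfun cop_comul (cop_comul c).
Proof.
have hc : lin cop_comul := cop_comul_lin.
rewrite /tmap /cop_comul [in RHS]tswap_sum; last by lin.
rewrite [in LHS]tswap_sum; last by lin.
rewrite /tassoc tsum_tsum; last by lin.
transitivity (\tsum_(u, v <- comul (c : C)) \tsum_(v1, v2 <- comul v) (v2 : cop) ⊗ ((v1 : cop) ⊗ (u : cop))).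
  apply: eq_tlift => u v; rewrite tliftE; last by lin.
  by rewrite /cop_comul tswap_sum //; lin.
rewrite -(comulA_sum (F := fun u v1 v2 => (v2 : cop) ⊗ ((v1 : cop) ⊗ (u : cop)))); last by split=> *; lin.
apply: eq_tlift => u v; rewrite -[RHS]/((v : cop) ⊗ cop_comul u) /cop_comul /tswap.
by rewrite (lin_tsum (f := fun t => v ⊗ t)); last by lin.
Qed.

Let cop_counitl (c : cop) : tlift (fun x y => counit (x : C) *: y) (cop_comul c) = c.
Proof.
have hb : bil (fun x y : cop => counit (x : C) *: y) by lin.
by rewrite /cop_comul tswap_sum // -[RHS](counitr (c : C)).
Qed.

Let cop_counitr (c : cop) : tlift (fun x y => counit (y : C) *: x) (cop_comul c) = c.
Proof.
have hb : bil (fun x y : cop => counit (y : C) *: x) by lin.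
by rewrite /cop_comul tswap_sum // -[RHS](counitl (c : C)).
Qed.

HB.instance Definition _ := Lmodule_isCoalgebra.Build k cop
  cop_comul_lin cop_counit_scalar cop_comulA cop_counitl cop_counitr.

Lemma cop_comulE (c : cop) : comul c = tswap (comul (c : C)).
Proof. by []. Qed.

Lemma cop_counitE (c : cop) : counit c = counit (c : C).
Proof. by []. Qed.

Lemma lcomod_cop (M : lmodType k) (rho : {linear M -> (M ⊗ C)%type}) : is_rcomod rho ->
  is_lcomod (C := cop) (fun m => tswap (rho m) : (cop ⊗ M)%type).
Proof.
move=> hr; split=> m.
  transitivity (\tsum_(x, c <- rho m) \tsum_(c1, c2 <- @comul k C c) (c2 : cop) ⊗ ((c1 : cop) ⊗ x)).
    rewrite /tmap tswap_sum; last by lin.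
    rewrite /tassoc tsum_tsum; last by lin.
    apply: eq_tlift => x c; rewrite tliftE; last by lin.
    by rewrite cop_comulE tswap_sum //; lin.
  rewrite -(rcomodA_sum (F := fun (x : M) (c1 c2 : C) => (c2 : cop) ⊗ ((c1 : cop) ⊗ x))) //; last first.
    by split=> *; lin.
  rewrite /tmap tswap_sum; last by lin.
  apply: eq_tlift => x c; rewrite /tswap.
  by rewrite [RHS](lin_tsum (f := fun t => (c : cop) ⊗ t)); last by lin.
rewrite tswap_sum; last by lin.
exact: hr.2.
Qed.

Lemma rcomod_cop (M : lmodType k) (lam : {linear M -> (cop ⊗ M)%type}) :
  is_lcomod (C := cop) lam ->
  is_rcomod (C := C) (fun m => tswap (lam m) : (M ⊗ C)%type).
Proof.
move=> hr; split=> m.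
  transitivity (\tsum_(c, x <- lam m) \tsum_(c', x' <- lam x) (x' ⊗ ((c' : C) ⊗ (c : C)))).
    rewrite /tmap tswap_sum; last by lin.
    rewrite /tassoc tsum_tsum; last by lin.
    apply: eq_tlift => c x; rewrite tliftE; last by lin.
    by rewrite tswap_sum //; lin.
  rewrite -(lcomodA_sum (C := cop) (F := fun c c' x => (x ⊗ ((c' : C) ⊗ (c : C))))) //; last first.
    by split=> *; lin.
  rewrite /tmap tswap_sum; last by lin.
  apply: eq_tlift => c x; rewrite (cop_comulE c) tswap_sum; last by lin.
  by rewrite /idfun -[X in _ = _ ⊗ X]tsum_id [RHS](lin_tsum (f := fun t => x ⊗ t)); last by lin.
rewrite tswap_sum; last by lin.
exact: hr.2.
Qed.

End CoOpposite.

Section ConverseHopf.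
Variables (k : fieldType) (H : hopfType k).
HB.instance Definition _ := Lmodule_isCoalgebra.Build k H^c
  (@comul_linear_subproof k H) (@counit_scalar_subproof k H) (@comulA_subproof k H)
  (@counitl_subproof k H) (@counitr_subproof k H).

Variable T : H -> H.
Hypotheses (ST : cancel (@antipode k H) T) (TS : cancel T (@antipode k H)).

Lemma inv_antipode_lin : lin T.
Proof. by move=> a x y; apply: (can_inj ST); rewrite TS [RHS]linearP /= !TS. Qed.

Let hT := inv_antipode_lin.

Lemma inv_antipodeM g h : T (g * h) = T h * T g.
Proof. by apply: (can_inj ST); rewrite antipodeM !TS. Qed.

(** [S] reverses products, so it turns [y S^{-1}(x)] into [x S(y)]. This is the antipode axiom of
    [H^c] with antipode [S^{-1}]. *)
Lemma inv_antipode_suml (X : lmodType k) (f : H -> X) h : lin f ->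
  \tsum_(x, y <- comul h) f (y * T x) = counit h *: f 1.
Proof.
move=> hf; rewrite -(linZ _ hf) -(lin_tsum (fun x y => y * T x) _ hf); congr f.
apply: (can_inj ST); rewrite lin_tsum; last by lin.
rewrite linearZ /= antipode1 -antipoder; apply: eq_tlift => x y.
by rewrite antipodeM TS.
Qed.

Lemma inv_antipode_sumr (X : lmodType k) (f : H -> X) h : lin f ->
  \tsum_(x, y <- comul h) f (T y * x) = counit h *: f 1.
Proof.
move=> hf; rewrite -(linZ _ hf) -(lin_tsum (fun x y => T y * x) _ hf); congr f.
apply: (can_inj ST); rewrite lin_tsum; last by lin.
rewrite linearZ /= antipode1 -antipodel; apply: eq_tlift => x y.
by rewrite antipodeM TS.
Qed.

Lemma comul_inv_antipode_sum (X : lmodType k) (F : H -> H -> X) h : bil F ->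
  tlift F (comul (T h)) = \tsum_(x, y <- comul h) F (T y) (T x).
Proof.
move=> hF; rewrite -{2}[h]TS comul_antipode_sum; last by lin.
by apply: eq_tlift => x y; rewrite !ST.
Qed.

Let conv_comul1 : comul (1 : H^c) = 1 ⊗ 1. Proof. exact: (comul1 H). Qed.

Let conv_comulM (x y : H^c) : comul (x * y) = tact *%R *%R (comul x) (comul y).
Proof. by apply: etrans (comulM (y : H) (x : H)) _; exact: tsum_exchange. Qed.

Let conv_counitM (x y : H^c) : counit (x * y) = counit x * counit y.
Proof. by rewrite [RHS]mulrC; exact: (counitM (y : H) (x : H)). Qed.

Let conv_antipodel (x : H^c) : tlift (fun x1 x2 : H^c => (T x1 : H^c) * x2) (comul x) = (counit x)%:A.
Proof. exact: (inv_antipode_suml x (@lin_id k H)). Qed.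

Let conv_antipoder (x : H^c) : tlift (fun x1 x2 : H^c => x1 * (T x2 : H^c)) (comul x) = (counit x)%:A.
Proof. exact: (inv_antipode_sumr x (@lin_id k H)). Qed.

Definition converse_hopf : hopfType k :=
  HB.pack H^c (isHopf.Build k H^c conv_comul1 conv_comulM (@counit1 k H) conv_counitM
    inv_antipode_lin conv_antipodel conv_antipoder).

End ConverseHopf.

(** * Right modules *)

Lemma lproj_tensl (k : fieldType) (U V : lmodType k) (S : submodClosed U) (t : (U ⊗ V)%type) :
  t \in tsubl S -> \tsum_(u, v <- t) lproj S u ⊗ v = 0.
Proof.
move=> tS; have hp : lin (lproj S) := @lproj_is_linear k U S.
rewrite (tsubl_eq (S := S) (G := fun _ _ => 0) _ _ tS).
- by rewrite /tlift big1.
- by lin.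
- by split=> ? c u v; rewrite scaler0 addr0.
move=> u v uS; suff -> : lproj S u = 0 by rewrite tens0l.
by rewrite -(linear0 (@lproj k U S)); apply/eqP; rewrite lproj_eq subr0.
Qed.

Section Sections.
Variables (k : fieldType) (H : hopfType k) (A : rcSubalg H).

(* Objects of [M_A^H] are projective, in terms of unbundled actions. *)
Definition hopf_sections : Prop :=
  forall (X : lmodType k) (ra : X -> H -> X) (rho : {linear X -> (X ⊗ H)%type}),
    is_right_hopf_mod A ra rho ->
  forall (T : lmodType k) (rt : T -> H -> T) (p : {linear T -> X}),
    bil rt -> (forall t, rt t 1 = t) ->
    (forall t a b, a \in rcs_pred A -> b \in rcs_pred A -> rt (rt t a) b = rt t (a * b)) ->
    (forall t a, a \in rcs_pred A -> p (rt t a) = ra (p t) a) ->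
    (forall x, exists t, p t = x) ->
  exists g : {linear X -> T},
    (forall x a, a \in rcs_pred A -> g (ra x a) = rt (g x) a) /\ forall x, p (g x) = x.

Lemma subalg_projection : exists w : {linear H -> H},
  (forall h, w h \in rcs_pred A) /\ forall a, a \in rcs_pred A -> w a = a.
Proof.
have [w wK] := lsub_retraction (A : submodClosed H).
have vw_lin : lin (fun h => lsub_val (w h)) := lin_comp (@lsub_val_linear k H A) (linE w).
exists (mklin vw_lin); split=> [h|a aA] /=; first exact: lsub_valP.
by rewrite -[a in LHS]/(lsub_val (Sub a aA)) wK.
Qed.

(** The quotient of [Z ⊗ H] by [S] is an object of [M_A^H], so the projection [p] onto it has an
    [A]-linear section [g], and [e = g p]. *)
Lemma sections_split : hopf_sections -> free_subobjects_split A.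
Proof.
move=> sec Z S SA Srho; have [w [wA wid]] := subalg_projection.
pose p : {linear (Z ⊗ H)%type -> lquot S} := @lproj k _ S.
have p_surj x : exists t, p t = x by exists (repr x); exact: lproj_repr.
have pS t : t \in S -> p t = 0.
  by move=> tS; rewrite -(linear0 p); apply/eqP; rewrite lproj_eq subr0.
have [sp spK] := linear_section p_surj.
have spS t : sp (p t) - t \in S by rewrite -lproj_eq -[lproj S _]/(p _) spK.
have hra := free_ract_bil H Z; have hrho := free_rho_lin (H := H) (Z := Z).
have hraM (t : (Z ⊗ H)%type) a b : free_ract (free_ract t a) b = free_ract t (a * b).
  rewrite /free_ract tsum_tsum; last by lin.
  by apply: eq_tlift => z h; rewrite tliftE ?mulrA //; lin.
have hra1 (t : (Z ⊗ H)%type) : free_ract t 1 = t.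
  by rewrite /free_ract -[RHS]tsum_id; apply: eq_tlift => z h; rewrite mulr1.
(* Actions are bilinear on all of [H], while [S] is stable under [A] only; hence [h] is first
   projected to [A] by [w]. *)
pose qa x h := p (free_ract (sp x) (w h)).
have qa_bil : bil qa by rewrite /qa; lin.
have qaE t a : a \in rcs_pred A -> qa (p t) a = p (free_ract t a).
  move=> aA; rewrite /qa wid //; apply/eqP; rewrite -subr_eq0 -linearB -(linB (hra.1 a)).
  by apply/eqP/pS; exact: SA (spS t) aA.
have qr_lin : lin (fun x => \tsum_(t, h <- free_rho (sp x)) p t ⊗ h).
  by apply: lin_tliftr; [lin | apply: lin_comp hrho _; lin].
pose qr := mklin qr_lin.
have qrE t : qr (p t) = \tsum_(u, h <- free_rho t) p u ⊗ h.
  have hl : lin (tlift (fun u (h : H) => p u ⊗ h)) by lin.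
  apply/eqP; rewrite -subr_eq0 /= -(linB hl) -(linB hrho).
  by apply/eqP; apply: lproj_tensl; exact: Srho (spS t).
have qr_tens z h : qr (p (z ⊗ h)) = \tsum_(h1, h2 <- comul h) p (z ⊗ h1) ⊗ h2.
  rewrite qrE free_rho_tens tsum_tsum; last by lin.
  by apply: eq_tlift => h1 h2; rewrite tliftE //; lin.
have ext (V : lmodType k) (f g : lquot S -> V) : lin f -> lin g ->
    (forall z h, f (p (z ⊗ h)) = g (p (z ⊗ h))) -> f =1 g.
  move=> hf hg fg x; have [t <-] := p_surj x.
  apply: (tsum_ext (F := fun t => f (p t)) (G := fun t => g (p t))) t; [by lin | by lin | exact: fg].
have qC : is_rcomod qr.
  split; apply: ext.
  - by rewrite /tassoc /tmap; lin.
  - by rewrite /tmap; lin.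
  - move=> z h; rewrite qr_tens /tmap tsum_tsum; last by lin.
    rewrite /tassoc tsum_tsum; last by lin.
    rewrite [RHS]tsum_tsum; last by lin.
    transitivity (\tsum_(h1, h2 <- comul h) \tsum_(x, y <- comul h1) p (z ⊗ x) ⊗ (y ⊗ h2)).
      apply: eq_tlift => h1 h2; rewrite (tliftE (F := fun u v => qr u ⊗ _)); last by lin.
      rewrite tliftE; last by lin.
      by rewrite qr_tens tsum_tsum; [apply: eq_tlift => x y; rewrite tliftE //; lin | lin].
    rewrite (comulA_sum (F := fun x y h2 => p (z ⊗ x) ⊗ (y ⊗ h2))); last by split=> *; lin.
    apply: eq_tlift => h1 h2; rewrite tliftE; last by lin.
    by rewrite -[in RHS](tsum_id (comul h2)) [RHS](lin_tsum (f := fun t => p (z ⊗ h1) ⊗ t)); last by lin.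
  - by lin.
  - by lin.
  - move=> z h; rewrite qr_tens tsum_tsum; last by lin.
    under eq_tlift => h1 h2 do (rewrite tliftE; last by lin).
    by rewrite (counitr_sum (f := fun h => p (z ⊗ h))) //; lin.
have hQ : is_right_hopf_mod A qa qr.
  split=> // [x|x a b aA bA|x a aA].
  - by rewrite /qa wid ?rpred1 // hra1 spK.
  - by have [t <-] := p_surj x; rewrite !qaE ?rpredM // hraM.
  pose L x := \tsum_(a1, a2 <- comul a) \tsum_(x0, x1 <- qr x) qa x0 a1 ⊗ (x1 * a2).
  apply: (ext _ (fun x => qr (qa x a)) L) x; [by lin | by rewrite /L; lin |].
  move=> z h; rewrite qaE // free_ract_tens qr_tens comulM_sum; last by lin.
  rewrite /L qr_tens; under [RHS]eq_tlift => a1 a2 do (rewrite tsum_tsum; last by lin).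
  rewrite [RHS]tsum_exchange; apply: eq_tlift => h1 h2.
  apply: (coideal_sum_eq (A := A)) => //; [by lin|by lin|move=> x y xA].
  by rewrite tliftE ?qaE ?free_ract_tens //; lin.
have [|g [gA gK]] := sec _ _ _ hQ _ (@free_ract k H Z) p hra hra1 (fun t a b _ _ => hraM t a b) _ p_surj.
  by move=> t a aA; rewrite qaE.
have e_lin : lin (fun t => g (p t)) by lin.
exists (mklin e_lin); split=> [t a aA|t tS|t] /=.
- by rewrite -qaE // gA.
- by rewrite pS // linear0.
- by rewrite -lproj_eq -[lproj S (g _)]/(p _) gK.
Qed.

End Sections.

(** * Passage between bundled and unbundled modules and comodules *)

Record alg_action (k : fieldType) (B : algType k) (V : lmodType k) := AlgAction {
  aact : B -> V -> V;
  aact_bil : bil aact;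
  aact1 : forall v, aact 1 v = v;
  aactM : forall b c v, aact (b * c) v = aact b (aact c v)
}.

Section ActionModule.
Variables (k : fieldType) (B : algType k) (V : lmodType k).

Definition actmod (m : alg_action B V) : Type := V.

Variable m : alg_action B V.
HB.instance Definition _ := GRing.Zmodule.on (actmod m).

Let scaleA b c (v : actmod m) : aact m b (aact m c v) = aact m (b * c) v.
Proof. by rewrite aactM. Qed.
Let scale1 : left_id 1 (aact m : B -> (actmod m) -> (actmod m)). Proof. exact: aact1. Qed.
Let scaleDr : right_distributive (aact m : B -> (actmod m) -> (actmod m)) +%R.
Proof. by move=> b u v; exact: (linD ((aact_bil m).2 b)). Qed.
Let scaleDl v : {morph (fun b => aact m b v : actmod m) : b c / b + c}.
Proof. by move=> b c; exact: (linD ((aact_bil m).1 v)). Qed.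

HB.instance Definition _ :=
  GRing.Zmodule_isLmodule.Build B (actmod m) scaleA scale1 scaleDr scaleDl.

Lemma kspace_actmodE (a : k) (v : V) : a *: (v : kspace (actmod m)) = (a *: v : V).
Proof.
rewrite -[LHS]/(aact m a%:A v) (linZ _ ((aact_bil m).1 v)).
by rewrite aact1.
Qed.

(** Identity maps: the scalar action of [kspace (actmod m)] goes through the unit of [B] and agrees
    with that of [V] only propositionally, by [kspace_actmodE]. *)
Definition to_kspace (v : V) : kspace (actmod m) := v.
Definition of_kspace (v : kspace (actmod m)) : V := v.

Lemma to_kspace_linear : linear to_kspace.
Proof. by move=> a x y; rewrite [a *: to_kspace x]kspace_actmodE. Qed.
Lemma of_kspace_linear : linear of_kspace.
Proof. by move=> a x y; rewrite /of_kspace [a *: x]kspace_actmodE. Qed.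
HB.instance Definition _ := GRing.isLinear.Build k V (kspace (actmod m)) *:%R to_kspace to_kspace_linear.
HB.instance Definition _ := GRing.isLinear.Build k (kspace (actmod m)) V *:%R of_kspace of_kspace_linear.

End ActionModule.

Lemma projective_section (k : fieldType) (B : algType k) (V W : lmodType k)
    (mV : alg_action B V) (mW : alg_action B W) (p : {linear W -> V}) :
  projective (actmod mV) -> (forall b w, p (aact mW b w) = aact mV b (p w)) ->
  (forall v, exists w, p w = v) ->
  exists g : {linear V -> W}, (forall b v, g (aact mV b v) = aact mW b (g v)) /\
    forall v, p (g v) = v.
Proof.
move=> projV pB p_surj.
have p_lin : linear (p : actmod mW -> actmod mV).
  by move=> b x y; rewrite linearD; congr (_ + _); exact: pB.
have id_lin : linear (id : actmod mV -> actmod mV) by [].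
have [|g gP] := projV _ _ (mklinear p_lin) (mklinear id_lin); first exact: p_surj.
have g_lin : lin (g : V -> W).
  move=> a x y; rewrite -[a *: x](kspace_actmodE mV) -[a *: g x](kspace_actmodE mW).
  exact: (linearP g).
by exists (mklin g_lin); split=> [b v|v] /=; [exact: (linearZZ g b (v : actmod mV)) | exact: gP].
Qed.

Section Transport.
Variables (k : fieldType) (C : coalgType k) (X Y : lmodType k).
Variables (to : {linear X -> Y}) (fr : {linear Y -> X}).
Hypotheses (frK : cancel fr to) (toK : cancel to fr).

Lemma transport_rcomod (rho : {linear X -> (X ⊗ C)%type}) : is_rcomod rho ->
  exists co : {linear Y -> (Y ⊗ C)%type},
    (forall x, co (to x) = \tsum_(y, c <- rho x) to y ⊗ c) /\ is_rcomod co.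
Proof.
move=> rhoC; have co_lin : lin (fun m => \tsum_(x, c <- rho (fr m)) to x ⊗ c) by lin.
have coE x : mklin co_lin (to x) = \tsum_(y, c <- rho x) to y ⊗ c by rewrite /= toK.
exists (mklin co_lin); split=> //; move: (mklin co_lin) coE => co coE.
split=> m; rewrite -[m]frK coE; move: (fr m) => {m} x.
  rewrite /tmap [RHS]tsum_tsum; last by lin.
  under [RHS]eq_tlift => y c do (rewrite tliftE; last by lin).
  rewrite [in LHS]tsum_tsum; last by lin.
  transitivity (\tsum_(y, c <- rho x) \tsum_(z, d <- rho y) to z ⊗ (d ⊗ c)).
    rewrite /tassoc tsum_tsum; last by lin.
    apply: eq_tlift => y c; rewrite tliftE; last by lin.
    rewrite tliftE; last by lin.
    by rewrite coE tsum_tsum; [apply: eq_tlift => z d; rewrite tliftE //; lin | lin].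
  rewrite (rcomodA_sum (F := fun z d c => to z ⊗ (d ⊗ c))) //; last by split=> *; lin.
  apply: eq_tlift => y c; rewrite -[in RHS](tsum_id (comul c)).
  by rewrite [RHS](lin_tsum (f := fun t => to y ⊗ t)); last by lin.
rewrite tsum_tsum; last by lin.
under eq_tlift => y c do (rewrite tliftE; last by lin).
by rewrite (rcomod_counit_sum (f := to)) //; lin.
Qed.

Lemma transport_lcomod (lam : {linear X -> (C ⊗ X)%type}) : is_lcomod lam ->
  exists co : {linear Y -> (C ⊗ Y)%type},
    (forall x, co (to x) = \tsum_(c, y <- lam x) c ⊗ to y) /\ is_lcomod co.
Proof.
move=> lamC; have co_lin : lin (fun m => \tsum_(c, x <- lam (fr m)) c ⊗ to x) by lin.
have coE x : mklin co_lin (to x) = \tsum_(c, y <- lam x) c ⊗ to y by rewrite /= toK.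
exists (mklin co_lin); split=> //; move: (mklin co_lin) coE => co coE.
split=> m; rewrite -[m]frK coE; move: (fr m) => {m} x.
  rewrite /tmap [RHS]tsum_tsum; last by lin.
  under [RHS]eq_tlift => c y do (rewrite tliftE; last by lin).
  rewrite [in LHS]tsum_tsum; last by lin.
  rewrite /tassoc tsum_tsum; last by lin.
  transitivity (\tsum_(c, y <- lam x) \tsum_(c1, c2 <- comul c) c1 ⊗ (c2 ⊗ to y)).
    by apply: eq_tlift => c y; rewrite tliftE ?tliftE //; lin.
  rewrite (lcomodA_sum (F := fun c1 c2 y => c1 ⊗ (c2 ⊗ to y))) //; last by split=> *; lin.
  by apply: eq_tlift => c y; rewrite coE [RHS](lin_tsum (f := fun t => c ⊗ t)) //; lin.
rewrite tsum_tsum; last by lin.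
under eq_tlift => c y do (rewrite tliftE; last by lin).
by rewrite (lcomod_counit_sum (f := to)) //; lin.
Qed.

End Transport.

Section Bundling.
Variables (k : fieldType) (H : hopfType k).

Section Subalgebra.
Variable A : rcSubalg H.

Lemma rcs_comul_sum (X : lmodType k) (F : H -> H -> X) (a : rcs_alg A) : bil F ->
  tlift F (comul (rcs_val a)) = \tsum_(x, y <- rcs_comul a) F (rcs_val x) y.
Proof.
move=> hF; rewrite -rcs_comulE tsum_tsum //.
by apply: eq_tlift => x y; rewrite tliftE.
Qed.

Lemma rcs_retraction : exists w : {linear H -> rcs_alg A}, forall a, w (rcs_val a) = a.
Proof.
have [x x0|w wE] := linear_extension (i := @rcs_val k H A) (f := idfun); last by exists w.
by apply: val_inj; rewrite [LHS]x0 -[RHS]/(rcs_val 0) linear0.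
Qed.

Lemma rcs_valE a (aA : a \in rcs_pred A) : exists b : rcs_alg A, rcs_val b = a.
Proof. by exists (Sub a aA). Qed.

Lemma rcs_val1 : rcs_val (1 : rcs_alg A) = 1. Proof. exact: rmorph1. Qed.

Lemma rcs_valM (a b : rcs_alg A) : rcs_val (a * b) = rcs_val a * rcs_val b.
Proof. exact: rmorphM. Qed.

Section RightModules.
Variables (X : lmodType k) (ra : X -> H -> X).
Hypotheses (ra_bil : bil ra) (ra1 : forall x, ra x 1 = x)
  (raM : forall x a b, a \in rcs_pred A -> b \in rcs_pred A -> ra (ra x a) b = ra x (a * b)).

Lemma right_action_bil : bil (fun (a : (rcs_alg A)^c) (x : X) => ra x (rcs_val (a : rcs_alg A))).
Proof.
split=> [x a b c|a]; last exact: ra_bil.1.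
by rewrite -(ra_bil.2 x) -linearP.
Qed.

Lemma right_action1 x : ra x (rcs_val (1 : rcs_alg A)) = x.
Proof. by rewrite rcs_val1 ra1. Qed.

Lemma right_actionM (a b : (rcs_alg A)^c) x :
  ra x (rcs_val (a * b : (rcs_alg A)^c)) = ra (ra x (rcs_val (b : rcs_alg A))) (rcs_val (a : rcs_alg A)).
Proof.
rewrite -[a * b]/((b : rcs_alg A) * (a : rcs_alg A)) rcs_valM raM //; exact: valP.
Qed.

Definition right_action : alg_action (rcs_alg A)^c X :=
  AlgAction right_action_bil right_action1 right_actionM.

End RightModules.

Lemma MAH_sections : (forall M : hopfmod_MAH A, projective M) -> hopf_sections A.
Proof.
move=> projA X ra rho hX T rt p rt_bil rt1 rtM p_ra p_surj.
have [ra_bil ra1 raM rhoC rho_ra] := hX.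
pose mX := right_action ra_bil ra1 raM; pose mT := right_action rt_bil rt1 rtM.
pose to : {linear X -> kspace (actmod mX)} := to_kspace mX.
pose fr : {linear kspace (actmod mX) -> X} := @of_kspace _ _ _ mX.
have [co [coE comod]] := transport_rcomod (to := to) (fr := fr) (fun=> erefl) (fun=> erefl) rhoC.
have compat (m : kspace (actmod mX)) (a : rcs_alg A) :
    co (ract m a) = tact (@ract k H A _) (fun x y => x * y) (co m) (rcs_comul a).
  have hract : bil (@ract k H A (actmod mX)) by apply: bilP; exact: ract_bilinear.
  rewrite -[m]/(to (fr m)); move: (fr m) => {m} x.
  rewrite -[ract _ _]/(to (ra x (rcs_val a))) !coE rho_ra; last exact: valP.
  rewrite rcs_comul_sum; last by lin.
  rewrite /tact /tmap [RHS]tsum_tsum; last by lin.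
  under [RHS]eq_tlift => y h do (rewrite tliftE; last by lin).
  rewrite [LHS]tsum_tsum; last by lin.
  rewrite [RHS]tsum_exchange; apply: eq_tlift => a1 a2; rewrite [LHS]tsum_tsum; last by lin.
  by apply: eq_tlift => y h; rewrite tliftE //; lin.
have [|g [gB gK]] := projective_section (mV := mX) (mW := mT) (p := p)
    (projA (HopfMod_MAH comod compat)) _ p_surj.
  by move=> b t; rewrite /= p_ra //; exact: valP.
exists g; split=> // x a /rcs_valE[b <-]; exact: gB.
Qed.

Section Unbundling.
Variables (C : coalgType k) (pi : {linear H -> C}) (act : H -> C -> C).
Hypothesis qC : is_quotient pi act.
Hypothesis coinvA : forall a, a \in rcs_pred A <-> \tsum_(x, y <- comul a) pi x ⊗ y = pi 1 ⊗ a.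
Hypothesis splitC : coactions_split act.

Lemma MAH_projective (M : hopfmod_MAH A) : projective M.
Proof.
have [w wK] := rcs_retraction.
have hract : bil (@ract k H A M) by apply: bilP; exact: ract_bilinear.
pose ra (m : kspace M) (h : H) : kspace M := ract m (w h).
have ra_bil : bil ra by rewrite /ra; lin.
have [bv bvE] : exists bv : {linear (rcs_alg A)^c -> H}, forall a, bv a = rcs_val (a : rcs_alg A).
  have bv_lin : lin (fun a : (rcs_alg A)^c => rcs_val (a : rcs_alg A)) := linE (@rcs_val k H A).
  by exists (mklin bv_lin).
have raE m (a : rcs_alg A) : ra m (rcs_val a) = ract m a by rewrite /ra wK.
have hM : is_right_hopf_mod A ra (MAH_coact M).
  split=> // [m|m _ _ /rcs_valE[a <-] /rcs_valE[b <-]||m _ /rcs_valE[a <-]].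
  - by rewrite -rcs_val1 raE ract1.
  - by rewrite -rcs_valM !raE ractA.
  - exact: MAH_comod.
  rewrite raE MAH_compat [RHS]rcs_comul_sum; last by lin.
  rewrite [RHS]tsum_exchange /tact /tmap; apply: eq_tlift => x y.
  by apply: eq_tlift => a1 a2; rewrite raE.
apply: (hopf_projective qC coinvA splitC hM (bv := bv)) => [b|a /rcs_valE[b <-]|b c|b c|b m].
- by rewrite bvE; exact: valP.
- by exists b; rewrite bvE.
- by rewrite !bvE; exact: val_inj.
- by rewrite !bvE -rcs_valM.
- by rewrite bvE raE.
Qed.

End Unbundling.
End Subalgebra.

Section Factor.
Variable C : factorCoalg H.

Lemma factor_quotient : is_quotient (@fproj k H C) (@factor_act k H C).
Proof.
split=> [c|h|h|h x].
- by exists (frepr c); exact: freprK.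
- exact: factor_comulE.
- exact: factor_counitE.
- exact: factor_actE.
Qed.

Lemma fproj0 x : fproj C x = 0 <-> x \in fc_ker C.
Proof. by rewrite -(linear0 (fproj C)) fproj_eq subr0. Qed.

Lemma coinv_sum a : a \in rcs_pred (takeuchi_subalg C) <->
  \tsum_(x, y <- comul a) fproj C x ⊗ y = fproj C 1 ⊗ a.
Proof. by split=> /coinvP. Qed.

Lemma CHM_hopf_mod (M : hopfmod_CHM C) :
  is_hopf_mod (@factor_act k H C) (fun h (m : kspace M) => kact h m) (CHM_coact M).
Proof.
split; [|exact: CHM_comod|exact: CHM_compat].
split=> [|m|g h m]; first by apply: bilP; exact: kact_bilinear.
- exact: (@scale1r H M).
- exact/esym/(@scalerA H M).
Qed.

End Factor.

Section Cofree.
Variables (C : coalgType k) (V : lmodType k).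

Let cofree_fun (t : (C ⊗ V)%type) : (C ⊗ (C ⊗ V))%type :=
  tassoc (tmap (@comul k C) idfun t).

Let cofree_lin : lin cofree_fun. Proof. by rewrite /cofree_fun /tassoc /tmap; lin. Qed.

Definition cofree_coact : {linear (C ⊗ V)%type -> (C ⊗ (C ⊗ V))%type} := mklin cofree_lin.

Lemma cofree_coact_tens c v : cofree_coact (c ⊗ v) = \tsum_(c1, c2 <- comul c) c1 ⊗ (c2 ⊗ v).
Proof.
rewrite /= /cofree_fun /tmap tliftE; last by lin.
by rewrite /tassoc tliftE //; lin.
Qed.

Lemma cofree_comod : is_lcomod cofree_coact.
Proof.
split.
  apply: tsum_ext => [||c v]; [by rewrite /tassoc /tmap; lin|by rewrite /tmap; lin|].
  rewrite cofree_coact_tens /tmap [RHS]tsum_tsum; last by lin.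
  rewrite [in LHS]tsum_tsum; last by lin.
  rewrite /tassoc tsum_tsum; last by lin.
  transitivity (\tsum_(c1, c2 <- comul c) \tsum_(x, y <- comul c1) x ⊗ (y ⊗ (c2 ⊗ v))).
    by apply: eq_tlift => c1 c2; rewrite tliftE ?tliftE //; lin.
  rewrite (comulA_sum (F := fun x y c2 => x ⊗ (y ⊗ (c2 ⊗ v)))); last by split=> *; lin.
  apply: eq_tlift => c1 c2; rewrite tliftE ?cofree_coact_tens; last by lin.
  by rewrite [RHS](lin_tsum (f := fun t => c1 ⊗ t)) //; lin.
apply: tsum_ext => [||c v]; [by lin|by lin|].
rewrite cofree_coact_tens tsum_tsum; last by lin.
under eq_tlift => c1 c2 do (rewrite tliftE; last by lin).
by rewrite (counitl_sum (f := fun c => c ⊗ v)) //; lin.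
Qed.

Lemma lcomod_counit_inj (lam : V -> (C ⊗ V)%type) : is_lcomod lam -> injective lam.
Proof. by move=> [_ lam1] x y /(congr1 (tlift (fun c x => counit c *: x))); rewrite !lam1. Qed.

Lemma transport_retraction (M : lmodType k) (to : {linear M -> V}) (fr : {linear V -> M})
    (lam : {linear M -> (C ⊗ M)%type}) (co : {linear V -> (C ⊗ V)%type})
    (g : {linear (C ⊗ V)%type -> V}) :
  cancel fr to -> cancel to fr ->
  (forall x, co (to x) = \tsum_(c, y <- lam x) c ⊗ to y) ->
  (forall v, g (co v) = v) -> (forall t, co (g t) = tmap idfun g (cofree_coact t)) ->
  exists r : {linear (C ⊗ M)%type -> M},
    (forall m, r (lam m) = m) /\
    forall c m, lam (r (c ⊗ m)) = \tsum_(c1, c2 <- comul c) c1 ⊗ r (c2 ⊗ m).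
Proof.
move=> frK toK coE gK gC.
have r_lin : lin (fun t => fr (g (\tsum_(c, m <- t) c ⊗ to m))) by lin.
have rE c m : mklin r_lin (c ⊗ m) = fr (g (c ⊗ to m)) by rewrite /= tliftE //; lin.
exists (mklin r_lin); split=> [m|c m]; first by rewrite /= -coE gK toK.
have lamE x : lam (fr x) = \tsum_(c, y <- co x) c ⊗ fr y.
  rewrite -[x in RHS]frK coE tsum_tsum; last by lin.
  by rewrite -[LHS]tsum_id; apply: eq_tlift => c' y; rewrite tliftE ?toK //; lin.
rewrite rE lamE gC cofree_coact_tens /tmap [in LHS]tsum_tsum; last by lin.
rewrite tsum_tsum; last by lin.
by apply: eq_tlift => c1 c2; rewrite !tliftE ?rE //; lin.
Qed.

End Cofree.

Section CHMSplit.
Variable C : factorCoalg H.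

(** The coaction is an injective colinear map from [M] to the cofree comodule [C ⊗ M]. Extending the
    identity of [M] along it gives the retraction. *)
Lemma CHM_split : (forall M : hopfmod_CHM C, lcomod_injective (CHM_lcomod M)) ->
  coactions_split (@factor_act k H C).
Proof.
move=> injC M ha lam [[ha_bil ha1 haM] lamC lam_ha].
pose mM := AlgAction ha_bil ha1 haM.
pose to : {linear M -> kspace (actmod mM)} := to_kspace mM.
pose fr : {linear kspace (actmod mM) -> M} := @of_kspace _ _ _ mM.
have [co [coE comod]] := transport_lcomod (to := to) (fr := fr) (fun=> erefl) (fun=> erefl) lamC.
have compat (h : H) (m : kspace (actmod mM)) : co (kact h m) =
    tact (fun h c => factor_act h c) (fun h m => kact h m) (comul h) (co m).
  have hk : bil (fun h (m : kspace (actmod mM)) => kact h m) by apply: bilP; exact: kact_bilinear.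
  have hact := act_bil (factor_quotient C).
  rewrite -[m]/(to (fr m)); move: (fr m) => {m} x.
  rewrite -[kact _ _]/(to (ha h x)) !coE lam_ha /diag_act /tact /tmap.
  rewrite tsum_tsum; last by lin.
  apply: eq_tlift => h1 h2; rewrite tsum_tsum; last by lin.
  rewrite [RHS]tsum_tsum; last by lin.
  by apply: eq_tlift => c y; rewrite !tliftE //; lin.
have [||//|g [gC gK]] := injC (HopfMod_CHM comod compat) (LComod comod)
  (LComod (cofree_comod (factor C) (kspace (actmod mM)))) co idfun.
- by move=> m; exact: comod.1.
- by move=> m; rewrite /= /tmap tsum_id.
- exact: lcomod_counit_inj comod.
exact: (transport_retraction (to := to) (fr := fr) (fun=> erefl) (fun=> erefl) coE gK gC).
Qed.

End CHMSplit.
End Bundling.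

Section Coinvariants.
Variables (k : fieldType) (H : hopfType k) (A : rcSubalg H) (C : coalgType k).
Variables (pi : {linear H -> C}) (act : H -> C -> C).
Hypothesis qC : is_quotient pi act.
Hypothesis ker_pi : forall x, pi x = 0 <-> x \in HAplus A.
Hypothesis secA : hopf_sections A.

Lemma coinv_subalg_iff a :
  a \in rcs_pred A <-> \tsum_(x, y <- comul a) pi x ⊗ y = pi 1 ⊗ a.
Proof.
split=> [aA|]; last first.
  have [s sK] := linear_section (quot_surj qC).
  exact: (coinv_sub_subalg ker_pi sK (sections_split secA)).
rewrite (coideal_sum_eq (A := A) (G := fun x y => pi 1 ⊗ (counit x *: y))) //.
- rewrite -[RHS](counitl_sum (f := fun y => pi 1 ⊗ y)); last by lin.
  by apply: eq_tlift => x y; rewrite tensZr.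
- by lin.
- by lin.
- by move=> x y xA; rewrite -[x]mul1r (quot_mulA ker_pi) // mul1r tensZl tensZr.
Qed.

End Coinvariants.

Section RightModulesOverSubalgebra.
Variables (k : fieldType) (H : hopfType k).

Lemma takeuchi_factor_injective (A : rcSubalg H) : hopf_sections A ->
  forall M : hopfmod_CHM (takeuchi_factor A), lcomod_injective (CHM_lcomod M).
Proof.
move=> secA M N P i f; pose C := takeuchi_factor A.
apply: (hopf_mod_extension (factor_quotient C) (fproj0 C) (sections_split secA) (CHM_hopf_mod M)).
exact: lcomodP.
Qed.

Lemma takeuchi_correspondence_MAH : inverse_bijections
  (fun A : rcSubalg H => forall M : hopfmod_MAH A, projective M)
  (fun C : factorCoalg H => forall M : hopfmod_CHM C, lcomod_injective (CHM_lcomod M))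
  (@takeuchi_factor k H) (@takeuchi_subalg k H).
Proof.
split=> [A /MAH_sections|C /CHM_split splitC|A /MAH_sections secA|C /CHM_split splitC].
- exact: takeuchi_factor_injective.
- exact: (MAH_projective (factor_quotient C) (coinv_sum C) splitC).
- pose C := takeuchi_factor A; apply: rcSubalg_eq => a.
  have E := coinv_subalg_iff (factor_quotient C) (fproj0 C) secA a.
  by apply/idP/idP => [/coinv_sum/E|/E/coinv_sum].
apply: factorCoalg_eq => x.
have E := quot_ker_HAplus (factor_quotient C) (coinv_sum C) splitC x.
by apply/idP/idP => [/E/fproj0|/fproj0/E].
Qed.

End RightModulesOverSubalgebra.

(** * Left modules *)

Section Converse.
Variables (k : fieldType) (H : hopfType k) (T : H -> H).
Hypotheses (ST : cancel (@antipode k H) T) (TS : cancel T (@antipode k H)).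
Let Hc := converse_hopf ST TS.
Let T_lin : lin T := inv_antipode_lin ST TS.

Lemma inv_antipode1 : T 1 = 1.
Proof. by rewrite -{1}(antipode1 H) ST. Qed.

Lemma counit_inv_antipode h : counit (T h) = counit h.
Proof.
have hc : lin (V := k^o) (fun x : H => counit (T x)) by lin.
have he : lin (V := k^o) (@counit k H) by move=> a x y; rewrite linearP.
have := inv_antipode_suml ST TS h he; rewrite counit1 [in RHS]/GRing.scale /= mulr1 => <-.
rewrite -[LHS](counitr_sum h hc); apply: (@eq_tlift _ _ _ k^o) => x y.
by rewrite counitM.
Qed.

Section Subalgebra.
Variable A : rcSubalg H.

Let A_subalg : GRing.subalg_closed (rcs_pred A : {pred Hc}).
Proof.
have [A1 Alin AM] := rcs_subalg A.
by split=> // a b aA bA; exact: AM.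
Qed.

Definition converse_subalg : rcSubalg Hc := RCSubalg A_subalg (@rcs_coideal k H A).

(** In [H^c] the ideal is [A^+ H]. If [counit a = 0], then [\sum T h T(a_2) (a_1 - counit a_1)]
    equals [- T h T a], because [T(a_2) a_1] collapses; as [a_1] is in [A], this puts [T (a h)] into
    [H A^+]. The converse is the mirror computation with [a_1 S(a_2)]. *)
Lemma HAplus_converse x : x \in HAplus converse_subalg <-> T x \in HAplus A.
Proof.
have augP a : a \in rcs_pred A -> a - counit a *: 1 \in rcs_pred A /\ counit (a - counit a *: 1) = 0.
  move=> aA; split; first by apply: rpredB => //; apply: rpredZ; exact: rpred1.
  by rewrite linearB linearZ /= counit1 mulr1 subrr.
split=> [|xA].
  apply: (lspan_map (f := mklin T_lin)) => _ [h [a [aA ea ->]]] /=.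
  have {}ea : @counit k H a = 0 := ea.
  rewrite -[h * a]/((a : H) * (h : H)) (inv_antipodeM ST TS).
  pose F (u v : H) := T h * T v * (u - counit u *: 1).
  have hF : bil F by rewrite /F; lin.
  have FE : tlift F (comul a) = - (T h * T a).
    transitivity (\tsum_(u, v <- comul a) (T h * (T v * u)) - \tsum_(u, v <- comul a) (counit u *: (T h * T v))).
      rewrite -tsumB; apply: eq_tlift => u v.
      by rewrite /F mulrBr mulrA -scalerAr mulr1.
    rewrite (inv_antipode_sumr ST TS (f := fun u => T h * u)); last by lin.
    by rewrite (counitl_sum (f := fun v => T h * T v)) ?ea ?scale0r ?sub0r //; lin.
  rewrite -[_ * _]opprK rpredN -FE.
  apply: (tsubl_sub hF (rcs_coideal aA)) => u v /augP[uA eu].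
  by apply: lspan_gen; exists (T h * T v), (u - counit u *: 1).
rewrite -[x]TS; apply: (lspan_map (f := @antipode k H)) xA => _ [h [a [aA ea ->]]].
rewrite [X in X \in _]antipodeM.
pose F (u v : H) := (u - counit u *: 1) * (antipode v * antipode h).
have hF : bil F by rewrite /F; lin.
have FE : tlift F (comul a) = - (antipode a * antipode h).
  transitivity (\tsum_(u, v <- comul a) (u * antipode v * antipode h) -
      \tsum_(u, v <- comul a) (counit u *: (antipode v * antipode h))).
    rewrite -tsumB; apply: eq_tlift => u v.
    by rewrite /F mulrBl mulrA -scalerAl mul1r.
  rewrite (antipoder_sum (f := fun u => u * antipode h)); last by lin.
  by rewrite (counitl_sum (f := fun v => antipode v * antipode h)) ?ea ?scale0r ?sub0r //; lin.
rewrite -[_ * _]opprK rpredN -FE.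
apply: (tsubl_sub hF (rcs_coideal aA)) => u v /augP[uA eu].
by apply: lspan_gen; exists (antipode v * antipode h), (u - counit u *: 1).
Qed.

End Subalgebra.

Section Quotient.
Variables (C : coalgType k) (pi : {linear H -> C}) (act : H -> C -> C).
Hypothesis qC : is_quotient pi act.
Let hact := act_bil qC.

Let cpi_lin : lin (fun h : Hc => pi (T h) : cop C).
Proof. by move=> a x y; rewrite T_lin linearP. Qed.

Definition converse_quot : {linear Hc -> cop C} := mklin cpi_lin.
Definition converse_act (h : Hc) (c : cop C) : cop C := act (T h) c.

(** [S^{-1}] reverses products, which makes [pi] composed with it linear over [H^c], and it reverses
    coproducts, which is why the target is [cop C]. *)
Lemma converse_quotient : is_quotient converse_quot converse_act.
Proof.
split=> [c|h|h|h x].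
- by have [h <-] := quot_surj qC c; exists (antipode h); rewrite /= ST.
- rewrite cop_comulE -[converse_quot h]/(pi (T h)) (quot_comul qC).
  rewrite (comul_inv_antipode_sum ST TS); last by lin.
  by rewrite (lin_tsum (f := @tswap _ _ _)); [apply: eq_tlift => x y; rewrite tswap_tens | exact: tswap_lin].
- by rewrite cop_counitE -[converse_quot h]/(pi (T h)) (quot_counit qC) counit_inv_antipode.
- by rewrite /converse_act /= (quot_act qC) -(inv_antipodeM ST TS).
Qed.

(** Apply [c ⊗ h |-> \sum h_1 c ⊗ h_2] to the equation for [pi T]: the left side becomes
    [\sum pi (a_2 T(a_1)) ⊗ a_3 = pi 1 ⊗ a], the right side [\sum pi a_1 ⊗ a_2]. The other direction
    uses [c ⊗ h |-> \sum T(h_1) c ⊗ h_2]. *)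
Lemma converse_coinv (a : H) :
  \tsum_(x, y <- @comul k Hc a) converse_quot x ⊗ y = converse_quot 1 ⊗ a <->
  \tsum_(x, y <- comul a) pi x ⊗ y = pi 1 ⊗ a.
Proof.
split=> E.
- have := congr1 (tlift (fun c h => \tsum_(h1, h2 <- comul (h : H)) act h1 c ⊗ h2)) E.
  rewrite tsum_tsum; last by lin.
  rewrite [X in _ = X -> _]tliftE; last by lin.
  rewrite [X in _ = X -> _](_ : _ = \tsum_(x, y <- comul a) pi x ⊗ y); last first.
    by apply: eq_tlift => x y; rewrite /= inv_antipode1 (quot_act qC) mulr1.
  move=> <-.
  transitivity (\tsum_(x, y <- comul a) \tsum_(y1, y2 <- comul y) pi (y1 * T x) ⊗ y2).
    apply: eq_tlift => x y; rewrite tliftE; last by lin.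
    by apply: eq_tlift => y1 y2; rewrite /= (quot_act qC).
  rewrite -(comulA_sum (F := fun x y1 y2 => pi (y1 * T x) ⊗ y2)); last by split=> *; lin.
  rewrite -[RHS](counitl_sum (f := fun y => pi 1 ⊗ y)); last by lin.
  apply: eq_tlift => x y.
  by rewrite (inv_antipode_suml ST TS (f := fun u => pi u ⊗ y)) //; lin.
have := congr1 (tlift (fun c h => \tsum_(h1, h2 <- comul (h : H)) (act (T h1) c : cop C) ⊗ (h2 : Hc))) E.
rewrite tsum_tsum; last by lin.
rewrite [X in _ = X -> _]tliftE; last by lin.
rewrite [X in _ = X -> _](_ : _ = \tsum_(x, y <- @comul k Hc a) converse_quot x ⊗ y); last first.
  by apply: eq_tlift => x y; rewrite /= (quot_act qC) mulr1.
move=> <-; rewrite [in RHS]/= inv_antipode1.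
transitivity (\tsum_(x, y <- comul a) \tsum_(y1, y2 <- comul y) (pi (T y1 * x) : cop C) ⊗ (y2 : Hc)).
  apply: eq_tlift => x y; rewrite tliftE; last by lin.
  by apply: eq_tlift => y1 y2; rewrite (quot_act qC).
rewrite -(comulA_sum (F := fun x y1 y2 => (pi (T y1 * x) : cop C) ⊗ (y2 : Hc))); last by split=> *; lin.
rewrite -[RHS](counitl_sum (f := fun y => (pi 1 : cop C) ⊗ (y : Hc))); last by lin.
apply: eq_tlift => x y.
by rewrite (inv_antipode_sumr ST TS (f := fun u => (pi u : cop C) ⊗ (y : Hc))) //; lin.
Qed.

End Quotient.
End Converse.

Section LeftModulesOverSubalgebra.
Variables (k : fieldType) (H : hopfType k) (T : H -> H).
Hypotheses (ST : cancel (@antipode k H) T) (TS : cancel T (@antipode k H)).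
Variable A : rcSubalg H.
Let Hc := converse_hopf ST TS.
Let Ac : rcSubalg Hc := converse_subalg ST TS A.

Section LeftActions.
Variables (X : lmodType k) (ra : X -> Hc -> X).
Hypotheses (ra_bil : bil ra) (ra1 : forall x, ra x 1 = x)
  (raM : forall x a b, a \in rcs_pred Ac -> b \in rcs_pred Ac -> ra (ra x a) b = ra x (a * b)).

Lemma left_action_bil : bil (fun (a : rcs_alg A) (x : X) => ra x (rcs_val a)).
Proof.
split=> [x a b c|a]; last exact: ra_bil.1.
by rewrite -(ra_bil.2 x) linearP.
Qed.

Lemma left_action1 x : ra x (rcs_val (1 : rcs_alg A)) = x.
Proof. by rewrite rcs_val1 ra1. Qed.

Lemma left_actionM (a b : rcs_alg A) x :
  ra x (rcs_val (a * b)) = ra (ra x (rcs_val b)) (rcs_val a).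
Proof. by rewrite rcs_valM raM //; exact: valP. Qed.

Definition left_action : alg_action (rcs_alg A) X :=
  AlgAction left_action_bil left_action1 left_actionM.

End LeftActions.

Lemma AMH_sections : (forall M : hopfmod_AMH A, projective M) -> hopf_sections Ac.
Proof.
move=> projA X ra rho hX Y rt p rt_bil rt1 rtM p_ra p_surj.
have [ra_bil ra1 raM rhoC rho_ra] := hX.
pose mX := left_action ra_bil ra1 raM; pose mY := left_action rt_bil rt1 rtM.
pose to : {linear X -> kspace (actmod mX)} := to_kspace mX.
pose fr : {linear kspace (actmod mX) -> X} := @of_kspace _ _ _ mX.
have [co [coE comod]] := transport_rcomod (C := H) (to := to) (fr := fr) (fun=> erefl) (fun=> erefl) rhoC.
have compat (a : rcs_alg A) (m : kspace (actmod mX)) :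
    co (kact a m) = tact (fun a m => kact a m) (fun x y => x * y) (rcs_comul a) (co m).
  have hk : bil (fun (a : rcs_alg A) (m : kspace (actmod mX)) => kact a m).
    by apply: bilP; exact: kact_bilinear.
  rewrite -[m]/(to (fr m)); move: (fr m) => {m} x.
  rewrite -[kact _ _]/(to (ra x (rcs_val a))) !coE rho_ra; last exact: valP.
  rewrite (rcs_comul_sum (A := A) (F := fun a1 a2 : H => \tsum_(y, h <- rho x) ra y a1 ⊗ ((a2 : H) * (h : H)))); last first.
    by lin.
  rewrite /tact /tmap tsum_tsum; last by lin.
  apply: eq_tlift => a1 a2; rewrite [RHS]tsum_tsum; last by lin.
  rewrite [LHS]tsum_tsum; last by lin.
  by apply: eq_tlift => y h; rewrite !tliftE //; lin.
have [|g [gB gK]] := projective_section (mV := mX) (mW := mY) (p := p)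
    (projA (HopfMod_AMH comod compat)) _ p_surj.
  by move=> b t; rewrite /= p_ra //; exact: valP.
exists g; split=> // x a /rcs_valE[b <-]; exact: gB.
Qed.

Section Unbundling.
Variables (C : coalgType k) (pi : {linear Hc -> C}) (act : Hc -> C -> C).
Hypothesis qC : is_quotient pi act.
Hypothesis coinvA : forall a, a \in rcs_pred Ac <-> \tsum_(x, y <- comul a) pi x ⊗ y = pi 1 ⊗ a.
Hypothesis splitC : coactions_split act.

Lemma AMH_projective (M : hopfmod_AMH A) : projective M.
Proof.
have [w wK] := rcs_retraction A.
have hk : bil (fun (a : rcs_alg A) (m : kspace M) => kact a m) by apply: bilP; exact: kact_bilinear.
pose ra (m : kspace M) (h : Hc) : kspace M := kact (w h) m.
have ra_bil : bil ra by rewrite /ra; lin.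
have bv_lin : lin (fun a : rcs_alg A => rcs_val a : Hc) := linE (@rcs_val k H A).
have [bv bvE] : exists bv : {linear rcs_alg A -> Hc}, forall a, bv a = rcs_val a.
  by exists (mklin bv_lin).
have raE m (a : rcs_alg A) : ra m (rcs_val a) = kact a m by rewrite /ra wK.
have hM : is_right_hopf_mod Ac ra (AMH_coact M).
  split=> // [m|m _ _ /rcs_valE[a <-] /rcs_valE[b <-]||m _ /rcs_valE[a <-]].
  - by rewrite -[ra m _]/(ra m (1 : H)) -(rcs_val1 A) raE; exact: (@scale1r (rcs_alg A) M).
  - rewrite -[X in _ = ra m X]/((rcs_val b : H) * rcs_val a) -rcs_valM !raE.
    exact: (@scalerA (rcs_alg A) M).
  - exact: AMH_comod.
  rewrite raE AMH_compat [RHS](rcs_comul_sum (A := A) (F := fun a1 a2 : H =>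
    \tsum_(x, y <- AMH_coact M m) ra x a1 ⊗ (a2 * y))); last by lin.
  rewrite /tact /tmap; apply: eq_tlift => a1 a2.
  by apply: eq_tlift => x y; rewrite raE.
apply: (hopf_projective qC coinvA splitC hM (bv := bv)) => [b|a /rcs_valE[b <-]|b c|b c|b m].
- by rewrite bvE; exact: valP.
- by exists b; rewrite bvE.
- by rewrite !bvE; exact: val_inj.
- by rewrite !bvE rcs_valM.
- by rewrite bvE raE.
Qed.

End Unbundling.
End LeftModulesOverSubalgebra.

Lemma tswap_tmap (k : fieldType) (U V U' V' : lmodType k) (f : {linear U -> U'})
    (g : {linear V -> V'}) t : tswap (tmap f g t) = tmap g f (tswap t).
Proof.
rewrite /tmap (lin_tsum (f := @tswap _ _ _)); last exact: tswap_lin.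
rewrite tswap_sum; last by lin.
by apply: eq_tlift => u v; rewrite tswap_tens.
Qed.

Section RightComodules.
Variables (k : fieldType) (H : hopfType k) (T : H -> H).
Hypotheses (ST : cancel (@antipode k H) T) (TS : cancel T (@antipode k H)).
Variable C : factorCoalg H.
Let Hc := converse_hopf ST TS.
Let cC : coalgType k := cop (factor C).
Let cact : Hc -> cC -> cC := @converse_act _ _ _ ST TS (factor C) (@factor_act k H C).

(** A left [H]-module becomes a left module over [H^c] through the anti-automorphism [T], and
    swapping the tensor factors turns the right coaction into a left one over the reversed
    coalgebra. *)
Lemma HMC_hopf_mod (M : hopfmod_HMC C) (lam : {linear kspace M -> (cC ⊗ kspace M)%type}) :
  (forall m, lam m = tswap (HMC_coact M m)) ->
  is_hopf_mod cact (fun (h : Hc) (m : kspace M) => kact (T h) m) lam.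
Proof.
move=> lamE; have T_lin : lin T := inv_antipode_lin ST TS.
have hk : bil (fun h (m : kspace M) => kact h m) by apply: bilP; exact: kact_bilinear.
have hact := act_bil (factor_quotient C).
have hcact : bil cact := act_bil (converse_quotient ST TS (factor_quotient C)).
split.
- split=> [|m|g h m]; first by lin.
  + by rewrite -[T 1]/(T (1 : H)) (inv_antipode1 ST); exact: (@scale1r H M).
  + by rewrite -[g * h]/((h : H) * (g : H)) (inv_antipodeM ST TS); exact/esym/(@scalerA H M).
- exact: (eq_ind_r (is_lcomod (C := cC) (M := kspace M)) (lcomod_cop (HMC_comod M)) (funext lamE)).
move=> h m; rewrite !lamE HMC_compat /tact /tmap.
rewrite (comul_inv_antipode_sum ST TS); last by lin.
rewrite (lin_tsum (f := @tswap _ _ _)); last exact: tswap_lin.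
apply: eq_tlift => x y; rewrite tswap_sum; last by lin.
rewrite (lin_tsum (f := @tswap _ _ _)); last exact: tswap_lin.
by apply: eq_tlift => m' c; rewrite tswap_tens.
Qed.

Let lcoact_lin (P : rcomod (factor C)) : lin (fun p : P => tswap (rcoact P p) : (cC ⊗ P)%type).
Proof. by lin. Qed.

Lemma HMC_injective (A : rcSubalg Hc) :
  (forall x : Hc, converse_quot ST TS (@fproj k H C) x = 0 <-> x \in HAplus A) ->
  hopf_sections A -> forall M : hopfmod_HMC C, rcomod_injective (HMC_rcomod M).
Proof.
move=> ker_pi secA M N P i f iC fC i_inj.
have hM := HMC_hopf_mod (lam := mklin (lcoact_lin (P := HMC_rcomod M))) (fun m => erefl).
have [|||g [gC gi]] := hopf_mod_extension (converse_quotient ST TS (factor_quotient C)) ker_pi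
  (sections_split secA) hM (lamP := mklin (lcoact_lin (P := P))) (lcomod_cop (rcomodP P))
  (lamN := mklin (lcoact_lin (P := N))) (i := i) (f := f) => //.
- by move=> n; rewrite /= iC tswap_tmap.
- by move=> n; rewrite -[LHS]/(tswap (rcoact (HMC_rcomod M) (f n))) fC tswap_tmap.
exists g; split=> // p; apply: (can_inj (@tswapK _ _ _)).
by rewrite tswap_tmap; exact: gC.
Qed.

Lemma HMC_split : (forall M : hopfmod_HMC C, rcomod_injective (HMC_rcomod M)) ->
  coactions_split cact.
Proof.
move=> injC M ha lam [[ha_bil ha1 haM] lamC lam_ha].
have hact := act_bil (factor_quotient C).
have hcact : bil cact := act_bil (converse_quotient ST TS (factor_quotient C)).
(* Acting through the antipode undoes the twist by [T] and returns a left [H]-module. *)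
have aS_bil : bil (fun (h : H) (m : M) => ha (antipode h) m) by lin.
have aS1 m : ha (antipode (1 : H)) m = m by rewrite antipode1; exact: ha1.
have aSM (g h : H) m : ha (antipode (g * h)) m = ha (antipode g) (ha (antipode h) m).
  by rewrite antipodeM; exact: haM.
pose mM := AlgAction aS_bil aS1 aSM.
pose to : {linear M -> kspace (actmod mM)} := to_kspace mM.
pose fr : {linear kspace (actmod mM) -> M} := @of_kspace _ _ _ mM.
have [l [lE lC]] := transport_lcomod (to := to) (fr := fr) (fun=> erefl) (fun=> erefl) lamC.
have co_lin : lin (fun m => tswap (l m) : (kspace (actmod mM) ⊗ factor C)%type) by lin.
have [co coE] : exists co : {linear kspace (actmod mM) -> (kspace (actmod mM) ⊗ factor C)%type},
    forall m, co m = tswap (l m) by exists (mklin co_lin).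
have comod : is_rcomod co.
  exact: (eq_ind_r (is_rcomod (C := factor C) (M := kspace (actmod mM))) (rcomod_cop lC) (funext coE)).
have compat (h : H) (m : kspace (actmod mM)) : co (kact h m) =
    tact (fun h m => kact h m) (fun h c => factor_act h c) (comul h) (co m).
  have hk : bil (fun h (m : kspace (actmod mM)) => kact h m) by apply: bilP; exact: kact_bilinear.
  rewrite -[m]/(to (fr m)); move: (fr m) => {m} x.
  rewrite -[kact _ _]/(to (ha (antipode h) x)) !coE !lE lam_ha /diag_act /tact /tmap.
  transitivity (\tsum_(h1, h2 <- comul (antipode h))
      \tsum_(c, y <- lam x) to (ha h2 y) ⊗ factor_act (T h1) c).
    rewrite tsum_tsum; last by lin.
    rewrite (lin_tsum (f := @tswap _ _ _)); last exact: tswap_lin.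
    apply: eq_tlift => h1 h2; rewrite tsum_tsum; last by lin.
    rewrite (lin_tsum (f := @tswap _ _ _)); last exact: tswap_lin.
    by apply: eq_tlift => c y; rewrite tliftE ?tswap_tens //; lin.
  have T_lin : lin T := inv_antipode_lin ST TS.
  rewrite comul_antipode_sum; last by lin.
  apply: eq_tlift => h1 h2; rewrite tswap_sum; last by lin.
  rewrite [RHS]tsum_tsum; last by lin.
  by apply: eq_tlift => c y; rewrite tliftE ?ST //; lin.
have i_col m : tswap (cofree_coact cC (kspace (actmod mM)) (l m)) = tmap l idfun (co m).
  by rewrite [cofree_coact _ _ _]lC.1 tswap_tmap coE.
have R_lin : lin (fun t => tswap (cofree_coact cC (kspace (actmod mM)) t)
  : ((cC ⊗ kspace (actmod mM)) ⊗ factor C)%type) by lin.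
have R_comod : is_rcomod (C := factor C) (mklin R_lin) := rcomod_cop (cofree_comod cC (kspace (actmod mM))).
have [|//||g [gC gK]] := injC (HopfMod_HMC comod compat) (RComod comod) (RComod R_comod) l idfun.
- exact: i_col.
- by move=> m; rewrite /= /tmap tsum_id.
- exact: lcomod_counit_inj lC.
apply: (transport_retraction (to := to) (fr := fr) (fun=> erefl) (fun=> erefl) lE gK) => t.
have cE : co (g t) = tmap g idfun (tswap (cofree_coact _ _ t)) := gC _.
by apply: (can_inj (@tswapK _ _ _)); rewrite -coE cE tswap_tmap.
Qed.

End RightComodules.

Section LeftModulesOverSubalgebraCorrespondence.
Variables (k : fieldType) (H : hopfType k) (T : H -> H).
Hypotheses (ST : cancel (@antipode k H) T) (TS : cancel T (@antipode k H)).

Lemma fproj_converse (A : rcSubalg H) x :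
  converse_quot ST TS (@fproj k H (takeuchi_factor A)) x = 0 <->
  x \in HAplus (converse_subalg ST TS A).
Proof. by rewrite HAplus_converse; exact: fproj0. Qed.

Lemma takeuchi_correspondence_AMH : inverse_bijections
  (fun A : rcSubalg H => forall M : hopfmod_AMH A, projective M)
  (fun C : factorCoalg H => forall M : hopfmod_HMC C, rcomod_injective (HMC_rcomod M))
  (@takeuchi_factor k H) (@takeuchi_subalg k H).
Proof.
have qC C := converse_quotient ST TS (factor_quotient C).
have coinvC (C : factorCoalg H) (a : H) :=
  iff_trans (coinv_sum C a) (iff_sym (converse_coinv ST TS (factor_quotient C) a)).
have sec A := @AMH_sections _ _ _ ST TS A; have spl C := @HMC_split _ _ _ ST TS C.
split=> [A /sec|C /spl splitC|A /sec secA|C /spl splitC].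
- exact: HMC_injective (fproj_converse A).
- exact: (AMH_projective (qC C) (coinvC C) splitC).
- pose C := takeuchi_factor A; apply: rcSubalg_eq => a.
  have E := coinv_subalg_iff (qC C) (fproj_converse A) secA a.
  by apply/idP/idP => [/coinvC/E|/E/coinvC].
apply: factorCoalg_eq => x.
(* Taken at [antipode x], since [converse_quot] and [HAplus_converse] both insert [T], which brings
   back [x]. *)
have := quot_ker_HAplus (A := converse_subalg ST TS (takeuchi_subalg C)) (qC C) (coinvC C) splitC (antipode x).
rewrite HAplus_converse /= ST => E.
by apply/idP/idP => [/E/fproj0|/fproj0/E].
Qed.

End LeftModulesOverSubalgebraCorrespondence.

Theorem theorem8p4 (k : fieldType) (H : hopfType k)
    (antipode_bij : bijective (@antipode k H)) :
  inverse_bijections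
    (fun A : rcSubalg H => forall M : hopfmod_MAH A, projective M)
    (fun C : factorCoalg H =>
       forall M : hopfmod_CHM C, lcomod_injective (CHM_lcomod M))
    (@takeuchi_factor k H) (@takeuchi_subalg k H)
  /\
  inverse_bijections
    (fun A : rcSubalg H => forall M : hopfmod_AMH A, projective M)
    (fun C : factorCoalg H =>
       forall M : hopfmod_HMC C, rcomod_injective (HMC_rcomod M))
    (@takeuchi_factor k H) (@takeuchi_subalg k H).
Proof.
have [T ST TS] := antipode_bij.
by split; [exact: takeuchi_correspondence_MAH | exact: takeuchi_correspondence_AMH ST TS].
Qed.
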